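(* Let $N\ge2$, $s\in(0,1)$ and $\mu\ge\mu_0$. For any $\xi\in C^2_c(\mathbb{R}^N)$ we have $$\int_{\mathbb{R}^N}\Phi_\mu\,(-\Delta)^s_{\Gamma_\mu}\xi\,dx=c_{s,\mu}\,\xi(0),$$ where the normalization constant $c_{s,\mu}>0$ is given by $$c_{s,\mu}:=\begin{cases}\displaystyle C_{N,s}\,\omega_{N-1}\int_0^1\frac1t\int_{B_t}\frac{|z|^{\tau_-(s,\mu)}-|z|^{\tau_+(s,\mu)}}{|e_1-z|^{N+2s}}\,dz\,dt&\text{if }\mu>\mu_0,\\[3mm]\displaystyle C_{N,s}\,\omega_{N-1}\int_0^1\frac1t\int_{B_t}\frac{|z|^{\frac{2s-N}{2}}(-\ln|z|)}{|e_1-z|^{N+2s}}\,dz\,dt&\text{if }\mu=\mu_0.\end{cases}$$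
   Context: $B_t$ is the open ball of radius $t$ centered at $0$, $\omega_{N-1}$ is the measure of the unit sphere in $\mathbb{R}^N$, $e_1=(1,0,\dots,0)$, $C_{N,s}=2^{2s}\pi^{-N/2}s\,\Gamma(\frac{N+2s}{2})/\Gamma(1-s)$, and $\mu_0=-2^{2s}\Gamma^2(\frac{N+2s}{4})/\Gamma^2(\frac{N-2s}{4})$, with $\Gamma(\cdot)$ the Gamma function. Let $c_s(\tau)=2^{2s}\frac{\Gamma(\frac{N+\tau}{2})\Gamma(\frac{2s-\tau}{2})}{\Gamma(-\frac{\tau}{2})\Gamma(\frac{N-2s+\tau}{2})}$ for $\tau\in(-N,2s)$ (with $1/\Gamma=0$ at poles of $\Gamma$). For $\mu\ge\mu_0$, $\tau_-(s,\mu)\in(-N,\frac{2s-N}{2}]$ and $\tau_+(s,\mu)\in[\frac{2s-N}{2},2s)$ denote the unique solutions in these intervals of $c_s(\tau)=-\mu$. Set $\Phi_\mu(x)=|x|^{\tau_-(s,\mu)}$ if $\mu>\mu_0$, $\Phi_{\mu_0}(x)=-|x|^{\tau_-(s,\mu_0)}\ln|x|$, and $\Gamma_\mu(x)=|x|^{\tau_+(s,\mu)}$. The weighted fractional Laplacian is $$(-\Delta)^s_{\Gamma_\mu}v(x):=C_{N,s}\lim_{\epsilon\to0^+}\int_{\mathbb{R}^N\setminus B_\epsilon(x)}\frac{v(x)-v(z)}{|x-z|^{N+2s}}\,\Gamma_\mu(z)\,dz,\qquad x\in\mathbb{R}^N\setminus\{0\}.$$ *)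

(* Defs.v *)
From HB Require Import structures.
From mathcomp Require Import all_boot all_order all_algebra.
From mathcomp Require Import all_classical all_reals all_analysis.

Set Implicit Arguments.
Unset Strict Implicit.
Unset Printing Implicit Defensive.

Import Order.TTheory GRing.Theory Num.Theory.
Import numFieldNormedType.Exports.

Local Open Scope classical_set_scope.
Local Open Scope ring_scope.

(* The sigma-algebra of R^n is generated by the coordinates, exactly as the
   library does for n.-tuple; it is the Borel sigma-algebra. *)
Definition rV_display : measure_display.
Proof. by []. Qed.

Section measurable_rV.
Context {R : realType} (n : nat).

Let coords : 'I_n -> 'rV[R]_n -> measurableTypeR R := fun i x => x ord0 i.

Let rV_set0 : g_sigma_preimage coords set0.
Proof. exact: sigma_algebra0. Qed.

Let rV_setC A : g_sigma_preimage coords A -> g_sigma_preimage coords (~` A).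
Proof. exact: sigma_algebraC. Qed.

Let rV_bigcup (F : (set 'rV[R]_n)^nat) :
  (forall i, g_sigma_preimage coords (F i)) ->
  g_sigma_preimage coords (\bigcup_i (F i)).
Proof. exact: sigma_algebra_bigcup. Qed.

HB.instance Definition _ := @isMeasurable.Build rV_display
  'rV[R]_n (g_sigma_preimage coords) rV_set0 rV_setC rV_bigcup.

Lemma measurable_coord (i : 'I_n) :
  measurable_fun [set: 'rV[R]_n] (fun x => x ord0 i : measurableTypeR R).
Proof.
move=> _ Y mY; rewrite setTI; apply: sub_sigma_algebra => /=.
rewrite -bigcup_seq/=; exists i => /=; first by rewrite mem_index_enum.
by exists Y => //; rewrite setTI.
Qed.

Lemma measurable_fun_coordP d (T : measurableType d) (f : T -> 'rV[R]_n) :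
  (forall i, measurable_fun [set: T]
               (fun x => f x ord0 i : measurableTypeR R)) ->
  measurable_fun [set: T] f.
Proof.
move=> mf _ A mA; rewrite setTI.
suff : <<s \big[setU/set0]_(i < n)
    preimage_set_system setT (coords i) measurable >> `<=`
    [set B | measurable (f @^-1` B)] by apply.
apply: smallest_sub.
  split => /=.
  - by rewrite preimage_set0.
  - by move=> B mB; rewrite setTD preimage_setC; exact: measurableC.
  - by move=> F mF; rewrite preimage_bigcup; exact: bigcup_measurable.
rewrite -bigcup_seq => B [i _] [C mC <-] /=.
by rewrite setTI -[X in measurable X]setTI; exact: mf.
Qed.

End measurable_rV.

Section lebesgue_rV.
Context {R : realType}.

Definition rV_cons n (p : 'rV[R]_n * measurableTypeR R) : 'rV[R]_n.+1 :=
  row_mx (const_mx p.2 : 'rV[R]_1) p.1.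

Lemma measurable_rV_cons n : measurable_fun setT (@rV_cons n).
Proof.
apply: measurable_fun_coordP => i.
rewrite /rV_cons; case: (split_ordP (i : 'I_(1 + n))) => j ->.
  rewrite (_ : (fun _ => _) = snd); first exact: measurable_snd.
  by apply/funext => x; rewrite [LHS]row_mxEl mxE.
rewrite (_ : (fun _ => _) =
    fun x : 'rV[R]_n * measurableTypeR R => x.1 ord0 j).
  by apply: (@measurableT_comp _ _ _ _ _ _
    (fun x : 'rV[R]_n => x ord0 j : measurableTypeR R));
    [exact: measurable_coord|exact: measurable_fst].
by apply/funext => x; rewrite [LHS]row_mxEr.
Qed.

Definition lebesgue_rV_succ n (m : {measure set 'rV[R]_n -> \bar R}) :
    {measure set 'rV[R]_n.+1 -> \bar R} :=
  measure_function_pushforward__canonical__measure_function_Measure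
    (m \x @lebesgue_measure R)%E (@measurable_rV_cons n).

Fixpoint lebesgue_rV (n : nat) : {measure set 'rV[R]_n -> \bar R} :=
  if n is m.+1 then lebesgue_rV_succ (lebesgue_rV m) else \d_(0 : 'rV[R]_0).

Lemma lebesgue_rV_box n (A : 'I_n -> set (measurableTypeR R)) :
  (forall i, measurable (A i)) ->
  lebesgue_rV n [set x | forall i, A i (x ord0 i)]
  = (\prod_(i < n) lebesgue_measure (A i))%E.
Proof.
elim: n A => [|n IH] A mA.
  by rewrite big_ord0 /= diracE mem_set// => -[].
rewrite big_ord_recl.
pose B := [set x : 'rV[R]_n | forall i, A (lift ord0 i) (x ord0 i)].
have mB : measurable B.
  rewrite (_ : B = \big[setI/setT]_(i < n)
      ((fun x : 'rV[R]_n => x ord0 i : measurableTypeR R)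
        @^-1` A (lift ord0 i))).
    apply: bigsetI_measurable => i _.
    by rewrite -[X in measurable X]setTI; exact: measurable_coord.
  rewrite -bigcap_seq; apply/seteqP; split => [x xB i _|x xB i]; first exact: xB.
  by apply: (xB i); rewrite /= mem_index_enum.
transitivity ((lebesgue_rV n \x @lebesgue_measure R)%E (B `*` A ord0)).
  congr ((lebesgue_rV n \x @lebesgue_measure R)%E _).
  have E0 (x : 'rV[R]_n) a : rV_cons (x, a) ord0 ord0 = a.
    transitivity (row_mx (const_mx a : 'rV[R]_1) x ord0 (@lshift 1 n ord0)).
      by congr (row_mx _ _ _ _); exact/val_inj.
    by rewrite row_mxEl mxE.
  have E1 (x : 'rV[R]_n) a i : rV_cons (x, a) ord0 (lift ord0 i) = x ord0 i.
    transitivity (row_mx (const_mx a : 'rV[R]_1) x ord0 (rshift 1 i)).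
      by congr (row_mx _ _ _ _); exact/val_inj.
    by rewrite row_mxEr.
  apply/seteqP; split => -[x a] /=.
    move=> xaA; split; last by have := xaA ord0; rewrite E0.
    by move=> i; have := xaA (lift ord0 i); rewrite E1.
  move=> [xB aA] i; case: (unliftP ord0 i) => [j|] ->; last by rewrite E0.
  by rewrite E1; exact: xB.
rewrite product_measure1E// muleC; congr (_ * _)%E.
exact: (IH (fun i => A (lift ord0 i))).
Qed.

End lebesgue_rV.

Section euclidean.
Context {R : realType} (N : nat).

(* The norm `|x| that the library puts on 'rV[R]_N is the sup norm. *)
Definition enorm (x : 'rV[R]_N) : R := Num.sqrt (\sum_i x ord0 i ^+ 2).

Definition eball (x : 'rV[R]_N) (r : R) : set 'rV[R]_N :=
  [set y | enorm (y - x) < r].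

Definition e1 : 'rV[R]_N := \row_i (i == 0%N :> nat)%:R.

Definition cone (A : set 'rV[R]_N) : set 'rV[R]_N :=
  [set r *: u | r in [set` `]0, 1]] & u in A].

(* For A in the unit sphere: the surface measure sigma of polar coordinates
   dx = r^(N-1) dr dsigma, normalised by integrating r^(N-1) over ]0, 1]. *)
Definition surface_measure (A : set 'rV[R]_N) : \bar R :=
  (N%:R%:E * lebesgue_rV N (cone A))%E.

Definition omega : \bar R := surface_measure [set u | enorm u = 1].

Definition partial (i : 'I_N) (f : 'rV[R]_N -> R) : 'rV[R]_N -> R :=
  'D_(delta_mx ord0 i) f.

Definition is_C1 (f : 'rV[R]_N -> R) : Prop :=
  forall i : 'I_N, (forall x, derivable f x (delta_mx ord0 i)) /\
                   continuous (partial i f).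

Definition is_C2 (f : 'rV[R]_N -> R) : Prop :=
  is_C1 f /\ forall i : 'I_N, is_C1 (partial i f).

Definition is_C2c (f : 'rV[R]_N -> R) : Prop :=
  is_C2 f /\ compact (closure [set x | f x != 0]).

End euclidean.
Arguments e1 {R} N.
Arguments omega R N : clear implicits.

Section gamma.
Context {R : realType}.

Definition gamma_integral (x : R) : R :=
  \int[lebesgue_measure]_(t in `]0, +oo[) (t `^ (x - 1) * expR (- t)).

(* Euler integral for x > 0, extended by Gamma(x) = Gamma(x+n)/(x...(x+n-1)).
   At a pole the denominator vanishes, so that Gamma x = 0 and hence
   (Gamma x)^-1 = 0, which is the convention 1/Gamma = 0. *)
Definition Gamma (x : R) : R :=
  if 0 < x then gamma_integral x
  else let n := (Num.truncn (- x)).+1 in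
       gamma_integral (x + n%:R) / \prod_(k < n) (x + k%:R).

End gamma.

Section hardy.
Context {R : realType} (N : nat) (s : R).

Definition C_Ns : R :=
  2 `^ (2 * s) * pi `^ (- (N%:R / 2)) * s *
  (Gamma ((N%:R + 2 * s) / 2) / Gamma (1 - s)).

Definition mu0 : R :=
  - (2 `^ (2 * s) * (Gamma ((N%:R + 2 * s) / 4) ^+ 2 /
                     Gamma ((N%:R - 2 * s) / 4) ^+ 2)).

Definition c_s (tau : R) : R :=
  2 `^ (2 * s) *
  ((Gamma ((N%:R + tau) / 2) * Gamma ((2 * s - tau) / 2)) /
   (Gamma (- tau / 2) * Gamma ((N%:R - 2 * s + tau) / 2))).

Definition is_tau_minus (mu tau : R) : Prop :=
  (- N%:R < tau <= (2 * s - N%:R) / 2) /\ c_s tau = - mu.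

Definition is_tau_plus (mu tau : R) : Prop :=
  ((2 * s - N%:R) / 2 <= tau < 2 * s) /\ c_s tau = - mu.

(* Below, taum and taup stand for tau_-(s,mu) and tau_+(s,mu); since mu >= mu0,
   the case ~~ (mu0 < mu) is mu = mu0. *)
Definition Phi_mu (mu taum : R) (x : 'rV[R]_N) : R :=
  if mu0 < mu then enorm x `^ taum else - (enorm x `^ taum) * ln (enorm x).

Definition Gamma_mu (taup : R) (x : 'rV[R]_N) : R := enorm x `^ taup.

Definition wfl_trunc (taup : R) (v : 'rV[R]_N -> R) (x : 'rV[R]_N) (eps : R) :
    \bar R :=
  (\int[lebesgue_rV N]_(z in ~` eball x eps)
     ((v x - v z) / enorm (x - z) `^ (N%:R + 2 * s) * Gamma_mu taup z)%:E)%E.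

Definition wfl (taup : R) (v : 'rV[R]_N -> R) (x : 'rV[R]_N) : \bar R :=
  (C_Ns%:E * lim (wfl_trunc taup v x eps @[eps --> 0^'+]))%E.

Definition c_smu (mu taum taup : R) : \bar R :=
  if mu0 < mu then
    (C_Ns%:E * omega R N *
     \int[lebesgue_measure]_(t in `]0%R, 1%R[)
       ((t^-1)%:E * \int[lebesgue_rV N]_(z in eball 0 t)
          ((enorm z `^ taum - enorm z `^ taup) /
           enorm (e1 N - z) `^ (N%:R + 2 * s))%:E))%E
  else
    (C_Ns%:E * omega R N *
     \int[lebesgue_measure]_(t in `]0%R, 1%R[)
       ((t^-1)%:E * \int[lebesgue_rV N]_(z in eball 0 t)
          (enorm z `^ ((2 * s - N%:R) / 2) * - ln (enorm z) /
           enorm (e1 N - z) `^ (N%:R + 2 * s))%:E))%E.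

End hardy.

(* Main.v *)
From HB Require Import structures.
Require Import Defs.
From mathcomp Require Import all_boot all_order all_algebra.
From mathcomp Require Import all_classical all_reals all_analysis.
From mathcomp Require Import measurable_realfun ring lra.

Set Implicit Arguments.
Unset Strict Implicit.
Unset Printing Implicit Defensive.

Import Order.TTheory GRing.Theory Num.Theory.
Import numFieldNormedType.Exports.

Local Open Scope classical_set_scope.
Local Open Scope ring_scope.

(* Write al, be for tau_-, tau_+.  Concavity of t -> t^s makes Gamma(x + s) / Gamma(x)
   close to x^s, and the functional equation propagates this to the monotonicity of c_s
   on either side of (2s - N)/2, about which c_s is symmetric; so al + be = 2s - N and
   Phi(x) Gamma(z) - Phi(z) Gamma(x) = - |x|^(2s-N) p(|z|/|x|) with p > 0 on ]0, 1[.
   Symmetrizing the double integral, the left-hand side becomes the integral of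
   (xi(z) - xi(x)) K(x, z) over |z| < |x|, where the kernel
   K(x, z) = |x|^(2s-N) p(|z|/|x|) |x - z|^(-N-2s) is rotation invariant and homogeneous.
   Restrict K to |z| < th |x|.  By homogeneity its marginals are a |z|^(-N) and b |x|^(-N),
   and comparing the fluxes of K through two spheres gives a = b.  Hence a function that is
   small at 0 and at infinity contributes nothing, and only xi(0) 1_{|x| <= 1} is left; it
   contributes xi(0) times the flux through the unit sphere, which is omega_{N-1} times the
   integral of p(|w|) (- ln |w|) |e1 - w|^(-N-2s) over |w| < th.  Let th tend to 1 and write
   - ln |w| as the integral of 1/t over ]|w|, 1[. *)

(** * Invariance of the Lebesgue measure *)

(** The truncation at [th] is there because for s >= 1/2 the full kernel has infinite marginals: p
    vanishes only to first order at 1, which does not compensate |e1 - w|^(-N-2s) near e1. One more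
    order is gained from xi(z) - xi(x), or from - ln |w|, and then 2 - 2s > 0 suffices. So the
    identity is proved for th < 1, where the marginals are finite and can be compared, and both
    sides pass to the limit th = 1. The principal value is treated separately: at a fixed cut-off
    everything converges absolutely and Fubini applies, while averaging the values at x + k and x -
    k gives a bound uniform in the cut-off. The weight |x|^(-N) diverges logarithmically both at 0
    and at infinity, so the estimates must leave a spare factor min(|x|^h, |x|^(-h)), where h is at
    most a quarter of al + N. The cases mu > mu0 and mu = mu0 differ only in Phi and p; [weights]
    lists the properties that they share. *)

Section lebesgue_rV_theory.
Context {R : realType}.
Implicit Types n : nat.

Definition box n (A : 'I_n -> set R) : set 'rV[R]_n :=
  [set x | forall i, A i (x ord0 i)].

Lemma measurable_box n (A : 'I_n -> set (measurableTypeR R)) :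
  (forall i, measurable (A i)) -> measurable (box A).
Proof.
move=> mA; rewrite (_ : box A = \big[setI/setT]_(i < n)
    ((fun x : 'rV[R]_n => x ord0 i : measurableTypeR R) @^-1` A i)).
  apply: bigsetI_measurable => i _.
  by rewrite -[X in measurable X]setTI; exact: measurable_coord.
rewrite -bigcap_seq; apply/seteqP; split => [x xB i _|x xB i]; first exact: xB.
by apply: (xB i); rewrite /= mem_index_enum.
Qed.

Definition cube n (k : nat) : set 'rV[R]_n :=
  box (fun _ : 'I_n => `[- k%:R, k%:R]%classic).
Arguments cube n k : clear implicits.

Lemma cube_cover n : \bigcup_k cube n k = setT.
Proof.
apply/seteqP; split => // x _.
have [k xk] : exists k : nat, forall i, `|x ord0 i| <= k%:R.
  exists (\max_(i < n) (Num.truncn `|x ord0 i|).+1)%N => i.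
  apply: (@le_trans _ _ (Num.truncn `|x ord0 i|).+1%:R).
    exact/ltW/truncnS_gt.
  by rewrite ler_nat (bigD1 i)//= leq_maxl.
by exists k => // i /=; rewrite in_itv/= -ler_norml.
Qed.

Lemma cube_finite n k : (lebesgue_rV n (cube n k) < +oo)%E.
Proof.
rewrite /cube lebesgue_rV_box//.
pose A : set (measurableTypeR R) := `[- k%:R, k%:R]%classic.
suff /andP[] : (0 <= \prod_(i < n) lebesgue_measure A < +oo)%E by [].
elim/big_ind : _ => [|x y /andP[x0 xoo] /andP[y0 yoo]|i _].
- by rewrite lee01 ltry.
- by rewrite mule_ge0//= lte_mul_pinfty// ge0_fin_numE.
- by rewrite measure_ge0/= lebesgue_measure_itv/=; case: ifPn => _; rewrite -?EFinB ltry.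
Qed.

(** The Lebesgue measure under a name of its own, to which sigma-finiteness can be attached as a
    structure; Fubini and Tonelli ask for it. *)
Definition lam n : set 'rV[R]_n -> \bar R := lebesgue_rV n.
HB.instance Definition _ n := Measure.on (@lam n).

Lemma lam_box n (A : 'I_n -> set (measurableTypeR R)) :
  (forall i, measurable (A i)) ->
  lam (box A) = (\prod_(i < n) lebesgue_measure (A i))%E.
Proof. exact: lebesgue_rV_box. Qed.

Lemma lam_sigma_finite n : sigma_finite setT (@lam n).
Proof.
exists (cube n); first by rewrite cube_cover.
by move=> k; split; [exact: measurable_box|exact: cube_finite].
Qed.

HB.instance Definition _ n := Measure_isSigmaFinite.Build _ _ _ (@lam n)
  (@lam_sigma_finite n).

(** Boxes are stable under intersection, generate the sigma-algebra (a condition on one coordinate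
    is a box whose other sides are the whole line), and the cubes exhaust the space with finite
    measure. *)
Lemma lam_unique n (nu : {measure set 'rV[R]_n -> \bar R}) :
  (forall A : 'I_n -> set (measurableTypeR R), (forall i, measurable (A i)) ->
     nu (box A) = (\prod_(i < n) lebesgue_measure (A i))%E) ->
  forall B, measurable B -> nu B = lam B.
Proof.
move=> nuE B mB.
pose G := [set B : set 'rV[R]_n | exists2 A : 'I_n -> set (measurableTypeR R),
  (forall i, measurable (A i)) & B = box A].
apply: (measure_unique G (cube n)) => //.
- apply/seteqP; split.
    apply: smallest_sub; first exact: smallest_sigma_algebra.
    rewrite -bigcup_seq => C [i _] [D mD <-]; apply: sub_sigma_algebra.
    exists (fun j => if j == i then D else setT); first by move=> j; case: ifP.
    rewrite setTI; apply/seteqP; split => x /=.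
      by move=> Dx j /=; case: ifPn => // /eqP ->.
    by move=> /(_ i); rewrite eqxx.
  apply: smallest_sub; first exact: sigma_algebra_measurable.
  by move=> _ [A mA ->]; exact: measurable_box.
- move=> _ _ [A mA ->] [A' mA' ->]; exists (fun i => A i `&` A' i).
    by move=> i; exact: measurableI.
  by apply/seteqP; split => x /=; [move=> [H1 H2] i; split|move=> H; split => i; have [] := H i].
- by move=> k; exists (fun _ : 'I_n => `[- k%:R, k%:R]%classic).
- exact: cube_cover.
- by move=> _ [A mA ->]; rewrite nuE// -lam_box.
- move=> k; rewrite /cube nuE// -lam_box//; exact: cube_finite.
Qed.

Lemma lebesgue_measure_translate (a : R) (A : set (measurableTypeR R)) :
  measurable A -> lebesgue_measure [set x | A (x + a)] = lebesgue_measure A.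
Proof.
move=> mA.
have mf : measurable_fun setT (fun x : measurableTypeR R => x + a : measurableTypeR R).
  exact: measurable_funD.
rewrite (@lebesgue_measure_unique R (measure_function_pushforward__canonical__measure_function_Measure (@lebesgue_measure R) mf) _ A)//.
move=> _ [[x y] _ <-] /=; rewrite /pushforward.
rewrite (_ : _ @^-1` _ = `](x - a), (y - a)]%classic); last first.
  by apply/seteqP; split => z /=; rewrite !in_itv/= ltrBlDr lerBrDr.
rewrite [LHS]lebesgue_measure_itv [RHS]lebesgue_measure_itv/= !lte_fin ltrD2r.
by case: ifPn => // _; rewrite -!EFinB; congr (_%:E); ring.
Qed.

Lemma measurable_rV_translate n (y : 'rV[R]_n) : measurable_fun setT (fun x : 'rV[R]_n => x + y).
Proof.
apply: measurable_fun_coordP => i.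
rewrite (_ : (fun x => _) = fun x : 'rV[R]_n => x ord0 i + y ord0 i).
  by apply: measurable_funD => //; exact: measurable_coord.
by apply/funext => x; rewrite mxE.
Qed.

Lemma lam_translate n (y : 'rV[R]_n) (A : set 'rV[R]_n) : measurable A ->
  lam [set x | A (x + y)] = lam A.
Proof.
move=> mA.
rewrite -(@lam_unique n (measure_function_pushforward__canonical__measure_function_Measure (@lam n) (measurable_rV_translate y)) _ A)//=.
move=> B mB; rewrite /pushforward.
rewrite (_ : _ @^-1` _ = box (fun i => [set t | B i (t + y ord0 i)])); last first.
  by apply/seteqP; split => x /= + i => /(_ i) /=; rewrite mxE.
have mA' i : measurable [set t | B i (t + y ord0 i)].
  have mf : measurable_fun setT (fun x : measurableTypeR R => x + y ord0 i : measurableTypeR R).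
    exact: measurable_funD.
  by rewrite -[X in measurable X]setTI; exact: mf.
rewrite [LHS](lam_box mA').
by apply: eq_bigr => i _; rewrite lebesgue_measure_translate.
Qed.


Lemma measurable_rV_add n d (T : measurableType d) (f g : T -> 'rV[R]_n) :
  measurable_fun setT f -> measurable_fun setT g ->
  measurable_fun setT (fun x => f x + g x).
Proof.
move=> mf mg; apply: measurable_fun_coordP => i.
rewrite (_ : (fun x => _) = (fun x => f x ord0 i) \+ (fun x => g x ord0 i)).
  apply: measurable_funD.
    exact: measurableT_comp (measurable_coord i) mf.
  exact: measurableT_comp (measurable_coord i) mg.
by apply/funext => x /=; rewrite mxE.
Qed.

Lemma measurable_rV_scale n d (T : measurableType d) (c : T -> R) (f : T -> 'rV[R]_n) :
  measurable_fun setT c -> measurable_fun setT f ->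
  measurable_fun setT (fun x => c x *: f x).
Proof.
move=> mc mf; apply: measurable_fun_coordP => i.
rewrite (_ : (fun x => _) = c \* (fun x => f x ord0 i)).
  apply: measurable_funM => //.
  exact: measurableT_comp (measurable_coord i) mf.
by apply/funext => x /=; rewrite mxE.
Qed.

Lemma measurable_rV_opp n d (T : measurableType d) (f : T -> 'rV[R]_n) :
  measurable_fun setT f -> measurable_fun setT (fun x => - f x).
Proof.
move=> mf; under eq_fun do rewrite -scaleN1r.
exact: measurable_rV_scale.
Qed.

Lemma measurable_rV_sub n d (T : measurableType d) (f g : T -> 'rV[R]_n) :
  measurable_fun setT f -> measurable_fun setT g ->
  measurable_fun setT (fun x => f x - g x).
Proof. by move=> mf mg; apply: measurable_rV_add => //; exact: measurable_rV_opp. Qed.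

Lemma measurable_preimage d d' (T : measurableType d) (U : measurableType d') (f : T -> U) A :
  measurable_fun setT f -> measurable A -> measurable [set x | A (f x)].
Proof. by move=> mf mA; rewrite -[X in measurable X]setTI; exact: mf. Qed.

(* Both sides are [nu \x lam] applied to [(x, y) | x + y \in A, y \in Q], for Q the unit cube. *)
Lemma translation_invariant_unique n (nu : {sigma_finite_measure set 'rV[R]_n -> \bar R}) :
  (forall (y : 'rV[R]_n) (A : set 'rV[R]_n), measurable A ->
    nu [set x | A (x + y)] = nu A) ->
  forall A : set 'rV[R]_n, measurable A ->
    nu A = (nu [set x | box (fun=> `[0%R, 1%R]%classic) (- x)%R] * lam A)%E.
Proof.
move=> nuT A mA.
pose Q : set 'rV[R]_n := box (fun=> `[0%R, 1%R]%classic).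
have mQ : measurable Q by exact: measurable_box.
have lQ : lam Q = 1%:E.
  rewrite lam_box// big1// => i _.
  by rewrite lebesgue_measure_itv/= lte_fin ltr01 oppr0 adde0.
rewrite -/Q.
have m1 : measurable_fun setT (fst : 'rV[R]_n * 'rV[R]_n -> _) by exact: measurable_fst.
have m2 : measurable_fun setT (snd : 'rV[R]_n * 'rV[R]_n -> _) by exact: measurable_snd.
pose E := [set z : 'rV[R]_n * 'rV[R]_n | A (z.1 + z.2)] `&` [set z | Q z.2].
have mE : measurable E.
  apply: measurableI; last exact: measurable_preimage.
  by apply: measurable_preimage => //; exact: measurable_rV_add.
pose F := [set z : 'rV[R]_n * 'rV[R]_n | Q (z.2 - z.1)] `&` [set z | A z.2].
have mF : measurable F.
  apply: measurableI; last exact: measurable_preimage.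
  by apply: measurable_preimage => //; exact: measurable_rV_sub.
have tonE (G : set ('rV[R]_n * 'rV[R]_n)) : measurable G ->
    (\int[nu]_x lam (xsection G x) = \int[@lam n]_y nu (ysection G y))%E.
  move=> mG; have := @indic_fubini_tonelli _ _ _ _ _ nu (@lam n) _ mG.
  have -> := indic_fubini_tonelli_FE (@lam n) mG.
  by have -> := indic_fubini_tonelli_GE nu mG.
have HE y : nu (ysection E y) = (nu A * (\1_Q y)%:E)%E.
  rewrite indicE; have [Qy|Qy] := boolP (y \in Q).
    rewrite mule1 -(nuT y A)//; congr (nu _); apply/seteqP; split => x.
      by rewrite /ysection/= inE /E/= => -[].
    by rewrite /ysection/= inE /E/=; split => //; rewrite inE in Qy.
  rewrite mule0 (_ : ysection _ _ = set0) ?measure0//; apply/seteqP; split => x//.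
  by rewrite /ysection/= inE /E/= => -[_]; rewrite notin_setE in Qy.
have HF y : nu (ysection F y) = (nu [set x | Q (- x)%R] * (\1_A y)%:E)%E.
  rewrite indicE; have [Qy|Qy] := boolP (y \in A).
    rewrite mule1 -(nuT (- y) [set x | Q (- x)])//=; last first.
      by apply: measurable_preimage => //; exact: measurable_rV_opp.
    congr (nu _); apply/seteqP; split => x.
      by rewrite /ysection/= inE /F/= => -[]; rewrite opprB.
    by rewrite /ysection/= inE /F/= opprB; split => //; rewrite inE in Qy.
  rewrite mule0 (_ : ysection _ _ = set0) ?measure0//; apply/seteqP; split => x//.
  by rewrite /ysection/= inE /F/= => -[_]; rewrite notin_setE in Qy.
have HEF x : lam (xsection E x) = lam (xsection F x).
  rewrite -(lam_translate x (A := xsection F x)); last exact: measurable_xsection.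
  congr (lam _); apply/seteqP; split => y.
    by rewrite /xsection/= !inE /E /F/= addrK [y + x]addrC => -[].
  by rewrite /xsection/= !inE /E /F/= addrK [y + x]addrC => -[].
have := tonE _ mE.
under eq_integral do rewrite HEF.
rewrite tonE//.
under eq_integral do rewrite HF.
under [in RHS]eq_integral do rewrite HE.
rewrite ge0_integralZl//; last first.
  by apply/measurable_EFinP; exact: measurable_indic.
rewrite ge0_integralZl//; last first.
  by apply/measurable_EFinP; exact: measurable_indic.
rewrite !integral_indic// !setIT.
by rewrite [X in (nu A * X)%E]lQ mule1 => <-.
Qed.

(** The pushforward of [lam] by an additive bijection is again translation invariant, hence a
    multiple of [lam]. This is the linear change of variables, with the measure of a preimage of the
    reflected unit cube in place of a determinant. *)
Lemma lam_additive n (phi psi : 'rV[R]_n -> 'rV[R]_n) :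
  measurable_fun setT phi -> measurable_fun setT psi ->
  cancel phi psi -> cancel psi phi -> {morph phi : x y / x + y} ->
  forall A : set 'rV[R]_n, measurable A ->
    lam [set x | A (phi x)] =
    (lam [set x | box (fun=> `[0%R, 1%R]%classic) (- phi x)%R] * lam A)%E.
Proof.
move=> mphi mpsi phiK psiK phiD A mA.
pose nu := measure_function_pushforward__canonical__measure_function_Measure (@lam n) mphi.
have nu_sf : sigma_finite setT nu.
  exists (fun k => [set x | cube n k (psi x)]).
    apply/seteqP; split => // x _.
    have : (\bigcup_k cube n k) (psi x) by rewrite cube_cover.
    by move=> [k _ kx]; exists k.
  move=> k; split.
    by apply: measurable_preimage => //; exact: measurable_box.
  rewrite /nu/= /pushforward/=.
  have -> : phi @^-1` [set x | cube n k (psi x)] = cube n k.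
    by apply/seteqP; split => x /=; rewrite phiK.
  exact: cube_finite.
pose nu' : {sigma_finite_measure set _ -> \bar R} :=
  HB.pack (Measure.sort nu) (Measure_isSigmaFinite.Build _ _ _ (Measure.sort nu) nu_sf).
apply: (@translation_invariant_unique n nu') => // y B mB.
(* A translation by [y] in the target is a translation by [psi y] in the source. *)
rewrite /nu'/= /pushforward -(lam_translate (psi y) (A := phi @^-1` B)).
  by congr (lam _); apply/seteqP; split => x /=; rewrite phiD psiK.
exact: measurable_preimage.
Qed.

End lebesgue_rV_theory.

(** * The Euclidean norm and reflections *)

Section euclidean_norm.
Context {R : realType} (n : nat).
Implicit Types x y : 'rV[R]_n.

Definition dot x y : R := \sum_i x ord0 i * y ord0 i.

Lemma dotC x y : dot x y = dot y x.
Proof. by apply: eq_bigr => i _; rewrite mulrC. Qed.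

Lemma dotDl x y z : dot (x + y) z = dot x z + dot y z.
Proof. by rewrite -big_split; apply: eq_bigr => i _; rewrite mxE mulrDl. Qed.

Lemma dotDr x y z : dot z (x + y) = dot z x + dot z y.
Proof. by rewrite dotC dotDl !(dotC z). Qed.

Lemma dotZl c x y : dot (c *: x) y = c * dot x y.
Proof. by rewrite /dot mulr_sumr; apply: eq_bigr => i _; rewrite mxE mulrA. Qed.

Lemma dotZr c x y : dot x (c *: y) = c * dot x y.
Proof. by rewrite dotC dotZl dotC. Qed.

Lemma dotNl x y : dot (- x) y = - dot x y.
Proof. by rewrite -scaleN1r dotZl mulN1r. Qed.

Lemma dotNr x y : dot x (- y) = - dot x y.
Proof. by rewrite dotC dotNl dotC. Qed.

Definition dotE := (dotDl, dotDr, dotZl, dotZr, dotNl, dotNr).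

Lemma dot_ge0 x : 0 <= dot x x.
Proof. by apply: sumr_ge0 => i _; rewrite -expr2 sqr_ge0. Qed.

Lemma enormE x : enorm x = Num.sqrt (dot x x).
Proof. by congr Num.sqrt; apply: eq_bigr => i _; rewrite expr2. Qed.

Lemma enorm_ge0 x : 0 <= enorm x. Proof. exact: sqrtr_ge0. Qed.

Lemma enorm_sqr x : enorm x ^+ 2 = dot x x.
Proof. by rewrite enormE sqr_sqrtr// dot_ge0. Qed.

Lemma enormZ c x : enorm (c *: x) = `|c| * enorm x.
Proof.
by rewrite !enormE dotZl dotZr mulrA -expr2 sqrtrM ?sqr_ge0// sqrtr_sqr.
Qed.

Lemma enormN x : enorm (- x) = enorm x.
Proof. by rewrite -scaleN1r enormZ normrN1 mul1r. Qed.

Lemma enormB x y : enorm (x - y) = enorm (y - x).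
Proof. by rewrite -enormN opprB. Qed.

Lemma enorm_coord x i : `|x ord0 i| <= enorm x.
Proof.
rewrite -sqrtr_sqr /enorm ler_wsqrtr// (bigD1 i)//= lerDl.
by apply: sumr_ge0 => j _; rewrite sqr_ge0.
Qed.

Lemma enorm_eq0 x : (enorm x == 0) = (x == 0).
Proof.
apply/eqP/eqP => [x0|->]; last by rewrite -(scale0r 0) enormZ normr0 mul0r.
apply/rowP => i; rewrite mxE; apply/eqP; rewrite -normr_le0 -x0.
exact: enorm_coord.
Qed.

Lemma enorm0 : enorm (0 : 'rV[R]_n) = 0.
Proof. by apply/eqP; rewrite enorm_eq0. Qed.

Lemma enorm_gt0 x : (0 < enorm x) = (x != 0).
Proof. by rewrite lt_def enorm_ge0 andbT enorm_eq0. Qed.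

(** Cauchy-Schwarz: with a = |x| and b = |y|, the square of |b x - a y| expands to 2ab (ab -
    x.y). *)
Lemma dot_le x y : dot x y <= enorm x * enorm y.
Proof.
have [->|x0] := eqVneq x 0; first by rewrite -(scale0r 0) dotZl mul0r enormZ normr0 !mul0r.
have [->|y0] := eqVneq y 0; first by rewrite -(scale0r 0) dotZr mul0r enormZ normr0 mul0r mulr0.
have a0 : 0 < enorm x by rewrite enorm_gt0.
have b0 : 0 < enorm y by rewrite enorm_gt0.
have := dot_ge0 (enorm y *: x - enorm x *: y).
rewrite !dotE (dotC y x) -(enorm_sqr x) -(enorm_sqr y).
set a := enorm x in a0 *; set b := enorm y in b0 *; set d := dot x y => H.
have : 0 <= (2 * a * b) * (a * b - d) by apply: le_trans H _; rewrite le_eqVlt; apply/orP; left; apply/eqP; ring.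
by rewrite pmulr_rge0 ?subr_ge0// !mulr_gt0.
Qed.

Lemma ler_enormD x y : enorm (x + y) <= enorm x + enorm y.
Proof.
rewrite -[leLHS](ger0_norm (enorm_ge0 _)) -ler_sqr ?nnegrE ?addr_ge0 ?enorm_ge0//.
rewrite (ger0_norm (enorm_ge0 _)).
rewrite enorm_sqr !dotE (dotC y x) sqrrD !enorm_sqr.
have := dot_le x y; lra.
Qed.

Lemma ler_enormB x y : enorm (x - y) <= enorm x + enorm y.
Proof. by rewrite -(enormN y); exact: ler_enormD. Qed.

Lemma ler_enorm_sub x y : enorm x - enorm y <= enorm (x - y).
Proof. by rewrite lerBlDr (le_trans _ (ler_enormD _ _))// subrK. Qed.

Lemma ler_dist_enorm x y : `|enorm x - enorm y| <= enorm (x - y).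
Proof. by rewrite ler_norml ler_enorm_sub andbT lerNl opprB enormB ler_enorm_sub. Qed.

Lemma enorm_le_sum x : enorm x <= \sum_i `|x ord0 i|.
Proof.
rewrite -[leRHS]ger0_norm ?sumr_ge0// -sqrtr_sqr /enorm ler_wsqrtr// expr2 mulr_suml.
apply: ler_sum => i _; rewrite -[leLHS]ger0_norm ?sqr_ge0// expr2 normrM ler_wpM2l//.
by rewrite (bigD1 i)//= lerDl sumr_ge0.
Qed.

Lemma measurable_enorm d (T : measurableType d) (f : T -> 'rV[R]_n) :
  measurable_fun setT f -> measurable_fun setT (fun t => enorm (f t)).
Proof.
move=> mf; apply: (@measurableT_comp _ _ _ _ _ _ (@Num.sqrt R)).
  exact: continuous_measurable_fun (@sqrt_continuous R).

apply: measurable_sum => i; apply: measurable_funX.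
exact: measurableT_comp (measurable_coord i) mf.
Qed.

(** The Householder reflection in the hyperplane orthogonal to [v]; for [v = 0] the division by zero
    makes it the identity. These are the rotations of the proof: two vectors of equal norm are
    exchanged by the reflection along their difference. *)
Definition reflection v x : 'rV[R]_n := x - (2 * dot x v / dot v v) *: v.

Lemma reflectionD v : {morph reflection v : x y / x + y}.
Proof.
move=> x y; rewrite /reflection dotDl addrACA -opprD -scalerDl.
by congr (_ - _ *: _); rewrite mulrDr mulrDl.
Qed.

Lemma enorm_reflection v x : enorm (reflection v x) = enorm x.
Proof.
rewrite !enormE /reflection !dotE (dotC v x); congr Num.sqrt.
have [->|v0] := eqVneq (dot v v) 0; first by rewrite invr0; ring.
by field.
Qed.

Lemma reflectionZ v c x : reflection v (c *: x) = c *: reflection v x.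
Proof. by rewrite /reflection dotZl scalerBr scalerA; congr (_ - _ *: _); ring. Qed.

Lemma reflectionK v : involutive (reflection v).
Proof.
move=> x; rewrite {1}/reflection; have [v0|v0] := eqVneq (dot v v) 0.
  by rewrite v0 invr0 mulr0 scale0r subr0 /reflection v0 invr0 mulr0 scale0r subr0.
rewrite /reflection !dotE -addrA -opprD -scalerDl.
rewrite [X in X *: v](_ : _ = 0) ?scale0r ?subr0//; by field.
Qed.

Lemma reflection_swap x y : enorm x = enorm y -> reflection (x - y) x = y.
Proof.
move=> xy; have [->|xNy] := eqVneq x y.
  by rewrite /reflection subrr scaler0 subr0.
have v0 : dot (x - y) (x - y) != 0.
  by rewrite -enorm_sqr sqrf_eq0 enorm_eq0 subr_eq0.
have E : 2 * dot x (x - y) / dot (x - y) (x - y) = 1.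
  apply: (mulIf v0); rewrite mulfVK// mul1r !dotE (dotC y x).
  have := enorm_sqr y; rewrite -xy enorm_sqr => <-; ring.
by rewrite /reflection E scale1r opprB addrC subrK.
Qed.

Lemma measurable_reflection v : measurable_fun setT (reflection v).
Proof.
apply: measurable_rV_sub => //; apply: measurable_rV_scale => //.
apply: measurable_funM => //; apply: measurable_funM => //.
rewrite /dot;
apply: measurable_sum => i; apply: measurable_funM => //.
exact: measurable_coord.
Qed.

End euclidean_norm.

Section invariance.
Context {R : realType} (n : nat).
Local Notation lam := (@lam R n).
Implicit Types (A : set 'rV[R]_n) (x y : 'rV[R]_n).

Definition cball (r : R) : set 'rV[R]_n := [set x | enorm x <= r].

Lemma measurable_ler_set d (T : measurableType d) (f g : T -> R) :
  measurable_fun setT f -> measurable_fun setT g -> measurable [set t | f t <= g t].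
Proof.
move=> mf mg; have := measurable_fun_ler mf mg => /(_ measurableT [set true] Logic.I).
by rewrite setTI.
Qed.

Lemma measurable_ltr_set d (T : measurableType d) (f g : T -> R) :
  measurable_fun setT f -> measurable_fun setT g -> measurable [set t | f t < g t].
Proof.
move=> mf mg; have := measurable_fun_ltr mf mg => /(_ measurableT [set true] Logic.I).
by rewrite setTI.
Qed.

Lemma measurable_cball r : measurable (cball r).
Proof. by apply: measurable_ler_set => //; exact: measurable_enorm. Qed.

Lemma cball_finite : (lam (cball 1) < +oo)%E.
Proof.
apply: (@le_lt_trans _ _ (lam (@cube R n 1%N))); last exact: cube_finite.
apply: le_measure; rewrite ?inE.
- exact: measurable_cball.
- exact: measurable_box.
- move=> x /= x1 i /=; rewrite in_itv/= -ler_norml; exact: le_trans (enorm_coord _ _) x1.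
Qed.

Lemma cball_gt0 : (0 < lam (cball 1))%E.
Proof.
(* With side 1/(n+1) the coordinates of a point of the cube sum to at most n/(n+1), so the cube lies
   in the unit ball; the successor also covers n = 0. *)
pose A : set (measurableTypeR R) := `[0, n.+1%:R^-1]%classic.
apply: (@lt_le_trans _ _ (lam (box (fun=> A)))); last first.
  apply: le_measure; rewrite ?inE; [by apply: measurable_box => i; exact: measurable_itv|exact: measurable_cball|].
  move=> x /= xA; apply: le_trans (enorm_le_sum x) _.
  apply: (@le_trans _ _ (\sum_(i < n) n.+1%:R^-1)).
    apply: ler_sum => i _; have := xA i; rewrite /A/= in_itv/= => /andP[x0 x1].
    by rewrite ger0_norm.
  rewrite sumr_const card_ord -[leLHS]mulr_natl ler_pdivrMr ?mul1r ?ler_nat//.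
rewrite lam_box; last by move=> i; exact: measurable_itv.
elim/big_ind : _ => [|x y x0 y0|i _]; [by rewrite lte01|exact: mule_gt0|].
by rewrite /A lebesgue_measure_itv/= lte_fin invr_gt0 ltr0n/= oppr0 adde0 lte_fin.
Qed.

(** By [lam_additive] the measure is multiplied by a constant; the unit ball is mapped to itself and
    has positive finite measure, so the constant is 1. *)
Lemma lam_isometry (phi : 'rV[R]_n -> 'rV[R]_n) :
  measurable_fun setT phi -> involutive phi -> {morph phi : x y / x + y} ->
  (forall x, enorm (phi x) = enorm x) ->
  forall A, measurable A -> lam [set x | A (phi x)] = lam A.
Proof.
move=> mphi phiK phiD phin A mA.
have H := lam_additive mphi mphi phiK phiK phiD.
rewrite H//; set k := (X in (X * _)%E).
have := H _ (measurable_cball 1); rewrite -/k.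
rewrite (_ : [set x | cball 1 (phi x)] = cball 1); last first.
  by apply/seteqP; split => x /=; rewrite /cball/= phin.
have B0 := cball_gt0; have Boo := cball_finite.
have Bf : lam (cball 1) \is a fin_num by rewrite ge0_fin_numE// ltW.
move: Bf B0 Boo; case: (lam (cball 1)) => // b _ b0 _.
case: k => [k||].
- rewrite -EFinM => -[kb]; rewrite (_ : k = 1) ?mul1e//.
  by apply: (mulIf (lt0r_neq0 b0)); rewrite -kb mul1r.
- by rewrite gt0_mulye.
- by rewrite gt0_mulNye.
Qed.

Lemma measurable_rV_scalel (c : R) : measurable_fun setT (fun x : 'rV[R]_n => c *: x).
Proof. exact: measurable_rV_scale. Qed.

Lemma lam_scale (c : R) A : 0 < c -> measurable A ->
  lam [set x | A (c *: x)] = ((c^-1 ^+ n)%:E * lam A)%E.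
Proof.
move=> c0 mA.
rewrite (lam_additive (psi := fun x => c^-1 *: x))//; first last.
- by move=> x y; rewrite scalerDr.
- by move=> x; rewrite scalerA divff ?scale1r// gt_eqF.
- by move=> x; rewrite scalerA mulVf ?scale1r// gt_eqF.
- exact: measurable_rV_scalel.
- exact: measurable_rV_scalel.
congr (_ * _)%E.
rewrite (_ : [set x | _] = box (fun=> `[- c^-1, 0%R]%classic)); last first.
  apply/seteqP; split => x /= xb i; have := xb i; rewrite /= !mxE !in_itv/=.
    move=> /andP[x0 x1]; rewrite -(pmulr_rle0 _ c0) -oppr_ge0 x0 andbT.
    by rewrite lerNl -(ler_pM2l c0) divff ?gt_eqF// mulrN.
  move=> /andP[x0 x1]; rewrite oppr_ge0 pmulr_rle0// x1/=.
  by rewrite -mulrN -ler_pdivlMl// mulr1 lerNl.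
rewrite lam_box; last by move=> i; exact: measurable_itv.
rewrite lebesgue_measure_itv/= lte_fin oppr_lt0 invr_gt0 c0 -EFinB sub0r opprK.
elim: n => [|m IH]; first by rewrite big_ord0 expr0.
by rewrite big_ord_recl IH exprS EFinM.
Qed.

Section integrals.
Local Open Scope ereal_scope.

Lemma ge0_integral_scale_preserving (phi : 'rV[R]_n -> 'rV[R]_n) (k : R) f :
  (0 <= k)%R -> measurable_fun setT phi ->
  (forall A, measurable A -> lam [set x | A (phi x)] = k%:E * lam A) ->
  measurable_fun setT f -> (forall x, 0 <= f x) ->
  \int[lam]_x f (phi x) = k%:E * \int[lam]_x f x.
Proof.
move=> k0 mphi lamphi mf f0.
have := @ge0_integral_pushforward _ _ _ _ R phi mphi lam setT f measurableT mf (fun x _ => f0 x).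
rewrite preimage_setT /= => <-.
rewrite (eq_measure_integral (mscale (NngNum k0) lam))//.
  by rewrite ge0_integral_mscale.
by move=> A mA _; exact: lamphi.
Qed.

Lemma integral_preserving (phi : 'rV[R]_n -> 'rV[R]_n) f :
  measurable_fun setT phi ->
  (forall A, measurable A -> lam [set x | A (phi x)] = lam A) ->
  measurable_fun setT f ->
  \int[lam]_x f (phi x) = \int[lam]_x f x.
Proof.
move=> mphi lamphi mf.
have H g : measurable_fun setT g -> (forall x, 0 <= g x) -> \int[lam]_x g (phi x) = \int[lam]_x g x.
  move=> mg g0; rewrite (@ge0_integral_scale_preserving _ 1)// ?mul1e//.
  by move=> A mA; rewrite mul1e lamphi.
rewrite [LHS]integralE [RHS]integralE; congr (_ - _).
- rewrite -[RHS](H _ (measurable_funepos mf) (fun x => funepos_ge0 f x)).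
  by apply: eq_integral => x _; rewrite !funeposE.
- rewrite -[RHS](H _ (measurable_funeneg mf) (fun x => funeneg_ge0 f x)).
  by apply: eq_integral => x _; rewrite !funenegE.
Qed.

Lemma integral_translate y f : measurable_fun setT f ->
  \int[lam]_x f (x + y)%R = \int[lam]_x f x.
Proof.
move=> mf; apply: (@integral_preserving (fun x => (x + y)%R)) => //.
- exact: measurable_rV_translate.
- by move=> A mA; rewrite lam_translate.
Qed.

Lemma integral_opp f : measurable_fun setT f ->
  \int[lam]_x f (- x)%R = \int[lam]_x f x.
Proof.
move=> mf; apply: (@integral_preserving (fun x => (- x)%R)) => //.
- exact: measurable_rV_opp.
- apply: lam_isometry.
  + exact: measurable_rV_opp.
  + exact: opprK.
  + by move=> x y; rewrite opprD.
  + exact: enormN.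
Qed.

Lemma integral_reflection v f : measurable_fun setT f ->
  \int[lam]_x f (reflection v x) = \int[lam]_x f x.
Proof.
move=> mf; apply: (@integral_preserving (reflection v)) => //.
- exact: measurable_reflection.
- apply: lam_isometry.
  + exact: measurable_reflection.
  + exact: reflectionK.
  + exact: reflectionD.
  + exact: enorm_reflection.
Qed.

Lemma ge0_integral_scale (c : R) f : (0 < c)%R -> measurable_fun setT f ->
  (forall x, 0 <= f x) ->
  \int[lam]_x f (c *: x)%R = (c^-1 ^+ n)%:E * \int[lam]_x f x.
Proof.
move=> c0 mf f0; apply: (@ge0_integral_scale_preserving (fun x => (c *: x)%R)) => //.
- by rewrite exprn_ge0// invr_ge0 ltW.
- exact: measurable_rV_scalel.
- by move=> A mA; rewrite lam_scale.
Qed.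

Lemma ge0_integral_homothety (c : R) x f : (0 < c)%R -> measurable_fun setT f ->
  (forall x, 0 <= f x) ->
  \int[lam]_y f y = (c ^+ n)%:E * \int[lam]_w f (x + c *: w)%R.
Proof.
move=> c0 mf f0.
rewrite (@ge0_integral_scale c (fun w => f (x + w)%R))//.
  rewrite muleA -EFinM -exprMn divff ?gt_eqF// expr1n mul1e.
  by rewrite -(integral_translate x mf); apply: eq_integral => w _; rewrite addrC.
by apply: measurableT_comp => //; exact: measurable_rV_add.
Qed.

End integrals.

Lemma lam_cball r : 0 < r -> lam (cball r) = ((r ^+ n)%:E * lam (cball 1))%E.
Proof.
move=> r0; have := @lam_scale r^-1 (cball 1); rewrite invrK invr_gt0 => <-//.
  congr lam; apply/seteqP; split => x; rewrite /cball/= enormZ gtr0_norm ?invr_gt0//.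
    by rewrite mulrC ler_pdivrMr// mul1r.
  by rewrite mulrC ler_pdivrMr// mul1r.
exact: measurable_cball.
Qed.

End invariance.

(** * Radial integrals *)

Lemma measurable_origin {R : realType} n : measurable [set 0 : 'rV[R]_n].
Proof.
rewrite (_ : [set 0] = cball 0); first exact: measurable_cball.
apply/seteqP; split => z /=; first by move=> ->; rewrite /cball/= enorm0.
by rewrite /cball/= => z0; apply/eqP; rewrite -enorm_eq0 eq_le z0 enorm_ge0.
Qed.

Section radial.
Context {R : realType} (n : nat).
Hypothesis n_gt0 : (0 < n)%N.
Local Notation lam := (@lam R n).
Implicit Types (x : 'rV[R]_n) (a b c y : R).

Definition ann a b : set 'rV[R]_n := [set x | a < enorm x] `&` [set x | enorm x <= b].

Lemma measurable_enorm_id : measurable_fun setT (@enorm R n).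
Proof. exact: measurable_enorm. Qed.

Lemma measurable_ann a b : measurable (ann a b).
Proof.
apply: measurableI.
  by apply: measurable_ltr_set => //; exact: measurable_enorm_id.
by apply: measurable_ler_set => //; exact: measurable_enorm_id.
Qed.

Lemma measurable_enorm_powR d (T : measurableType d) (f : T -> 'rV[R]_n) a :
  measurable_fun setT f -> measurable_fun setT (fun t => enorm (f t) `^ a).
Proof.
move=> mf; have H := measurableT_comp (@measurable_powR R a) (measurable_enorm mf). exact: H.
Qed.

(** The mass of a spherical shell for |x|^(-n) dx, the measure invariant under dilations. *)
Definition annI a b : \bar R :=
  (\int[lam]_x (\1_(ann a b) x * enorm x `^ (- n%:R))%:E)%E.

Let annf_meas a b :
  measurable_fun setT (fun x => (\1_(ann a b) x * enorm x `^ (- n%:R))%:E).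
Proof.
apply/measurable_EFinP; apply: measurable_funM.
  by apply: measurable_indic; exact: measurable_ann.
exact: measurable_enorm_powR.
Qed.

Let annf_ge0 a b x : (0 <= (\1_(ann a b) x * enorm x `^ (- n%:R))%:E)%E.
Proof. by rewrite lee_fin mulr_ge0 ?powR_ge0. Qed.

Lemma annI_scale c a b : 0 < c -> annI (c * a) (c * b) = annI a b.
Proof.
move=> c0; have c0' := ltW c0.
have := @ge0_integral_scale R n c _ c0 (annf_meas (c * a) (c * b)) (annf_ge0 _ _).
rewrite -/(annI _ _).
under eq_integral => x _.
  rewrite (_ : (_ * _)%R = c^-1 ^+ n * (\1_(ann a b) x * enorm x `^ (- n%:R))); last first.
    rewrite enormZ gtr0_norm// powRM ?enorm_ge0// powR_invn// exprVn mulrCA; congr (_ * (_ * _)).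
    rewrite !indicE; congr (_%:R); congr nat_of_bool.
    apply/idP/idP; rewrite !inE /ann/= enormZ gtr0_norm// => -[].
      by rewrite ltr_pM2l// ler_pM2l//.
    by rewrite ltr_pM2l// ler_pM2l//.
  rewrite EFinM; over.
rewrite ge0_integralZl//; last by rewrite lee_fin exprn_ge0// invr_ge0.
rewrite -/(annI _ _) => /(congr1 (fun z => (c ^+ n)%:E * z)%E).
by rewrite !muleA -!EFinM -exprMn divff ?gt_eqF// expr1n !mul1e.
Qed.

Lemma annI_add a b c : a <= b -> b <= c -> (annI a c = annI a b + annI b c)%E.
Proof.
move=> ab bc; rewrite /annI -ge0_integralD//.
apply: eq_integral => x _; rewrite -EFinD -mulrDl; congr (_ * _)%:E.
rewrite !indicE -natrD; congr _%:R.
have [xb|xb] := leP (enorm x) b.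
  rewrite [x \in ann b c]memNset ?addn0; last by move=> []/=; rewrite ltNge xb.
  congr nat_of_bool; apply/idP/idP; rewrite !inE => -[/= ax _]; split => //=.
  exact: le_trans bc.
rewrite [x \in ann a b]memNset ?add0n; last by move=> [/= _]; rewrite leNgt xb.
congr nat_of_bool; apply/idP/idP; rewrite !inE => -[/= ax xc]; split => //=.
exact: le_lt_trans xb.
Qed.

Let vol := fine (lam (cball 1)).

Lemma volE : lam (cball 1) = vol%:E.
Proof. by rewrite fineK// ge0_fin_numE//; exact: cball_finite. Qed.

Lemma vol_gt0 : 0 < vol.
Proof. by rewrite -lte_fin -volE; exact: cball_gt0. Qed.

Lemma lam_ann b : 1 <= b -> lam (ann 1 b) = ((b ^+ n - 1) * vol)%:E.
Proof.
move=> b1; have b0 : 0 < b by exact: lt_le_trans b1.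
have E : lam (cball b) = (lam (cball 1) + lam (ann 1 b))%E.
  rewrite -measureU//.
  - congr lam; apply/seteqP; split => x; rewrite /cball/ann/=.
      by have [] := leP (enorm x) 1; [left|right].
    by case=> [|[]//]; move=> /le_trans; apply.
  - exact: measurable_cball.
  - exact: measurable_ann.
  - by apply/seteqP; split => x // -[]; rewrite /cball/ann/= leNgt => /negP h [].
move: E; rewrite lam_cball// volE -EFinM mulrBl mul1r.
by case: (lam (ann 1 b)) => [r||]//; rewrite -EFinD => -[->]; rewrite addrAC subrr add0r.
Qed.

Lemma annI_le y : 0 <= y -> (annI 1 (expR y) <= ((expR (n%:R * y) - 1) * vol)%:E)%E.
Proof.
move=> y0; have e1 : 1 <= expR y by rewrite -expR0 ler_expR.
rewrite expRM_natl -lam_ann// -[X in (_ <= lam X)%E]setIT -integral_indic//; last exact: measurable_ann.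
apply: ge0_le_integral => //.
- by apply/measurable_EFinP; apply: measurable_indic; exact: measurable_ann.
- move=> x _; rewrite lee_fin indicE; have [|] := boolP (x \in _); last by rewrite mul0r.
  rewrite inE => -[/= x1 _]; rewrite mul1r powRN invf_le1 ?powR_gt0 ?(lt_trans _ x1)//.
  by rewrite powR_mulrn ?enorm_ge0// exprn_ege1// ltW.
Qed.

Lemma annI_ge y : 0 <= y ->
  ((expR (- (n%:R * y)) * ((expR (n%:R * y) - 1) * vol))%:E <= annI 1 (expR y))%E.
Proof.
move=> y0; have e1 : 1 <= expR y by rewrite -expR0 ler_expR.
rewrite EFinM expRM_natl -lam_ann// -[X in (_ * lam X)%E]setIT -integral_indic//; last exact: measurable_ann.
rewrite -ge0_integralZl//; last by apply/measurable_EFinP; apply: measurable_indic; exact: measurable_ann.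
apply: ge0_le_integral => //.
- apply/measurable_EFinP; apply: measurable_funM => //.
  by apply: measurable_indic; exact: measurable_ann.
- move=> x _; rewrite -EFinM lee_fin indicE; have [|] := boolP (x \in _); last by rewrite mulr0 mul0r.
  rewrite inE => -[/= x1 xy]; rewrite mulr1 mul1r powRN powR_mulrn ?enorm_ge0//.
  rewrite expRN expRM_natl lef_pV2 ?posrE ?exprn_gt0 ?expR_gt0// ?(lt_trans _ x1)//.
  by rewrite lerXn2r ?nnegrE ?enorm_ge0 ?expR_ge0.
Qed.

Lemma ler_divn_eps (u v w : R) : (forall k, (0 < k)%N -> u <= v + w / k%:R) -> u <= v.
Proof.
move=> H; rewrite leNgt; apply/negP => vu.
pose k := (Num.truncn (`|w| / (u - v))).+1.
have := H k isT; rewrite leNgt => /negP; apply.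
rewrite -ltrBrDl ltr_pdivrMr ?ltr0n// mulrC -ltr_pdivrMr ?subr_gt0//.
apply: le_lt_trans (truncnS_gt _); rewrite ler_pM2r ?invr_gt0 ?subr_gt0//.
exact: ler_norm.
Qed.

(** By dilation invariance [annI 1 (expR y)] is additive in [y], and it is n vol y up to a relative
    error of order [y], because the weight is almost constant on a thin shell. Cutting [ln r] into
    [k] equal parts and letting [k] grow removes the error. This takes the place of integration in
    polar coordinates. *)
Lemma annI_ln r : 1 <= r -> annI 1 r = (n%:R * vol * ln r)%:E.
Proof.
move=> r1; have r0 : 0 < r by exact: lt_le_trans r1.
pose u := ln r; have u0 : 0 <= u by exact: ln_ge0.
have rE : r = expR u by rewrite lnK.
rewrite -/u rE.
have scaleE k y : 0 <= y -> annI 1 (expR (k%:R * y)) = (k%:R%:E * annI 1 (expR y))%E.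
  move=> y0; elim: k => [|k IH].
    rewrite !mul0r mul0e expR0 /annI integral0_eq// => x _.
    rewrite indicE memNset ?mul0r// => -[/=] x1 x2.
    by have := lt_le_trans x1 x2; rewrite ltxx.
  rewrite (@annI_add _ (expR (k%:R * y))); last 2 first.
  - by rewrite -expR0 ler_expR mulr_ge0.
  - by rewrite ler_expR ler_wpM2r// ler_nat.
  have -> : expR (k.+1%:R * y) = expR (k%:R * y) * expR y.
    by rewrite -expRD -natr1 mulrDl mul1r.
  have := @annI_scale (expR (k%:R * y)) 1 (expR y) (expR_gt0 _); rewrite mulr1 => ->.
  by rewrite IH -natr1 EFinD ge0_muleDl ?mul1e ?lee_fin.
have fin y : 0 <= y -> annI 1 (expR y) \is a fin_num.
  move=> y0; rewrite ge0_fin_numE; last by apply: integral_ge0.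
  by apply: le_lt_trans (annI_le y0) _; rewrite ltry.
pose v := fine (annI 1 (expR u)).
have vE : annI 1 (expR u) = v%:E by rewrite /v fineK// fin.
rewrite vE; congr _%:E.
have key k : (0 < k)%N -> [/\ n%:R * vol * u * (1 - (n%:R * u) / k%:R) <= v &
     v * (1 - (n%:R * u) / k%:R) <= n%:R * vol * u].
  move=> k0; have k0' : 0 < (k%:R : R) by rewrite ltr0n.
  have y0 : 0 <= u / k%:R by rewrite divr_ge0.
  set y := u / k%:R in y0.
  have vy : v = k%:R * fine (annI 1 (expR y)).
    rewrite /v -[X in expR X](_ : k%:R * y = u); last by rewrite /y; field; rewrite gt_eqF.
    by rewrite scaleE// fineM// fin.
  have := annI_le y0; have := annI_ge y0.
  rewrite -(fineK (fin _ y0)) !lee_fin.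
  set w := fine _ in vy *.
  have -> : n%:R * u / k%:R = n%:R * y by rewrite mulrA.
  have -> : n%:R * vol * u = k%:R * (n%:R * y * vol).
    by rewrite /y; field; rewrite gt_eqF.
  set z := n%:R * y.
  have z0 : 0 <= z by rewrite mulr_ge0.
  have e1 : 1 + z <= expR z by exact: expR_ge1Dx.
  have e2 : 1 - z <= expR (- z) by exact: expR_ge1Dx.
  have ee : expR (- z) * expR z = 1 by rewrite -expRD addNr expR0.
  have ep : 0 < expR z by exact: expR_gt0.
  have en : 0 < expR (- z) by exact: expR_gt0.
  have v0 := vol_gt0.
  move=> h1 h2; rewrite vy; split;
    rewrite -?(mulrA k%:R (z * vol)) -?(mulrA k%:R w) ler_pM2l//.
    have A1 : z * (1 - z) <= expR (- z) * (expR z - 1).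
      apply: (@le_trans _ _ (z * expR (- z))); first by rewrite ler_wpM2l.
      by rewrite mulrC ler_pM2l//; lra.
    apply: le_trans h1; rewrite (_ : z * vol * (1 - z) = (z * (1 - z)) * vol); last ring.
    by rewrite mulrA ler_pM2r.
  have [z1|z1] := leP z 1.
    apply: (@le_trans _ _ ((expR z - 1) * vol * (1 - z))).
      by rewrite ler_wpM2r// subr_ge0.
    rewrite mulrAC ler_pM2r//.
    have : expR z * (1 - z) <= 1 by rewrite -[leRHS]ee mulrC ler_pM2r.
    rewrite mulrBl mul1r; lra.
  (* For z > 1 the factor 1 - z makes the left-hand side nonpositive. *)
  apply: (@le_trans _ _ 0); last by rewrite mulr_ge0// ltW.
  rewrite mulr_ge0_le0//; last lra.
  apply: le_trans h1; rewrite mulr_ge0 ?expR_ge0// mulr_ge0 ?(ltW v0)//; lra.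
apply/eqP; rewrite eq_le; apply/andP; split.
- apply: (@ler_divn_eps _ _ (v * (n%:R * u))) => k k0.
  by have [_] := key k k0; rewrite -(mulrA v) mulrBr mulr1 lerBlDr.
- apply: (@ler_divn_eps _ _ (n%:R * vol * u * (n%:R * u))) => k k0.
  by have [+ _] := key k k0; rewrite -(mulrA (n%:R * vol * u)) mulrBr mulr1 lerBlDr.
Qed.

Lemma lam_set0 : lam [set 0] = 0%E.
Proof.
rewrite (_ : [set 0] = box (fun=> [set 0%R])).
  rewrite lam_box// (eq_bigr (fun=> 0%E)) => [|i _]; last exact: lebesgue_measure_set1.
  by move: n_gt0; case: n => // m _; rewrite big_ord_recl mul0e.
apply/seteqP; split => x; first by move=> -> i /=; rewrite mxE.
by move=> x0; apply/rowP => i; rewrite mxE; exact: x0.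
Qed.

(** The cone over the unit sphere is the closed unit ball without its center, and the center is a
    null set. *)
Lemma omegaE : omega R n = (n%:R * vol)%:E.
Proof.
rewrite /omega /surface_measure EFinM -volE; congr (_ * _)%E.
rewrite (_ : cone _ = cball 1 `\ 0); last first.
  apply/seteqP; split => x.
    case=> r /=; rewrite in_itv/= => /andP[r0 r1] [u u1 <-].
    rewrite /cball/= enormZ u1 mulr1 gtr0_norm//; split => //.
    by apply/eqP; rewrite scaler_eq0 gt_eqF//= -enorm_eq0 u1 oner_eq0.
  case=> /= x1 /eqP x0.
  have e0 : 0 < enorm x by rewrite enorm_gt0.
  exists (enorm x); first by rewrite /= in_itv/= e0.
  exists ((enorm x)^-1 *: x); last by rewrite scalerA divff ?gt_eqF// scale1r.
  by rewrite /= enormZ gtr0_norm ?invr_gt0// mulVf// gt_eqF.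
have m0 : measurable [set (0 : 'rV[R]_n)].
  rewrite (_ : [set _] = cball 0); first exact: measurable_cball.
  apply/seteqP; split => x; rewrite /cball/=; first by move=> ->; rewrite enorm0.
  move=> x0; apply/eqP; rewrite -enorm_eq0 eq_le x0 enorm_ge0//.
rewrite -[LHS]/(lam (cball 1 `\ 0)).
rewrite [RHS](measureDI lam (B := [set 0]))//; last exact: measurable_cball.
rewrite [X in (_ + X)%E](_ : _ = 0%E) ?adde0//.
apply/eqP; rewrite -measure_le0 -lam_set0.
by apply: le_measure; rewrite ?inE//; apply: measurableI => //; exact: measurable_cball.
Qed.

(** The spare factor: r^h near 0 and r^(-h) near infinity. It makes the borderline weight |x|^(-n)
    integrable at both ends. *)
Definition min_powR (h r : R) : R := Num.min (r `^ h) (r `^ (- h)).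

Lemma min_powR_ge0 h r : 0 <= min_powR h r.
Proof. by rewrite /min_powR le_min !powR_ge0. Qed.

Lemma measurable_min_powR h d (T : measurableType d) (f : T -> R) :
  measurable_fun setT f -> measurable_fun setT (fun t => min_powR h (f t)).
Proof.
move=> mf; apply: measurable_minr.
- have H := measurableT_comp (@measurable_powR R h) mf; exact: H.
- have H := measurableT_comp (@measurable_powR R (- h)) mf; exact: H.
Qed.

Lemma min_powR_le_expR h k r : 0 <= h -> 0 < r -> r <= expR (- k) \/ expR k <= r ->
  min_powR h r <= expR (- (h * k)).
Proof.
move=> h0 r0; rewrite /min_powR ge_min => -[rk|rk]; apply/orP; [left|right].
  rewrite /powR gt_eqF// ler_expR -mulrN ler_wpM2l//.
  by rewrite -[leRHS]expRK ler_ln ?posrE ?expR_gt0.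
rewrite /powR gt_eqF// ler_expR mulNr lerN2 ler_wpM2l//.
by rewrite -[leLHS]expRK ler_ln ?posrE ?expR_gt0.
Qed.

(** Exhaust the space by the shells [D k], between the radii expR(-k) and expR(k). Passing from
    [D k] to [D k.+1] adds two shells of mass [W] each, on which [min_powR h] is at most q^k with q
    = expR(-h). The integrals are thus bounded by a geometric series, and monotone convergence
    concludes. *)
Lemma radial_min_powR_finite h : 0 < h ->
  (\int[lam]_x (enorm x `^ (- n%:R) * min_powR h (enorm x))%:E < +oo)%E.
Proof.
move=> h0.
pose f x := enorm x `^ (- n%:R) * min_powR h (enorm x).
have f0 x : 0 <= f x by rewrite mulr_ge0 ?powR_ge0 ?min_powR_ge0.
have mf : measurable_fun setT f.
  apply: measurable_funM; first exact: measurable_enorm_powR.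
  by apply: measurable_min_powR; exact: measurable_enorm_id.
pose D k := ann (expR (- k%:R)) (expR k%:R).
pose g (k : nat) x := (\1_(D k) x * f x)%:E.
have g0 k x : (0 <= g k x)%E by rewrite lee_fin mulr_ge0.
have mg k : measurable_fun setT (g k).
  apply/measurable_EFinP; apply: measurable_funM => //.
  by apply: measurable_indic; exact: measurable_ann.
have Dsub (i j : nat) : (i <= j)%N -> D i `<=` D j.
  move=> ij x [/= x1 x2]; split => /=.
    by apply: le_lt_trans x1; rewrite ler_expR lerN2 ler_nat.
  by apply: le_trans x2 _; rewrite ler_expR ler_nat.
have ndg x : nondecreasing_seq (g ^~ x).
  move=> i j ij; rewrite lee_fin ler_wpM2r// !indicE ler_nat.
  case: (boolP (x \in D i)) => // xi; rewrite mem_set//.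
  by apply: (Dsub _ _ ij); rewrite inE in xi.
have gf x : g ^~ x @ \oo --> (f x)%:E.
  have [->|x0] := eqVneq x 0.
    rewrite /g /f enorm0 powR0 ?mul0r; last by rewrite oppr_eq0 pnatr_eq0 -lt0n.
    by under eq_fun do rewrite mulr0; exact: cvg_cst.
  have e0 : 0 < enorm x by rewrite enorm_gt0.
  pose k0 := (Num.truncn `|ln (enorm x)|).+1.
  apply: cvg_near_cst.
  exists k0 => // k /= k0k; rewrite /g indicE mem_set ?mul1r//.
  have H : `|ln (enorm x)| < k%:R.
    by apply: lt_le_trans (truncnS_gt _) _; rewrite ler_nat.
  move: H; rewrite ltr_norml => /andP[H1 H2]; split => /=.
    by rewrite -[ltRHS]lnK ?posrE// ltr_expR.
  by rewrite -[leLHS]lnK ?posrE// ler_expR ltW.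
pose q := expR (- h).
have q0 : 0 < q by exact: expR_gt0.
have q1 : q < 1 by rewrite -expR0 ltr_expR oppr_lt0.
pose W := n%:R * vol.
have W0 : 0 <= W by rewrite mulr_ge0// ltW// vol_gt0.
have Ibnd k : (\int[lam]_x g k x <= (2 * W * ((1 - q ^+ k) / (1 - q)))%:E)%E.
  elim: k => [|k IH].
    rewrite expr0 subrr mul0r mulr0 integral0_eq// => x _.
    rewrite /g indicE memNset ?mul0r// => -[/=]; rewrite mulr0n oppr0 expR0 => x1 x2.
    by have := lt_le_trans x1 x2; rewrite ltxx.
  pose A1 := ann (expR k%:R) (expR k.+1%:R).
  pose A2 := ann (expR (- k.+1%:R)) (expR (- k%:R)).
  pose g1 (A : set 'rV[R]_n) x := ((q ^+ k)%:E * (\1_A x * enorm x `^ (- n%:R))%:E)%E.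
  have mg1 a b : measurable_fun setT (g1 (ann a b)).
    by apply: measurable_funeM; exact: annf_meas.
  have p1 (A : set 'rV[R]_n) x : 0 <= q ^+ k * (\1_A x * enorm x `^ (- n%:R)).
    by rewrite mulr_ge0 ?exprn_ge0 ?(ltW q0)// mulr_ge0 ?powR_ge0.
  have p2 (A : set 'rV[R]_n) x : 0 <= \1_A x * f x by rewrite mulr_ge0.
  have g10 A x : (0 <= g1 A x)%E by rewrite /g1 -EFinM lee_fin mulr_ge0 ?exprn_ge0 ?(ltW q0)// mulr_ge0 ?powR_ge0.
  apply: (@le_trans _ _ (\int[lam]_x (g k x + (g1 A1 x + g1 A2 x)))%E).
    apply: ge0_le_integral => //.
      by apply: emeasurable_funD => //; apply: emeasurable_funD; exact: mg1.
    move=> x _; rewrite /g1 -!EFinM -!EFinD lee_fin.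
    have [[/= x1 x2]|xD] := pselect (D k.+1 x); last first.
      by rewrite (indicE _ (D k.+1)) memNset// mul0r addr_ge0// addr_ge0.
    rewrite (indicE _ (D k.+1)) mem_set// mul1r.
    have e0 : 0 < enorm x by apply: lt_trans x1; exact: expR_gt0.
    have qE : q ^+ k = expR (- (h * k%:R)) by rewrite /q -expRM_natl mulrN mulrC.
    have [xk|xk] := leP (enorm x) (expR k%:R); last first.
      apply: (@le_trans _ _ (q ^+ k * (\1_A1 x * enorm x `^ (- n%:R)))); last first.
        by rewrite addrCA lerDl addr_ge0.
      rewrite indicE mem_set// mul1r /f mulrC ler_wpM2r ?powR_ge0//.
      by rewrite qE; apply: min_powR_le_expR; [exact: ltW|by []|right; exact: ltW].
    have [xk'|xk'] := leP (enorm x) (expR (- k%:R)); last first.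
      rewrite (indicE _ (D k)) mem_set// mul1r lerDl.
      by rewrite addr_ge0.
    apply: (@le_trans _ _ (q ^+ k * (\1_A2 x * enorm x `^ (- n%:R)))); last first.
      by rewrite addrA lerDr addr_ge0.
    rewrite indicE mem_set// mul1r /f mulrC ler_wpM2r ?powR_ge0//.
    by rewrite qE; apply: min_powR_le_expR; [exact: ltW|by []|left].
  rewrite ge0_integralD//; last 2 first.
    by move=> x _; apply: adde_ge0.
    by apply: emeasurable_funD; exact: mg1.
  rewrite ge0_integralD//; [|exact: mg1|exact: mg1].
  have g1E a b : (\int[lam]_x g1 (ann a b) x = (q ^+ k)%:E * annI a b)%E.
    rewrite ge0_integralZl// ?lee_fin ?exprn_ge0 ?(ltW q0)//.
  rewrite !g1E.
  have eE : expR (k.+1%:R : R) = expR k%:R * expR 1 by rewrite -expRD -natr1.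
  have -> : annI (expR k%:R) (expR k.+1%:R) = W%:E.
    have := annI_scale 1 (expR 1) (expR_gt0 k%:R); rewrite mulr1 -eE => ->.
    by rewrite annI_ln ?expRK ?mulr1// -[leLHS]expR0 ler_expR.
  have -> : annI (expR (- k.+1%:R)) (expR (- k%:R)) = W%:E.
    have := annI_scale 1 (expR 1) (expR_gt0 (- k.+1%:R)).
    rewrite mulr1 -expRD -natr1 opprD addrNK => ->.
    by rewrite annI_ln ?expRK ?mulr1// -[leLHS]expR0 ler_expR.
  rewrite -!EFinM -!EFinD; apply: le_trans (leeD2r _ IH) _.
  rewrite -EFinD lee_fin le_eqVlt; apply/orP; left; apply/eqP.
  by rewrite exprS; field; rewrite subr_eq0 gt_eqF.
apply: (@le_lt_trans _ _ (2 * W / (1 - q))%:E); last by rewrite ltry.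
rewrite (_ : (\int[lam]_x _)%E = limn (fun k => (\int[lam]_x g k x)%E)); last first.
  rewrite -monotone_convergence//.
  by apply: eq_integral => x _; apply/esym/cvg_lim => //; exact: gf.
apply: lime_le.
  apply: ereal_nondecreasing_is_cvgn => i j ij; apply: ge0_le_integral => //.
  by move=> x _; exact: ndg.
apply: nearW => k; apply: le_trans (Ibnd k) _.
have q1' : 0 < 1 - q by rewrite subr_gt0.
rewrite lee_fin; apply: ler_wpM2l; first by rewrite mulr_ge0.
rewrite ler_pdivrMr// mulVf ?gt_eqF//.
by rewrite gerBl exprn_ge0// ltW.
Qed.

End radial.

(** * Estimates for test functions *)

Section test_functions.
Context {R : realType} (n : nat).
Implicit Types (x y h : 'rV[R]_n) (f : 'rV[R]_n -> R).

(** The sigma-algebra is generated by the coordinates, so a sublevel set is written as a countable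
    union of sets measurable through [enorm]: f x < a if and only if f q + C |x - q| < a for some
    rational point [q], by the Lipschitz bound and density. *)
Lemma lipschitz_measurable f (C : R) : 0 <= C ->
  (forall x y, `|f x - f y| <= C * enorm (x - y)) -> measurable_fun setT f.
Proof.
move=> C0 fC.
have dense x (e : R) : 0 < e -> exists q : 'rV[rat]_n, enorm (x - map_mx ratr q) <= e.
  move=> e0; have en0 : 0 < e / n.+1%:R by rewrite divr_gt0.
  set d := e / n.+1%:R in en0.
  have H i : exists r : rat, `|x ord0 i - ratr r| < d.
    have /rat_in_itvoo[r] : x ord0 i - d < x ord0 i + d by lra.
    by rewrite in_itv/= => /andP[r1 r2]; exists r; rewrite ltr_distlC r1 r2.
  have [g gP] := choice H.
  exists (\row_i g i); apply: le_trans (enorm_le_sum _) _.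
  apply: (@le_trans _ _ (\sum_(i < n) d)).
    by apply: ler_sum => i _; rewrite !mxE; exact/ltW.
  rewrite sumr_const card_ord -[leLHS]mulr_natl /d mulrCA ler_piMr ?(ltW e0)//.
  by rewrite ler_pdivrMr// mul1r ler_nat.
apply: (measurability _ (RGenInftyO.measurableE R)) => _ [_ [a ->] <-].
rewrite setTI (_ : _ @^-1` _ = \bigcup_(q : 'rV[rat]_n)
   [set x | f (map_mx ratr q) + C * enorm (x - map_mx ratr q) < a]).
  apply: countable_bigcupT_measurable; first exact: countableP.
  move=> q; apply: measurable_ltr_set => //.
  apply: measurable_funD => //; apply: measurable_funM => //.
  by apply: measurable_enorm; exact: measurable_rV_sub.
apply/seteqP; split => x /=; rewrite in_itv/=.
  move=> fxa; have e0 : 0 < (a - f x) / 4 / (C + 1).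
    by rewrite !divr_gt0 ?subr_gt0// ltr_wpDl.
  have [q xq] := dense x _ e0; exists q => //=.
  have H1 : f (map_mx ratr q) <= f x + C * enorm (x - map_mx ratr q).
    by rewrite -lerBlDl; apply: le_trans (ler_norm _) _; rewrite distrC fC.
  have H2 : (C + 1) * enorm (x - map_mx ratr q) <= (a - f x) / 4.
    by rewrite mulrC -ler_pdivlMr ?ltr_wpDl.
  have fx0 : 0 < a - f x by rewrite subr_gt0.
  have := enorm_ge0 (x - map_mx ratr q).
  move: H1 H2; set z := enorm _; set u := f (map_mx _ _) => H1 H2 q0.
  rewrite mulrDl mul1r in H2; lra.
case=> q _ /=; apply: le_lt_trans.
by rewrite -lerBlDl; apply: le_trans (ler_norm _) _; rewrite fC.
Qed.

Local Notation e i := (delta_mx ord0 i : 'rV[R]_n).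

Lemma partial_line f i x (t : R) : (forall y, derivable f y (e i)) ->
  is_derive t 1 (fun u => f (x + u *: e i)) (partial i f (x + t *: e i)).
Proof.
move=> df; pose g (u : R) : R := f (x + u *: e i).
have E : (fun k : R => k^-1 *: ((g \o shift t) (k *: (1 : R)) - g t)) =
  (fun k : R => k^-1 *: ((f \o shift (x + t *: e i)) (k *: e i) - f (x + t *: e i))).
  apply/funext => k; congr (_ *: (_ - _)); rewrite /shift/= /g; congr f.
  by rewrite [k *: 1]mulr1 scalerDl addrCA.
have dg : derivable g t (1 : R) by rewrite /derivable E; exact: df.
by apply: (DeriveDef dg); rewrite /derive E.
Qed.

Lemma partial_mvt f i x (t : R) : (forall y, derivable f y (e i)) ->
  exists2 c, `|c| <= `|t| & f (x + t *: e i) - f x = t * partial i f (x + c *: e i).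
Proof.
move=> df; pose g u := f (x + u *: e i).
have dg (u : R) : is_derive u 1 g (partial i f (x + u *: e i)) by exact: partial_line.
have cg (a b : R) : {within `[a, b], continuous g}.
  apply: derivable_within_continuous => u _.
  by have [] := dg u.
have g0 : g 0 = f x by rewrite /g scale0r addr0.
have [t0|t0] := leP 0 t.
  have [c] := MVT_segment t0 (fun u _ => dg u) (cg _ _).
  rewrite in_itv/= g0 subr0 => /andP[c0 ct] ->; exists c; last by rewrite mulrC.
  by rewrite !ger0_norm.
have [c] := MVT_segment (ltW t0) (fun u _ => dg u) (cg _ _).
rewrite in_itv/= g0 sub0r => /andP[c0 ct] E; exists c.
  by rewrite !ler0_norm ?lerN2// ltW.
by rewrite -/(g t) -opprB E mulrN opprK mulrC.
Qed.

Lemma enorm_le_coord x y : (forall i, `|x ord0 i| <= `|y ord0 i|) -> enorm x <= enorm y.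
Proof.
move=> xy; rewrite /enorm ler_wsqrtr//; apply: ler_sum => i _.
by rewrite -(real_normK (num_real (x ord0 i))) -(real_normK (num_real (y ord0 i))) lerXn2r ?nnegrE.
Qed.

(** Only partial derivatives are at hand, so the path from [x] to [x + h] changes one coordinate at
    a time and the mean value theorem in one variable is applied to each leg. The intermediate
    points differ from [x] by at most |h| because each of their coordinates moves by at most that of
    [h]. *)
Lemma gradient_mvt f x h : (forall i y, derivable f y (e i)) ->
  exists2 y : 'I_n -> 'rV[R]_n, forall i, enorm (y i - x) <= enorm h &
    f (x + h) - f x = \sum_i h ord0 i * partial i f (y i).
Proof.
move=> df.
pose p (k : nat) : 'rV[R]_n := \row_i (if (i < k)%N then h ord0 i else 0).
have pS (i : 'I_n) : p i.+1 = p i + h ord0 i *: e i.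
  apply/rowP => j; rewrite !mxE eqxx/= ltnS leq_eqVlt.
  have [->|ij] := eqVneq j i; first by rewrite eqxx ltnn add0r mulr1.
  by rewrite (negbTE (ij : nat_of_ord j != i)) mulr0 addr0.
have H (i : 'I_n) : exists y, enorm (y - x) <= enorm h /\
    f (x + p i.+1) - f (x + p i) = h ord0 i * partial i f y.
  have [c ch E] := partial_mvt (x + p i) (h ord0 i) (df i).
  exists (x + p i + c *: e i); split; last by rewrite pS addrA.
  rewrite addrAC (addrAC x) subrr add0r addrC; apply: enorm_le_coord => j.
  rewrite !mxE eqxx/=; have [->|ij] := eqVneq j i; first by rewrite ltnn addr0 mulr1.
  by rewrite mulr0 add0r; case: ifP; rewrite ?normr0.
have [y yP] := choice H.
exists y; first by move=> i; have [] := yP i.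
have -> : f (x + h) - f x = \sum_(0 <= k < n) (f (x + p k.+1) - f (x + p k)).
  rewrite telescope_sumr//; congr (f (x + _) - f _).
    by apply/rowP => i; rewrite !mxE ltn_ord.
  by rewrite [p 0%N](_ : _ = 0) ?addr0//; apply/rowP => i; rewrite !mxE.
by rewrite big_mkord; apply: eq_bigr => i _; have [_ ->] := yP i.
Qed.

Lemma enorm_sum_le h : \sum_i `|h ord0 i| <= n%:R * enorm h.
Proof.
apply: (@le_trans _ _ (\sum_(i < n) enorm h)); first by apply: ler_sum => i _; exact: enorm_coord.
by rewrite sumr_const card_ord -[leLHS]mulr_natl.
Qed.

Lemma bounded_gradient_lipschitz f (M : R) : 0 <= M -> (forall i y, derivable f y (e i)) ->
  (forall i y, `|partial i f y| <= M) ->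
  forall x y, `|f x - f y| <= (n%:R * M) * enorm (x - y).
Proof.
move=> M0 df fM x y; have [z _] := gradient_mvt y (x - y) df.
rewrite (addrC y) subrK => ->.
apply: le_trans (ler_norm_sum _ _ _) _.
apply: (@le_trans _ _ (\sum_i `|(x - y) ord0 i| * M)).
  by apply: ler_sum => i _; rewrite normrM ler_wpM2l.
rewrite -mulr_suml mulrAC; apply: ler_wpM2r => //. exact: enorm_sum_le.
Qed.

Lemma compact_support_bounded f (K : set 'rV[R]_n) : compact K ->
  continuous f -> (forall x, ~ K x -> f x = 0) ->
  exists2 M : R, 0 <= M & forall x, `|f x| <= M.
Proof.
move=> cK cf f0.
have cfK : compact (f @` K).
  by apply: continuous_compact => //; exact: continuous_subspaceT.
have [M [_ HM]] := compact_bounded cfK.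
exists (`|M| + 1); first by rewrite addr_ge0.
move=> x; have [xK|xK] := pselect (K x); last by rewrite f0// normr0 addr_ge0.
apply: HM; last by exists x.
by rewrite (le_lt_trans (ler_norm _))// ltrDl.
Qed.

Lemma partial_support f (K : set 'rV[R]_n) i : closed K ->
  (forall x, ~ K x -> f x = 0) -> forall x, ~ K x -> partial i f x = 0.
Proof.
move=> cK f0 x xK.
have oK : open (~` K) by exact: closed_openC.
have : \forall y \near x, f y = cst 0 y.
  have : nbhs x (~` K) by exact: open_nbhs_nbhs.
  by apply: filterS => y; exact: f0.
move=> H; rewrite /partial (near_eq_derive _ H).
  by rewrite derive_cst.
Qed.

Variable xi : 'rV[R]_n -> R.
Hypothesis xiC : is_C2c xi.

Let K := closure [set x | xi x != 0].

Let xi0 x : ~ K x -> xi x = 0.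
Proof.
move=> xK; apply/eqP; apply: contra_notT xK => xN0; exact: subset_closure.
Qed.

Let cK : closed K. Proof. exact: closed_closure. Qed.

Let compK : compact K. Proof. by case: xiC. Qed.

Lemma test_lipschitz : exists2 C : R, 0 <= C & forall x y, `|xi x - xi y| <= C * enorm (x - y).
Proof.
have [[C1 C2] _] := xiC.
have H i : exists M, 0 <= M /\ forall x, `|partial i xi x| <= M.
  have [_ cp] := C1 i.
  have [M M0 HM] := compact_support_bounded compK cp (partial_support i cK xi0).
  by exists M.
have [M MP] := choice H.
exists (n%:R * \sum_i M i); first by rewrite mulr_ge0// sumr_ge0// => i _; have [] := MP i.
apply: bounded_gradient_lipschitz; first by rewrite sumr_ge0// => i _; have [] := MP i.
  by move=> i; have [] := C1 i.
move=> i y; have [_ /(_ y)] := MP i => /le_trans; apply.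
by rewrite (bigD1 i)//= lerDl sumr_ge0// => j _; have [] := MP j.
Qed.

(** The second difference is the difference of two mean value expansions along [h], one based at [x]
    and one at [x - h]. The partial derivatives are Lipschitz, and their evaluation points are at
    distance at most 3 |h|: one |h| for each point from its base and one between the bases. *)
Lemma test_second_difference : exists2 C : R, 0 <= C &
  forall x h, `|xi (x + h) + xi (x - h) - 2 * xi x| <= C * enorm h ^+ 2.
Proof.
have [[C1 C2] _] := xiC.
have H i : exists M, 0 <= M /\ forall x y, `|partial i xi x - partial i xi y| <= M * enorm (x - y).
  have H j : exists M, 0 <= M /\ forall x, `|partial j (partial i xi) x| <= M.
    have [_ cp] := C2 i j.
    have [M M0 HM] := compact_support_bounded compK cp
      (partial_support j cK (partial_support i cK xi0)).
    by exists M.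
  have [M MP] := choice H.
  exists (n%:R * \sum_j M j); split; first by rewrite mulr_ge0// sumr_ge0// => j _; have [] := MP j.
  apply: bounded_gradient_lipschitz; first by rewrite sumr_ge0// => j _; have [] := MP j.
    by move=> j; have [] := C2 i j.
  move=> j y; have [_ /(_ y)] := MP j => /le_trans; apply.
  by rewrite (bigD1 j)//= lerDl sumr_ge0// => k _; have [] := MP k.
have [M MP] := choice H.
have M0 i : 0 <= M i by have [] := MP i.
have dxi i y : derivable xi y (e i) by have [] := C1 i.
exists (3 * \sum_i M i); first by rewrite mulr_ge0// sumr_ge0.
move=> x h.
have [y yx yE] := gradient_mvt x h dxi.
have [z zx zE] := gradient_mvt (x - h) h dxi.
rewrite subrK in zE.
have -> : xi (x + h) + xi (x - h) - 2 * xi x = (xi (x + h) - xi x) - (xi x - xi (x - h)) by ring.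
rewrite yE zE -sumrB; apply: le_trans (ler_norm_sum _ _ _) _.
rewrite mulr_sumr mulr_suml; apply: ler_sum => i _.
rewrite -mulrBr normrM expr2.
have e0 := enorm_ge0 h.
have h1 := enorm_coord h i.
have h2 : `|partial i xi (y i) - partial i xi (z i)| <= M i * (3 * enorm h).
  have [_ /(_ (y i) (z i))/le_trans] := MP i; apply; apply: ler_wpM2l => //.
  have -> : y i - z i = (y i - x) + (h - (z i - (x - h))).
    by apply/rowP => j; rewrite !mxE; ring.
  apply: le_trans (ler_enormD _ _) _.
  have := ler_enormB h (z i - (x - h)); have := yx i; have := zx i; lra.
apply: le_trans (ler_pM _ _ h1 h2) _ => //.
rewrite le_eqVlt; apply/orP; left; apply/eqP; ring.
Qed.

Lemma test_support : exists2 r : R, 1 <= r & forall x, r <= enorm x -> xi x = 0.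
Proof.
have [M [_ HM]] := compact_bounded compK.
exists (n%:R * (`|M| + 1) + 1); first by rewrite lerDr mulr_ge0// addr_ge0.
move=> x xr; apply: xi0 => Kx.
have Mx : `|x| <= `|M| + 1 by apply: HM => //; rewrite (le_lt_trans (ler_norm _))// ltrDl.
have : enorm x <= n%:R * (`|M| + 1).
  apply: le_trans (enorm_le_sum x) _.
  apply: (@le_trans _ _ (\sum_(i < n) (`|M| + 1))); last by rewrite sumr_const card_ord -[leLHS]mulr_natl.
  apply: ler_sum => i _; apply: le_trans Mx.
  rewrite [leRHS]mx_normrE; apply: (le_bigmax _ (fun ij => `|x ij.1 ij.2|) (ord0, i)).
by move: xr; lra.
Qed.

End test_functions.

(** * Elementary inequalities for powers and logarithms *)

Section powers.
Context {R : realType}.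
Implicit Types r t u v a h : R.

Lemma powR_expR r a : 0 < r -> r `^ a = expR (a * ln r).
Proof. by move=> r0; rewrite /powR gt_eqF. Qed.

Lemma powRDg r a b : 0 < r -> r `^ (a + b) = r `^ a * r `^ b.
Proof. by move=> r0; rewrite powRD// (gt_eqF r0) implybT. Qed.

Lemma powR_ge1 r a : 1 <= r -> 0 <= a -> 1 <= r `^ a.
Proof. by move=> r1 a0; rewrite -(powRr0 r) ler_powR. Qed.

Lemma powR_le1 r a : 0 < r <= 1 -> 0 <= a -> r `^ a <= 1.
Proof. by move=> r1 a0; rewrite -[leRHS](powRr0 r) ger_powR. Qed.

Lemma powRN_ge1 r a : 0 < r <= 1 -> 0 <= a -> 1 <= r `^ (- a).
Proof. by move=> r1 a0; rewrite -(powRr0 r) ger_powR// oppr_le0. Qed.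

Lemma min_powR_le1 h r : 0 <= h -> 0 < r <= 1 -> min_powR h r = r `^ h.
Proof.
move=> h0 r1; apply/min_idPl.
by apply: ger_powR => //; lra.
Qed.

Lemma min_powR_ge1 h r : 0 <= h -> 1 <= r -> min_powR h r = r `^ (- h).
Proof. by move=> h0 r1; apply/min_idPr; apply: ler_powR => //; lra. Qed.

Lemma powR_le_min_powR h r rho : 0 <= h -> 0 < r <= rho -> 1 <= rho ->
  r `^ h <= rho `^ (2 * h) * min_powR h r.
Proof.
move=> h0 /andP[r0 rrho] rho1; have [r1|r1] := leP r 1.
  rewrite min_powR_le1 ?r0// -[leLHS]mul1r ler_wpM2r ?powR_ge0// powR_ge1// mulr_ge0//.
rewrite min_powR_ge1 ?(ltW r1)// -ler_pdivrMr ?powR_gt0// -powRN opprK -powRDg//.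
rewrite -mulr2n -[h *+ 2]mulr_natl; apply: ge0_ler_powR => //.
- by rewrite mulr_ge0.
- by rewrite nnegrE ltW.
- by rewrite nnegrE (le_trans _ rho1).
Qed.

Lemma le_min_powR h r rho : 0 <= h <= 1 -> 0 < r <= rho -> 1 <= rho ->
  r <= rho `^ 2 * min_powR h r.
Proof.
move=> /andP[h0 h1] /andP[r0 rrho] rho1; have [r1|r1] := leP r 1.
  rewrite min_powR_le1 ?r0//; apply: (@le_trans _ _ (r `^ h)).
    by rewrite -[leLHS]powRr1 ?(ltW r0)// ger_powR// r0.
  by rewrite -[leLHS]mul1r ler_wpM2r ?powR_ge0// powR_ge1.
rewrite min_powR_ge1 ?(ltW r1)// -ler_pdivrMr ?powR_gt0// -powRN opprK.
rewrite -[X in X * _]powRr1 ?(ltW r0)// -powRDg//.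
apply: (@le_trans _ _ (r `^ 2)); first by apply: ler_powR; lra.
by apply: ge0_ler_powR; rewrite ?nnegrE ?(ltW r0)// (le_trans _ rho1).
Qed.

(** Interpolates between a Lipschitz bound, used for u <= 1, and a uniform bound, used for u > 1. *)
Lemma lip_min_powR (C B u h : R) : 0 <= C -> 0 <= B -> 0 <= u -> 0 < h <= 1 ->
  Num.min (C * u) B <= (C + B) * u `^ h.
Proof.
move=> C0 B0 u0 /andP[h0 h1]; rewrite ge_min; apply/orP; have [u1|u1] := leP u 1.
  left; apply: (@le_trans _ _ (C * u `^ h)); last by rewrite ler_wpM2r ?powR_ge0// lerDl.
  apply: ler_wpM2l => //; move: u0; rewrite le_eqVlt => /predU1P[<-|u0]; first exact: powR_ge0.
  by rewrite -[leLHS]powRr1 ?(ltW u0)// ger_powR// u0.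
right; apply: (@le_trans _ _ (B * u `^ h)); last by rewrite ler_wpM2r ?powR_ge0// lerDr.
by rewrite ler_peMr// powR_ge1// ltW.
Qed.

Lemma one_plus_powR t h : 0 < t -> 0 < h <= 1 ->
  (1 + t) `^ h <= 2 * (t `^ h + t `^ (- h)).
Proof.
move=> t0 /andP[h0 h1]; have [t1|t1] := leP t 1.
  apply: (@le_trans _ _ (2 `^ h)).
    by apply: ge0_ler_powR; rewrite ?nnegrE ?(ltW h0)//; lra.
  apply: (@le_trans _ _ 2); first by apply: ler1_powR => //; lra.
  rewrite ler_peMr//; apply: (@le_trans _ _ (t `^ (- h))); last by rewrite lerDr powR_ge0.
  by apply: powRN_ge1; rewrite ?t0//= ltW.
apply: (@le_trans _ _ ((2 * t) `^ h)).
  by apply: ge0_ler_powR; rewrite ?nnegrE ?(ltW h0)//; lra.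
rewrite powRM ?(ltW t0)//; apply: ler_pM; rewrite ?powR_ge0//.
  by apply: ler1_powR => //; lra.
by rewrite lerDl powR_ge0.
Qed.

(** Apply ln u <= u - 1 to u = t^(-k), then use t^(1-k) <= 1. The factor 1 - t, which vanishes at
    the diagonal |z| = |x|, is bought with an arbitrarily small negative power at 0. *)
Lemma neg_ln_le t k : 0 < t <= 1 -> 0 < k <= 1 -> - ln t <= k^-1 * ((1 - t) * t `^ (- k)).
Proof.
move=> /andP[t0 t1] /andP[k0 k1]; rewrite -ler_pdivrMl ?invr_gt0// invrK.
have tk : 0 < t `^ (- k) by rewrite powR_gt0.
have -> : k * - ln t = ln (t `^ (- k)) by rewrite ln_powR mulrN mulNr.
apply: (@le_trans _ _ (t `^ (- k) - 1)).
  rewrite lerBrDr -{2}[t `^ _]lnK ?posrE// addrC; exact: expR_ge1Dx.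
rewrite mulrBl mul1r lerD2l lerN2 -{1}(powRr1 (ltW t0)) -powRDg// powR_le1 ?t0//; lra.
Qed.

Lemma powR_half_le u a : 2^-1 <= u <= 2 -> u `^ a <= 2 `^ `|a|.
Proof.
move=> /andP[u1 u2]; have u0 : 0 < u by apply: lt_le_trans u1; lra.
rewrite !powR_expR// ler_expR; apply: le_trans (ler_norm _) _.
rewrite normrM ler_wpM2l// ler_norml; apply/andP; split.
  by rewrite -lnV ?posrE// ler_ln ?posrE.
by rewrite ler_ln ?posrE.
Qed.

(** By expR B >= expR A (1 + B - A), the increment of the exponential is controlled by that of a ln,
    and ln is 2-Lipschitz on [1/2, 2]. *)
Lemma powR_half_lip u v a : 2^-1 <= u <= 2 -> 2^-1 <= v <= 2 ->
  `|u `^ a - v `^ a| <= 2 * `|a| * 2 `^ `|a| * `|u - v|.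
Proof.
have main (p q : R) : 2^-1 <= p <= 2 -> 2^-1 <= q <= 2 ->
    p `^ a - q `^ a <= 2 * `|a| * 2 `^ `|a| * `|p - q|.
  move=> hp hq; have p0 : 0 < p by lra. have q0 : 0 < q by lra.
  apply: (@le_trans _ _ (p `^ a * (a * ln p - a * ln q))).
    rewrite !powR_expR//.
    have := expR_ge1Dx (a * ln q - a * ln p).
    set A := a * ln p; set B := a * ln q => H.
    have -> : expR B = expR A * expR (B - A) by rewrite -expRD addrC subrK.
    rewrite -[X in X - _]mulr1 -mulrBr; apply: ler_wpM2l; first exact: expR_ge0.
    lra.
  apply: (@le_trans _ _ (2 `^ `|a| * (`|a| * (2 * `|p - q|)))); last by rewrite le_eqVlt; apply/orP; left; apply/eqP; ring.
  apply: (@le_trans _ _ (p `^ a * (`|a| * (2 * `|p - q|)))); last first.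
    by apply: ler_wpM2r; [rewrite !mulr_ge0|exact: powR_half_le].
  apply: ler_wpM2l; first exact: powR_ge0.
  rewrite -mulrBr; apply: le_trans (ler_norm _) _; rewrite normrM; apply: ler_wpM2l => //.
  have ln_le (x y : R) : 2^-1 <= x -> 2^-1 <= y -> ln x - ln y <= 2 * `|x - y|.
    move=> hx hy; have x0 : 0 < x by lra. have y0 : 0 < y by lra.
    have -> : ln x - ln y = ln (x / y) by rewrite ln_div ?posrE.
    apply: (@le_trans _ _ (x / y - 1)).
      have xy0 : 0 < x / y by rewrite divr_gt0.
      rewrite lerBrDr -{2}[x / y]lnK ?posrE// addrC; exact: expR_ge1Dx.
    have -> : x / y - 1 = (x - y) / y by field; rewrite gt_eqF.
    apply: le_trans (ler_norm _) _; rewrite normrM mulrC; apply: ler_wpM2r => //.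
    by rewrite gtr0_norm ?invr_gt0// invf_ple ?posrE.
  rewrite ler_norml; apply/andP; split; last by apply: ln_le; lra.
  by rewrite lerNl opprB distrC; apply: ln_le; lra.
move=> hu hv; rewrite ler_norml main// andbT lerNl opprB distrC; exact: main.
Qed.

End powers.

(* [r `^ be] with the value 0 at [r = 0] also when [be = 0] *)
Definition gam {R : realType} (be r : R) : R := r * r `^ (be - 1).

Lemma gamE {R : realType} (be r : R) : 0 < r -> gam be r = r `^ be.
Proof.
by move=> r0; rewrite /gam -[X in X * _](powRr1 (ltW r0)) -powRDg// addrC subrK.
Qed.

Lemma gam0 {R : realType} (be : R) : gam be 0 = 0.
Proof. exact: mul0r. Qed.

Lemma gam_ge0 {R : realType} (be r : R) : 0 <= r -> 0 <= gam be r.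
Proof. by move=> r0; rewrite mulr_ge0 ?powR_ge0. Qed.

Section test_function_estimates.
Context {R : realType} (n : nat).
Hypothesis n_gt0 : (0 < n)%N.
Implicit Types (x y z k : 'rV[R]_n).
Variables (xi : 'rV[R]_n -> R) (C C2 rho be h : R).
Hypothesis C0 : 0 <= C.
Hypothesis xiL : forall x y, `|xi x - xi y| <= C * enorm (x - y).
Hypothesis C20 : 0 <= C2.
Hypothesis xi2 : forall x k, `|xi (x + k) + xi (x - k) - 2 * xi x| <= C2 * enorm k ^+ 2.
Hypothesis rho1 : 1 <= rho.
Hypothesis xi0 : forall x, rho <= enorm x -> xi x = 0.
Hypothesis h01 : 0 < h <= 1.

Let rho0 : 0 < rho. Proof. exact: lt_le_trans rho1. Qed.
Let rho0' : 0 <= rho. Proof. exact: ltW. Qed.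
Let h0 : 0 < h. Proof. by case/andP : h01. Qed.
Let h0' : 0 <= h. Proof. exact: ltW. Qed.
Let h1 : h <= 1. Proof. by case/andP : h01. Qed.

Lemma enorm_e1 : enorm (e1 n : 'rV[R]_n) = 1.
Proof.
rewrite /enorm (bigD1 (Ordinal n_gt0))//= mxE/= expr1n big1 ?addr0 ?sqrtr1// => i i0.
rewrite mxE (negbTE (_ : nat_of_ord i != 0%N)) ?expr0n//.
Qed.

Let B := 2 * rho * C.

Let B0 : 0 <= B. Proof. by rewrite !mulr_ge0// ltW. Qed.

Lemma test_bounded x : `|xi x| <= B.
Proof.
have [/xi0->|xr] := leP rho (enorm x); first by rewrite normr0.
have y0 : xi (rho *: e1 n) = 0 by apply: xi0; rewrite enormZ enorm_e1 mulr1 ler_norm.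
rewrite -[xi x]subr0 -y0; apply: le_trans (xiL _ _) _.
rewrite mulrC ler_wpM2r//; apply: le_trans (ler_enormB _ _) _.
rewrite enormZ enorm_e1 mulr1 gtr0_norm//; lra.
Qed.

Let far x z : rho <= enorm x -> z != 0 ->
  `|xi x - xi z| <= B * rho `^ h * enorm z `^ (- h).
Proof.
move=> /xi0-> z0; rewrite sub0r normrN.
have e0 : 0 < enorm z by rewrite enorm_gt0.
have [/xi0->|zr] := leP rho (enorm z).
  by rewrite normr0 !mulr_ge0 ?powR_ge0.
apply: le_trans (test_bounded z) _; rewrite -mulrA ler_peMr//.
rewrite powRN -ler_pdivrMr ?invr_gt0 ?powR_gt0// mul1r invrK.
by apply: ge0_ler_powR; rewrite ?nnegrE ?ltW.
Qed.

(** The bound used away from the diagonal: decay in |x| at both ends, paid for by a small power of t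
    = |z|/|x|. If |x| >= rho then xi x = 0, |z| < rho is the only case left, and |z|^(-h) = |x|^(-h)
    t^(-h). If |x| < rho, the Lipschitz and uniform bounds are interpolated at |x| + |z| = |x| (1 +
    t). *)
Lemma test_difference_min_powR : exists2 M : R, 0 <= M & forall x z, x != 0 -> z != 0 ->
  `|xi x - xi z| <= M * (min_powR h (enorm x) *
     ((enorm z / enorm x) `^ h + (enorm z / enorm x) `^ (- h))).
Proof.
pose M1 := B * rho `^ h; pose M2 := 2 * (C + 2 * B) * rho `^ (2 * h).
have M10 : 0 <= M1 by rewrite mulr_ge0 ?powR_ge0.
have M20 : 0 <= M2 by rewrite !mulr_ge0 ?powR_ge0// addr_ge0// mulr_ge0.
exists (M1 + M2); first by rewrite addr_ge0.
move=> x z; rewrite -!enorm_gt0 => x0 z0.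
set r := enorm x in x0 *; set t := enorm z / r.
have t0 : 0 < t by rewrite divr_gt0.
have zE : enorm z = r * t by rewrite /t mulrC divfK// gt_eqF.
have p0 : 0 <= t `^ h + t `^ (- h) by rewrite addr_ge0 ?powR_ge0.
have m0 : 0 <= min_powR h r by exact: min_powR_ge0.
have q0 : 0 <= min_powR h r * (t `^ h + t `^ (- h)) by exact: mulr_ge0.
rewrite mulrDl; have [xr|xr] := leP rho r.
  apply: (@le_trans _ _ (M1 * (min_powR h r * (t `^ h + t `^ (- h))))); last first.
    by rewrite lerDl mulr_ge0.
  apply: le_trans (far xr _) _; first by rewrite -enorm_gt0.
  rewrite -/M1 ler_wpM2l// zE powRM ?(ltW x0) ?(ltW t0)// min_powR_ge1 ?(le_trans rho1)//.
  by rewrite ler_wpM2l ?powR_ge0// lerDr powR_ge0.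
apply: (@le_trans _ _ (M2 * (min_powR h r * (t `^ h + t `^ (- h))))); last first.
  by rewrite lerDr mulr_ge0.
have u0 : 0 <= r * (1 + t) by rewrite mulr_ge0 ?(ltW x0)// addr_ge0// ltW.
apply: (@le_trans _ _ (Num.min (C * (r * (1 + t))) (2 * B))).
  rewrite le_min; apply/andP; split.
    apply: le_trans (xiL _ _) _; apply: ler_wpM2l => //.
    by apply: le_trans (ler_enormB _ _) _; rewrite -/r zE mulrDr mulr1.
  apply: le_trans (ler_normB _ _) _.
  have := test_bounded x; have := test_bounded z; lra.
apply: le_trans (lip_min_powR C0 _ u0 h01) _; first by rewrite mulr_ge0.
rewrite powRM ?(ltW x0)// ?addr_ge0 ?(ltW t0)//.
have A1 : r `^ h <= rho `^ (2 * h) * min_powR h r by apply: powR_le_min_powR => //; rewrite x0 ltW.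
have A2 := one_plus_powR t0 h01.
rewrite /M2 (_ : _ * _ * _ * _ = (C + 2 * B) * ((rho `^ (2 * h) * min_powR h r) * (2 * (t `^ h + t `^ (- h))))); last ring.
rewrite ler_wpM2l ?addr_ge0 ?mulr_ge0//.
by apply: ler_pM; rewrite ?powR_ge0.
Qed.

(** Here the Lipschitz gain |x - z|/|x| is kept, to be spent at the diagonal. For |x| >= 2 rho it
    costs nothing: the difference is nonzero only if |z| < rho, and then |x - z| >= |x|/2. *)
Lemma test_difference_near : exists2 M : R, 0 <= M & forall x z, z != 0 -> enorm z < enorm x ->
  `|xi x - xi z| <= M * (min_powR h (enorm x) *
     (enorm (x - z) / enorm x * (enorm z / enorm x) `^ (- h))).
Proof.
pose M1 := 2 * (B * rho `^ h); pose M2 := C * (2 * rho) `^ 2.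
have M10 : 0 <= M1 by rewrite !mulr_ge0 ?powR_ge0.
have M20 : 0 <= M2 by rewrite !mulr_ge0 ?powR_ge0.
exists (M1 + M2); first by rewrite addr_ge0.
move=> x z; rewrite -!enorm_gt0 => z0 zx.
have x0 : 0 < enorm x by exact: lt_trans zx.
set r := enorm x in x0 zx *; set t := enorm z / r.
have t0 : 0 < t by rewrite divr_gt0.
have t1 : t <= 1 by rewrite ler_pdivrMr// mul1r ltW.
have zE : enorm z = r * t by rewrite /t mulrC divfK// gt_eqF.
have m0 : 0 <= min_powR h r by exact: min_powR_ge0.
set d := enorm (x - z); have d0 : 0 <= d / r by rewrite divr_ge0 ?enorm_ge0 ?(ltW x0).
have th : 0 <= t `^ (- h) by exact: powR_ge0.
have q0 : 0 <= min_powR h r * (d / r * t `^ (- h)) by rewrite mulr_ge0// mulr_ge0.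
rewrite mulrDl; have [xr|xr] := leP (2 * rho) r.
  apply: (@le_trans _ _ (M1 * (min_powR h r * (d / r * t `^ (- h))))); last first.
    by rewrite lerDl mulr_ge0.
  have xr' : rho <= r by lra.
  have [zr|zr] := leP rho (enorm z).
    by rewrite (xi0 zr) (@xi0 x)// subrr normr0 mulr_ge0.
  apply: le_trans (far xr' _) _; first by rewrite -enorm_gt0.
  rewrite zE powRM ?(ltW x0) ?(ltW t0)// min_powR_ge1 ?(le_trans rho1)//.
  rewrite /M1 (_ : 2 * _ * _ = B * rho `^ h * (r `^ (- h) * t `^ (- h)) * (2 * (d / r))); last ring.
  rewrite ler_peMr ?mulr_ge0 ?powR_ge0//.
  rewrite mulrA ler_pdivlMr// mul1r.
  have := ler_enorm_sub x z; rewrite -/r -/d; lra.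
apply: (@le_trans _ _ (M2 * (min_powR h r * (d / r * t `^ (- h))))); last first.
  by rewrite lerDr mulr_ge0.
have A1 : r <= (2 * rho) `^ 2 * min_powR h r.
  by apply: le_min_powR; [rewrite h0' h1|rewrite x0 ltW|move: rho1; lra].
have A2 : 1 <= t `^ (- h) by apply: powRN_ge1; rewrite ?t0.
apply: le_trans (xiL _ _) _; rewrite -/d.
rewrite /M2 (_ : _ * _ * _ = C * (((2 * rho) `^ 2 * min_powR h r) * (d / r) * t `^ (- h))); last ring.
apply: ler_wpM2l => //.
apply: (@le_trans _ _ (((2 * rho) `^ 2 * min_powR h r) * (d / r))).
  by rewrite mulrA ler_pdivlMr// mulrC ler_wpM2r ?enorm_ge0.
by rewrite ler_peMr// mulr_ge0// mulr_ge0 ?powR_ge0.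
Qed.

(** Subtracting xi 0 on the unit ball leaves a Lipschitz function vanishing at 0, and compact
    support takes care of infinity. The remainder is therefore integrable against |x|^(-n). *)
Lemma test_minus_ball_min_powR : exists2 M : R, 0 <= M & forall x,
  `|xi x - xi 0 * \1_(cball 1) x| <= M * min_powR h (enorm x).
Proof.
pose M1 := C; pose M2 := B * rho `^ h.
have M20 : 0 <= M2 by rewrite !mulr_ge0 ?powR_ge0.
exists (M1 + M2); first by rewrite addr_ge0.
move=> x; set r := enorm x; rewrite mulrDl.
have m0 : 0 <= min_powR h r by exact: min_powR_ge0.
have [->|] := eqVneq x 0.
  have c0 : cball 1 (0 : 'rV[R]_n) by rewrite /cball/= enorm0.
  by rewrite indicE mem_set// mulr1 subrr normr0 addr_ge0// mulr_ge0.
rewrite -enorm_gt0 -/r => x0; rewrite indicE; have [r1|r1] := leP r 1.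
  rewrite mem_set// mulr1; apply: (@le_trans _ _ (M1 * min_powR h r)); last by rewrite lerDl mulr_ge0.
  apply: le_trans (xiL _ _) _; rewrite subr0 -/r ler_wpM2l//.
  rewrite min_powR_le1 ?x0//; rewrite -[leLHS]powRr1 ?(ltW x0)//.
  by apply: ger_powR; rewrite ?x0.
rewrite memNset ?mulr0 ?subr0; last by rewrite /cball/= -/r leNgt r1.
apply: (@le_trans _ _ (M2 * min_powR h r)); last by rewrite lerDr mulr_ge0.
have [/xi0->|xr] := leP rho (enorm x); first by rewrite normr0 mulr_ge0.
apply: le_trans (test_bounded x) _; rewrite -mulrA ler_peMr//.
rewrite min_powR_ge1 ?(ltW r1)// powRN -ler_pdivrMr ?invr_gt0 ?powR_gt0// mul1r invrK.
by apply: ge0_ler_powR; rewrite ?nnegrE ?ltW.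
Qed.

(** The integrand of the principal value without its kernel, summed over the two points symmetric
    about [x]. *)
Definition symm_diff x k := (xi x - xi (x + k)) * gam be (enorm (x + k)) +
  (xi x - xi (x - k)) * gam be (enorm (x - k)).

(** With u, v the norms of x + k, x - k divided by |x|, the sum is |x|^be times - (second
    difference) u^be + (xi x - xi (x - k)) (v^be - u^be), and both terms are quadratic in k. The
    condition on |k| keeps u and v in [1/2, 2], where the power is Lipschitz; for |x| >= 2 rho all
    the values of xi vanish. *)
Lemma symm_diff_near : exists2 M : R, 0 <= M & forall x k, x != 0 -> 2 * enorm k <= enorm x ->
  `|symm_diff x k| <= M * (min_powR h (enorm x) * (enorm x `^ be * (enorm k / enorm x) ^+ 2)).
Proof.
pose P := 2 `^ `|be|; pose Q := 2 * `|be| * P.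
have P0 : 0 <= P by exact: powR_ge0.
have Q0 : 0 <= Q by rewrite !mulr_ge0 ?powR_ge0.
pose M := (2 * rho) `^ 2 * (C2 * P * (2 * rho) + C * Q * 2).
exists M.
  by rewrite mulr_ge0 ?powR_ge0// addr_ge0// !mulr_ge0// ltW// mulr_gt0.
move=> x k; rewrite -enorm_gt0; set r := enorm x => r0.
set s := enorm k; move=> ks; have s0 : 0 <= s by exact: enorm_ge0.
have xpk : r - s <= enorm (x + k) <= r + s.
  by rewrite ler_enormD andbT -[k]opprK /s -(enormN k) ler_enorm_sub.
have xmk : r - s <= enorm (x - k) <= r + s.
  by rewrite ler_enormB andbT ler_enorm_sub.
have m0 : 0 <= min_powR h r by exact: min_powR_ge0.
have M0 : 0 <= M * (min_powR h r * (r `^ be * (s / r) ^+ 2)).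
  apply: mulr_ge0.
    by rewrite mulr_ge0 ?powR_ge0// addr_ge0// !mulr_ge0// ltW// mulr_gt0.
  by rewrite mulr_ge0// mulr_ge0 ?powR_ge0// sqr_ge0.
have [xr|xr] := leP (2 * rho) r.
  rewrite /symm_diff (@xi0 x) -/r; last lra.
  rewrite (@xi0 (x + k)); last lra.
  by rewrite (@xi0 (x - k)) ?subrr ?mul0r ?addr0 ?normr0//; lra.
pose u := enorm (x + k) / r; pose v := enorm (x - k) / r.
have uE : enorm (x + k) = r * u by rewrite /u mulrC divfK// gt_eqF.
have vE : enorm (x - k) = r * v by rewrite /v mulrC divfK// gt_eqF.
have hu : 2^-1 <= u <= 2.
  rewrite /u ler_pdivlMr// ler_pdivrMr//; apply/andP; split; lra.
have hv : 2^-1 <= v <= 2.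
  rewrite /v ler_pdivlMr// ler_pdivrMr//; apply/andP; split; lra.
have u0 : 0 <= u by lra. have v0 : 0 <= v by lra.
have uP : u `^ be <= P by exact: powR_half_le.
have uvQ : `|v `^ be - u `^ be| <= Q * `|v - u| by exact: powR_half_lip.
have uv : `|v - u| <= 2 * (s / r).
  rewrite /u /v -mulrBl normrM (ger0_norm (x := r^-1)) ?invr_ge0 ?(ltW r0)//.
  rewrite mulrA ler_wpM2r ?invr_ge0 ?(ltW r0)//.
  apply: le_trans (ler_dist_enorm _ _) _.
  rewrite (_ : x - k - (x + k) = (- 2) *: k); last first.
    by apply/rowP => i; rewrite !mxE; ring.
  by rewrite enormZ normrN ger0_norm.
have A1 : r <= (2 * rho) `^ 2 * min_powR h r.
  by apply: le_min_powR; [rewrite h0' h1|rewrite r0 ltW|move: rho1; lra].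
have -> : symm_diff x k = r `^ be * (- (xi (x + k) + xi (x - k) - 2 * xi x) * u `^ be +
    (xi x - xi (x - k)) * (v `^ be - u `^ be)).
  rewrite /symm_diff !gamE; [|lra|lra].
  clearbody u v; rewrite uE vE (powRM _ (ltW r0) u0) (powRM _ (ltW r0) v0).
  ring.
rewrite normrM ger0_norm ?powR_ge0//.
rewrite (_ : M * _ = r `^ be * (M * min_powR h r * (s / r) ^+ 2)); last ring.
apply: ler_wpM2l; first exact: powR_ge0.
apply: le_trans (ler_normD _ _) _; rewrite !normrM normrN (ger0_norm (powR_ge0 _ _)).
set w := s / r; have w0 : 0 <= w by rewrite divr_ge0 ?(ltW r0).
have sE : s = r * w by rewrite /w mulrC divfK// gt_eqF.
apply: (@le_trans _ _ (C2 * s ^+ 2 * P + C * s * (Q * (2 * w)))).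
  apply: lerD; first by apply: ler_pM => //; rewrite ?powR_ge0.
  apply: ler_pM => //.
    by apply: le_trans (xiL _ _) _; rewrite opprB addrC subrK.
  by apply: le_trans uvQ _; rewrite ler_wpM2l.
rewrite sE (_ : _ + _ = r * (C2 * P * r + C * Q * 2) * w ^+ 2); last ring.
apply: ler_wpM2r; first exact: sqr_ge0.
rewrite (_ : M * _ = ((2 * rho) `^ 2 * min_powR h r) * (C2 * P * (2 * rho) + C * Q * 2)); last by rewrite /M; ring.
apply: ler_pM => //; rewrite ?(ltW r0)//.
  by rewrite addr_ge0 ?mulr_ge0// ltW.
by rewrite lerD2r ler_wpM2l ?mulr_ge0// ltW.
Qed.

End test_function_estimates.

(** * The singular kernel *)

Lemma measurable_fun_powR {R : realType} d (T : measurableType d) (f : T -> R) (a : R) :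
  measurable_fun setT f -> measurable_fun setT (fun t => f t `^ a).
Proof. by move=> mf; have H := measurableT_comp (@measurable_powR R a) mf; exact: H. Qed.

Lemma measurable_fun_ln {R : realType} d (T : measurableType d) (f : T -> R) :
  measurable_fun setT f -> measurable_fun setT (fun t => ln (f t)).
Proof. by move=> mf; have H := measurableT_comp (@measurable_ln R) mf; exact: H. Qed.

Lemma measurable_fun_comp {R : realType} d (T : measurableType d) (g : R -> R) (f : T -> R) :
  measurable_fun setT g -> measurable_fun setT f -> measurable_fun setT (fun t => g (f t)).
Proof. by move=> mg mf; have H := measurableT_comp mg mf; exact: H. Qed.

Lemma measurable_indic_comp {R : realType} d (T : measurableType d) d' (U : measurableType d')
    (A : set U) (f : T -> U) :
  measurable A -> measurable_fun setT f -> measurable_fun setT (fun t => \1_A (f t) : R).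
Proof.
move=> mA mf; have mi : measurable_fun setT (\1_A : U -> R) by exact: measurable_indic.
by have H := measurableT_comp mi mf; exact: H.
Qed.

Lemma measurable_gam {R : realType} (be : R) : measurable_fun setT (gam be).
Proof. by apply: measurable_funM => //; exact: measurable_powR. Qed.

Lemma measurable_nat_ler {R : realType} d (T : measurableType d) (f g : T -> R) :
  measurable_fun setT f -> measurable_fun setT g ->
  measurable_fun setT (fun t => (f t <= g t)%R%:R : R).
Proof.
move=> mf mg; rewrite (_ : (fun _ => _) = \1_[set t | f t <= g t]).
  by apply: measurable_indic; exact: measurable_ler_set.
apply/funext => t; rewrite indicE; congr (nat_of_bool _)%:R.
by apply/idP/idP; rewrite inE.
Qed.

Lemma measurable_nat_ltr {R : realType} d (T : measurableType d) (f g : T -> R) :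
  measurable_fun setT f -> measurable_fun setT g ->
  measurable_fun setT (fun t => (f t < g t)%R%:R : R).
Proof.
move=> mf mg; rewrite (_ : (fun _ => _) = \1_[set t | f t < g t]).
  by apply: measurable_indic; exact: measurable_ltr_set.
apply/funext => t; rewrite indicE; congr (nat_of_bool _)%:R.
by apply/idP/idP; rewrite inE.
Qed.

Section kernel.
Context {R : realType} (n : nat) (s : R).
Hypothesis n_gt0 : (0 < n)%N.
Hypothesis s01 : 0 < s < 1.
Local Notation lam := (@lam R n).
Implicit Types (x y z w : 'rV[R]_n).

Let s0 : 0 < s. Proof. by case/andP : s01. Qed.
Let n0 : (0 : R) < n%:R. Proof. by rewrite ltr0n. Qed.

Definition riesz x : R := enorm x `^ (- (n%:R + 2 * s)).

Lemma riesz_ge0 x : 0 <= riesz x. Proof. exact: powR_ge0. Qed.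

Lemma rieszN x : riesz (- x) = riesz x. Proof. by rewrite /riesz enormN. Qed.

Lemma rieszB x y : riesz (x - y) = riesz (y - x). Proof. by rewrite -rieszN opprB. Qed.

Lemma rieszZ c x : 0 < c -> riesz (c *: x) = c `^ (- (n%:R + 2 * s)) * riesz x.
Proof. by move=> c0; rewrite /riesz enormZ gtr0_norm// powRM ?enorm_ge0 ?ltW. Qed.

Lemma riesz0 : riesz 0 = 0.
Proof. by rewrite /riesz enorm0 powR0// oppr_eq0 gt_eqF// addr_gt0// mulr_gt0. Qed.

Lemma measurable_riesz d (T : measurableType d) (f : T -> 'rV[R]_n) :
  measurable_fun setT f -> measurable_fun setT (fun t => riesz (f t)).
Proof. exact: measurable_enorm_powR. Qed.

(** At the origin powers take default values and the pointwise estimates may fail; the origin is a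
    null set. *)
Lemma ge0_le_integral_ne0 (f g : 'rV[R]_n -> R) :
  measurable_fun setT f -> measurable_fun setT g ->
  (forall x, 0 <= f x) -> (forall x, 0 <= g x) ->
  (forall x, x != 0 -> f x <= g x) ->
  (\int[lam]_x (f x)%:E <= \int[lam]_x (g x)%:E)%E.
Proof.
move=> mf mg f0 g0 fg; apply: ae_ge0_le_integral => //.
- by move=> x _; rewrite lee_fin.
- exact/measurable_EFinP.
- by move=> x _; rewrite lee_fin.
- exact/measurable_EFinP.
exists [set 0]; split; [|exact: lam_set0|].
  rewrite (_ : [set _] = cball 0); first exact: measurable_cball.
  apply/seteqP; split => x; rewrite /cball/=; first by move=> ->; rewrite enorm0.
  move=> x0; apply/eqP; rewrite -enorm_eq0 eq_le x0 enorm_ge0//.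
move=> x; apply: contra_notP => /eqP x0 _; rewrite lee_fin; exact: fg.
Qed.

(** A power at the origin combined with the decay of the kernel at infinity: this is what remains of
    |y|^c times the kernel seen from a point at distance bounded below. *)
Definition wt (c : R) y : R := enorm y `^ c * (1 + enorm y) `^ (- (n%:R + 2 * s)).

Lemma wt_ge0 c y : 0 <= wt c y. Proof. by rewrite mulr_ge0 ?powR_ge0. Qed.

Lemma measurable_wt c d (T : measurableType d) (f : T -> 'rV[R]_n) :
  measurable_fun setT f -> measurable_fun setT (fun t => wt c (f t)).
Proof.
move=> mf; apply: measurable_funM; first exact: measurable_enorm_powR.
by apply: measurable_fun_powR; apply: measurable_funD => //; exact: measurable_enorm.
Qed.

Lemma wt_finite h c : 0 < h -> - n%:R + h <= c <= 2 * s - h ->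
  (\int[lam]_x (wt c x)%:E < +oo)%E.
Proof.
move=> h0 /andP[c1 c2]; apply: le_lt_trans (radial_min_powR_finite n_gt0 h0).
apply: ge0_le_integral_ne0.
- exact: measurable_wt.
- apply: measurable_funM; first exact: measurable_enorm_powR.
  by apply: measurable_min_powR; exact: measurable_enorm_id.
- by move=> x; exact: wt_ge0.
- by move=> x; rewrite mulr_ge0 ?powR_ge0 ?min_powR_ge0.
move=> x; rewrite -enorm_gt0 /wt; move: (enorm x) => r r0.
have ns0 : 0 <= n%:R + 2 * s by rewrite addr_ge0 ?mulr_ge0// ltW.
have [r1|r1] := leP r 1.
  rewrite min_powR_le1 ?r0 ?(ltW h0)// -powRDg//.
  rewrite -[leRHS]mulr1; apply: ler_pM; rewrite ?powR_ge0//.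
    by apply: ger_powR; rewrite ?r0.
  have r11 : 0 < 1 + r by lra.
  rewrite powRN invf_le1 ?powR_gt0//; apply: powR_ge1 => //; lra.
rewrite min_powR_ge1 ?(ltW h0) ?(ltW r1)// -powRDg//.
apply: (@le_trans _ _ (r `^ c * r `^ (- (n%:R + 2 * s)))).
  apply: ler_wpM2l; first exact: powR_ge0.
  rewrite !powRN lef_pV2 ?posrE ?powR_gt0//; last lra.
  by apply: ge0_ler_powR => //; rewrite ?nnegrE; lra.
rewrite -powRDg//; apply: ler_powR; lra.
Qed.

(** From |x| >= e follows |x| >= (e / (1 + e)) (1 + |x|). *)
Lemma far_kernel_le x (e : R) : 0 < e -> e <= enorm x ->
  riesz x <= (e / (1 + e)) `^ (- (n%:R + 2 * s)) * (1 + enorm x) `^ (- (n%:R + 2 * s)).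
Proof.
move=> e0 ex; have ns0 : 0 <= n%:R + 2 * s by rewrite addr_ge0 ?mulr_ge0// ltW.
have ee0 : 0 < e / (1 + e) by rewrite divr_gt0//; lra.
have x0 : 0 < enorm x by exact: lt_le_trans ex.
rewrite -powRM ?(ltW ee0) ?addr_ge0 ?enorm_ge0//.
rewrite /riesz !powRN lef_pV2 ?posrE ?powR_gt0//; last by rewrite mulr_gt0//; lra.
apply: ge0_ler_powR => //; rewrite ?nnegrE ?enorm_ge0//.
  by rewrite mulr_ge0 ?(ltW ee0)//; lra.
rewrite mulrAC ler_pdivrMr; last lra.
by move: (enorm x) ex => r ex; rewrite !mulrDr !mulr1 mulrC [r * e]mulrC; lra.
Qed.

Lemma near_finite (c : R) : - n%:R < c ->
  (\int[lam]_x ((enorm x <= 2)%R%:R * enorm x `^ c)%:E < +oo)%E.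
Proof.
move=> cn; pose h := c + n%:R.
have h0 : 0 < h by rewrite /h; lra.
have H := radial_min_powR_finite n_gt0 h0.
pose M := (2 : R) `^ (2 * h).
have M0 : 0 <= M by exact: powR_ge0.
have mf : measurable_fun setT (fun x : 'rV[R]_n => enorm x `^ (- n%:R) * min_powR h (enorm x)).
  apply: measurable_funM; first exact: measurable_enorm_powR.
  by apply: measurable_min_powR; exact: measurable_enorm_id.
apply: (@le_lt_trans _ _ (\int[lam]_x (M * (enorm x `^ (- n%:R) * min_powR h (enorm x)))%:E)%E).
  apply: ge0_le_integral_ne0.
  - apply: measurable_funM; last exact: measurable_enorm_powR.
    by apply: measurable_nat_ler => //; exact: measurable_enorm_id.
  - exact: measurable_funM.
  - by move=> x; rewrite mulr_ge0 ?powR_ge0.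
  - by move=> x; rewrite !mulr_ge0 ?powR_ge0 ?min_powR_ge0.
  move=> x; rewrite -enorm_gt0; move: (enorm x) => r r0.
  have [r2|r2] := leP r 2; last by rewrite mul0r !mulr_ge0 ?powR_ge0 ?min_powR_ge0.
  rewrite mul1r mulrCA (_ : c = - n%:R + h); last by rewrite /h; lra.
  rewrite powRDg//; apply: ler_wpM2l; first exact: powR_ge0.
  by apply: powR_le_min_powR; rewrite ?(ltW h0) ?r0//; lra.
under eq_integral do rewrite EFinM.
rewrite ge0_integralZl//.
- by rewrite lte_mul_pinfty// ?lee_fin.
- exact/measurable_EFinP.
- by move=> x _; rewrite lee_fin mulr_ge0 ?powR_ge0 ?min_powR_ge0.
Qed.

(* The reflection exchanging the unit vector [u] and [e1] preserves both arguments of [f]. *)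
Lemma integral_rotate (f : R -> R -> \bar R) u : enorm u = 1 ->
  measurable_fun setT (fun w => f (enorm w) (enorm (e1 n - w))) ->
  (\int[lam]_w f (enorm w) (enorm (u - w)) = \int[lam]_w f (enorm w) (enorm (e1 n - w)))%E.
Proof.
move=> u1 mf; have e1u : enorm (e1 n : 'rV[R]_n) = enorm u by rewrite enorm_e1.
rewrite -(integral_reflection (e1 n - u) mf); apply: eq_integral => w _.
rewrite enorm_reflection; congr (f _ _).
have HN v y : reflection v (- y) = - reflection v y :> 'rV[R]_n.
  by rewrite -[- y]scaleN1r reflectionZ scaleN1r.
have H x y : reflection (e1 n - u) (x - y) = reflection (e1 n - u) x - reflection (e1 n - u) y.
  by rewrite reflectionD HN.
have E : reflection (e1 n - u) u = e1 n.
  by rewrite -[X in reflection _ X](reflection_swap e1u) reflectionK.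
by rewrite -[X in _ = enorm (X - _)]E -H enorm_reflection.
Qed.

Lemma integral_radial_inner (f : R -> R -> \bar R) x : x != 0 ->
  (forall a b, 0 <= f a b)%E ->
  measurable_fun setT (fun ab : R * R => f ab.1 ab.2) ->
  (\int[lam]_z f (enorm z) (enorm (x - z)) =
   (enorm x ^+ n)%:E * \int[lam]_w f (enorm x * enorm w)%R (enorm x * enorm (e1 n - w))%R)%E.
Proof.
rewrite -enorm_gt0 => x0 f0 mf.
have mfc d (T : measurableType d) (g1 g2 : T -> R) : measurable_fun setT g1 -> measurable_fun setT g2 ->
    measurable_fun setT (fun t => f (g1 t) (g2 t)).
  move=> m1 m2; have m12 : measurable_fun setT (fun t => (g1 t, g2 t)) by exact: measurable_fun_pair.
  by have H := measurableT_comp mf m12; exact: H.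
rewrite (@ge0_integral_homothety R n (enorm x) 0)//; last first.
  apply: mfc; first exact: measurable_enorm_id.
  by apply: measurable_enorm; exact: measurable_rV_sub.
congr (_ * _)%E.
pose u := (enorm x)^-1 *: x.
have u1 : enorm u = 1 by rewrite enormZ gtr0_norm ?invr_gt0// mulVf// gt_eqF.
have xE : x = enorm x *: u by rewrite scalerA divff ?gt_eqF// scale1r.
rewrite -(@integral_rotate (fun a b => f (enorm x * a) (enorm x * b)) u u1); last first.
  apply: mfc; apply: measurable_funM => //; first exact: measurable_enorm_id.
  by apply: measurable_enorm; exact: measurable_rV_sub.
apply: eq_integral => w _; rewrite add0r enormZ gtr0_norm//; congr (f _ _).
by rewrite {1}xE -scalerBr enormZ gtr0_norm.
Qed.

End kernel.

(* [phi] and [gam be] are the radial profiles of the two solutions [Phi_mu] and [Gamma_mu];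
   their antisymmetric combination is governed by the profile [p]. *)
Record weights {R : realType} (n : nat) (s al be h : R) (phi p : R -> R) : Prop := Weights {
  w_n : (0 < n)%N;
  w_s : 0 < s < 1;
  w_h : 0 < h <= 1;
  w_sum : al + be = 2 * s - n%:R;
  w_le : al <= be;
  w_al : - n%:R + 4 * h <= al;
  w_mphi : measurable_fun setT phi;
  w_mp : measurable_fun setT p;
  w_phi0 : phi 0 = 0;
  w_p0 : p 0 = 0;
  w_wronskian : forall r t, 0 < r -> 0 <= t ->
    phi r * gam be t - phi t * gam be r = - (r `^ (2 * s - n%:R) * p (t / r));
  w_phi_le : exists2 M, 0 <= M & forall r, 0 < r ->
    `|phi r| <= M * (r `^ al * (r `^ (h / 2) + r `^ (- (h / 2))));
  w_p_ge0 : forall t, 0 < t < 1 -> 0 <= p t;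
  w_p_le : exists2 M, 0 <= M & forall t, 0 < t < 1 -> p t <= M * (t `^ al * - ln t) }.

Record test_fun {R : realType} (n : nat) (xi : 'rV[R]_n -> R) (C C2 rho : R) : Prop := TestFun {
  t_C : 0 <= C;
  t_lip : forall x y, `|xi x - xi y| <= C * enorm (x - y);
  t_C2 : 0 <= C2;
  t_second : forall x k, `|xi (x + k) + xi (x - k) - 2 * xi x| <= C2 * enorm k ^+ 2;
  t_rho : 1 <= rho;
  t_supp : forall x, rho <= enorm x -> xi x = 0 }.

Section product.
Context {R : realType} (n : nat).
Local Notation lam := (@lam R n).
Implicit Types (x y z : 'rV[R]_n) (a b : 'rV[R]_n -> R).

Lemma integrable_ge0_fin (f : 'rV[R]_n -> R) : measurable_fun setT f -> (forall x, 0 <= f x) ->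
  (\int[lam]_x (f x)%:E < +oo)%E -> lam.-integrable setT (EFin \o f).
Proof.
move=> mf f0 fi; apply/integrableP; split; first exact/measurable_EFinP.
apply: le_lt_trans fi; rewrite le_eqVlt; apply/orP; left; apply/eqP.
by apply: eq_integral => x _; rewrite /= ger0_norm.
Qed.

Lemma integrable_prod a b : measurable_fun setT a -> measurable_fun setT b ->
  (forall x, 0 <= a x) -> (forall x, 0 <= b x) ->
  (\int[lam]_x (a x)%:E < +oo)%E -> (\int[lam]_x (b x)%:E < +oo)%E ->
  (lam \x lam)%E.-integrable setT (fun w => (a w.1 * b w.2)%:E).
Proof.
move=> ma mb a0 b0 ai bi.
have m1 : measurable_fun setT (fun w : 'rV[R]_n * 'rV[R]_n => a w.1).
  by have H := measurableT_comp ma measurable_fst; exact: H.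
have m2 : measurable_fun setT (fun w : 'rV[R]_n * 'rV[R]_n => b w.2).
  by have H := measurableT_comp mb measurable_snd; exact: H.
apply/integrable12ltyP.
  by apply/measurable_EFinP; exact: measurable_funM.
have I0 : (0 <= \int[lam]_x (b x)%:E)%E by apply: integral_ge0 => x _; rewrite lee_fin.
have E x : (\int[lam]_y `|(a (x, y).1 * b (x, y).2)%:E| = (\int[lam]_y (b y)%:E) * (a x)%:E)%E.
  rewrite muleC -ge0_integralZl//.
  - by apply: eq_integral => y _; rewrite abse_EFin ger0_norm ?EFinM// mulr_ge0.
  - exact/measurable_EFinP.
  - by move=> y _; rewrite lee_fin.
  - by rewrite lee_fin.
under eq_integral do rewrite E.
rewrite ge0_integralZl//.
- by rewrite lte_mul_pinfty// ge0_fin_numE.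
- exact/measurable_EFinP.
- by move=> y _; rewrite lee_fin.
Qed.

End product.

Section products.
Context {R : realType} (n : nat) (s al be h : R) (phi p : R -> R).
Hypothesis W : weights n s al be h phi p.
Local Notation lam := (@lam R n).
Local Notation riesz := (riesz s).
Local Notation wt := (wt s).
Local Notation q := (n%:R + 2 * s).
Implicit Types (x y z k : 'rV[R]_n).

Let n_gt0 := w_n W.
Let s01 := w_s W.
Let h01 := w_h W.
Let h0 : 0 < h. Proof. by case/andP : h01. Qed.
Let s0 : 0 < s. Proof. by case/andP : s01. Qed.
Let q0 : 0 <= q. Proof. by rewrite addr_ge0// mulr_ge0// ltW. Qed.

Definition phi_wt x : R := `|phi (enorm x)| * (1 + enorm x) `^ (- q).
Definition gam_wt x : R := gam be (enorm x) * (1 + enorm x) `^ (- q).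

Lemma measurable_one_enorm d (T : measurableType d) (f : T -> 'rV[R]_n) :
  measurable_fun setT f -> measurable_fun setT (fun t => (1 + enorm (f t)) `^ (- q)).
Proof.
by move=> mf; apply: measurable_fun_powR; apply: measurable_funD => //; exact: measurable_enorm.
Qed.

Lemma measurable_phi_enorm d (T : measurableType d) (f : T -> 'rV[R]_n) :
  measurable_fun setT f -> measurable_fun setT (fun t => phi (enorm (f t))).
Proof. by move=> mf; apply: measurable_fun_comp (w_mphi W) _; exact: measurable_enorm. Qed.

Lemma measurable_gam_enorm d (T : measurableType d) (f : T -> 'rV[R]_n) :
  measurable_fun setT f -> measurable_fun setT (fun t => gam be (enorm (f t))).
Proof. by move=> mf; apply: measurable_fun_comp (measurable_gam be) _; exact: measurable_enorm. Qed.

Lemma measurable_phi_wt : measurable_fun setT phi_wt.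
Proof.
apply: measurable_funM; last exact: measurable_one_enorm.
have H := measurableT_comp (@normr_measurable R setT) (@measurable_phi_enorm _ _ id (@measurable_id _ _ setT)).
exact: H.
Qed.

Lemma measurable_gam_wt : measurable_fun setT gam_wt.
Proof.
by apply: measurable_funM; [exact: measurable_gam_enorm|exact: measurable_one_enorm].
Qed.

Lemma phi_wt_ge0 x : 0 <= phi_wt x. Proof. by rewrite mulr_ge0 ?powR_ge0. Qed.

Lemma gam_wt_ge0 x : 0 <= gam_wt x. Proof. by rewrite mulr_ge0 ?powR_ge0// gam_ge0// enorm_ge0. Qed.

Lemma wt_sum_finite (M a b : R) : 0 <= M -> - n%:R + h / 2 <= a <= 2 * s - h / 2 ->
  - n%:R + h / 2 <= b <= 2 * s - h / 2 ->
  (\int[lam]_x (M * (wt a x + wt b x))%:E < +oo)%E.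
Proof.
move=> M0 ha hb; have h20 : 0 < h / 2 by move: h0; lra.
under eq_integral do rewrite EFinM EFinD.
have ma c : measurable_fun setT (fun x => (wt c x)%:E) by apply/measurable_EFinP; exact: measurable_wt.
have m0 c x : (0 <= (wt c x)%:E)%E by rewrite lee_fin wt_ge0.
rewrite ge0_integralZl//; last 2 first.
- exact: emeasurable_funD.
- by move=> x _; exact: adde_ge0.
rewrite lte_mul_pinfty// ?lee_fin// ge0_integralD// lte_add_pinfty//.
- exact: (wt_finite n_gt0 s01 h20).
- exact: (wt_finite n_gt0 s01 h20).
Qed.

Lemma phi_wt_finite : (\int[lam]_x (phi_wt x)%:E < +oo)%E.
Proof.
have [M M0 HM] := w_phi_le W.
have Ws := w_sum W; have Wl := w_le W; have Wa := w_al W; have hp := h0.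
apply: le_lt_trans (@wt_sum_finite M (al + h / 2) (al - h / 2) M0 _ _); last 2 first.
- by apply/andP; split; lra.
- by apply/andP; split; lra.
apply: (ge0_le_integral_ne0 n_gt0) => //.
- exact: measurable_phi_wt.
- by apply: measurable_funM => //; apply: measurable_funD; exact: measurable_wt.
- exact: phi_wt_ge0.
- by move=> x; rewrite mulr_ge0// addr_ge0// wt_ge0.
move=> x; rewrite -enorm_gt0 => x0.
rewrite /phi_wt /wt -mulrDl mulrA; apply: ler_wpM2r; first exact: powR_ge0.
by rewrite !powRDg// -mulrDr; exact: HM.
Qed.

Lemma gam_wt_finite : (\int[lam]_x (gam_wt x)%:E < +oo)%E.
Proof.
have Ws := w_sum W; have Wl := w_le W; have Wa := w_al W; have hp := h0.
have h20 : 0 < h / 2 by move: h0; lra.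
apply: le_lt_trans (@wt_finite R n s n_gt0 s01 (h / 2) be h20 _); last by apply/andP; split; lra.
apply: (ge0_le_integral_ne0 n_gt0) => //.
- exact: measurable_gam_wt.
- exact: measurable_wt.
- exact: gam_wt_ge0.
- by move=> x; exact: wt_ge0.
by move=> x; rewrite -enorm_gt0 => x0; rewrite /gam_wt gamE.
Qed.

Variables (xi : 'rV[R]_n -> R) (C C2 rho : R).
Hypothesis T : test_fun xi C C2 rho.

Let B := 2 * rho * C.
Let xiB x : `|xi x| <= B.
Proof. exact: (test_bounded n_gt0 (t_C T) (t_lip T) (t_rho T) (t_supp T)). Qed.
Let B0 : 0 <= B. Proof. exact: le_trans (xiB 0). Qed.

Let mxi d (U : measurableType d) (f : U -> 'rV[R]_n) : measurable_fun setT f ->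
  measurable_fun setT (fun t => xi (f t)).
Proof.
by move=> mf; have H := measurableT_comp (lipschitz_measurable (t_C T) (t_lip T)) mf; exact: H.
Qed.

Definition psi x z : R := (xi x - xi z) * riesz (x - z) * gam be (enorm z).
Definition cut (e : R) x z : R := (e <= enorm (x - z))%R%:R.

Lemma measurable_psi d (U : measurableType d) (f g : U -> 'rV[R]_n) :
  measurable_fun setT f -> measurable_fun setT g -> measurable_fun setT (fun t => psi (f t) (g t)).
Proof.
move=> mf mg; apply: measurable_funM; last exact: measurable_gam_enorm.
apply: measurable_funM; first by apply: measurable_funB; exact: mxi.
by apply: measurable_riesz; exact: measurable_rV_sub.
Qed.

Lemma measurable_cut e d (U : measurableType d) (f g : U -> 'rV[R]_n) :
  measurable_fun setT f -> measurable_fun setT g -> measurable_fun setT (fun t => cut e (f t) (g t)).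
Proof.
by move=> mf mg; apply: measurable_nat_ler => //; apply: measurable_enorm; exact: measurable_rV_sub.
Qed.

Lemma cutC e x z : cut e x z = cut e z x. Proof. by rewrite /cut enormB. Qed.

(* Off the diagonal, and with one of the two points in a ball, the kernel is comparable to a product. *)
Lemma kernel_product_le (e r : R) : 0 < e -> 0 <= r -> exists2 M, 0 <= M &
  forall x z, e <= enorm (x - z) -> enorm x <= r \/ enorm z <= r ->
  riesz (x - z) <= M * ((1 + enorm x) `^ (- q) * (1 + enorm z) `^ (- q)).
Proof.
move=> e0 r0; pose K := (e / (1 + e)) `^ (- q); pose L := ((1 + r) * (1 + r)) `^ q.
exists (K * L); first by rewrite mulr_ge0 ?powR_ge0.
move=> x z exz xz; have := far_kernel_le s01 e0 exz; rewrite -/K => H.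
apply: le_trans H _; rewrite -mulrA; apply: ler_wpM2l; first exact: powR_ge0.
have x0 := enorm_ge0 x; have z0 := enorm_ge0 z; have xz0 := enorm_ge0 (x - z).
have tri1 : enorm z <= enorm x + enorm (x - z).
  have -> : enorm z = enorm (x - (x - z)) by rewrite opprB addrC subrK.
  exact: ler_enormB.
have tri2 : enorm x <= enorm z + enorm (x - z).
  have -> : enorm x = enorm (z + (x - z)) by rewrite addrC subrK.
  exact: ler_enormD.
rewrite -powRM; [|lra|lra].
have key : (1 + enorm x) * (1 + enorm z) <= (1 + r) * (1 + r) * (1 + enorm (x - z)).
  move: (enorm x) (enorm z) (enorm (x - z)) x0 z0 xz0 tri1 tri2 xz => a b c a0 b0 c0 t1 t2 xz.
  rewrite -mulrA; case: xz => ar; first by apply: ler_pM; nra.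
  by rewrite mulrC; apply: ler_pM; nra.
rewrite -ler_pdivrMr ?powR_gt0 ?mulr_gt0//; [|lra..].
rewrite !powRN invrK mulrC ler_pdivrMr ?powR_gt0//; last lra.
rewrite -powRM ?mulr_ge0//; [|lra..].
by apply: ge0_ler_powR => //; rewrite ?nnegrE ?mulr_ge0//; lra.
Qed.

(** Covers two uses: [x] fixed, with r = |x|, and all [x] at once, with r = rho. In the second case
    the difference of xi vanishes unless one of the points lies in the ball of radius [r], which is
    what the product bound on the kernel requires. *)
Lemma psi_cut_le (e r : R) : 0 < e -> 0 <= r -> exists2 M, 0 <= M &
  forall x z, enorm x <= r \/ rho <= r ->
  `|cut e x z * psi x z| <= M * ((1 + enorm x) `^ (- q) * gam_wt z).
Proof.
move=> e0 r0; have [M M0 HM] := kernel_product_le e0 r0.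
exists (M * (2 * B)); first by rewrite mulr_ge0// mulr_ge0.
move=> x z xr; have g0 : 0 <= gam be (enorm z) by rewrite gam_ge0// enorm_ge0.
have R0 : 0 <= M * (2 * B) * ((1 + enorm x) `^ (- q) * gam_wt z).
  apply: mulr_ge0; first by apply: mulr_ge0 => //; apply: mulr_ge0.
  by apply: mulr_ge0; [exact: powR_ge0|exact: gam_wt_ge0].
rewrite /cut; have [exz|_] := leP e (enorm (x - z)); last by rewrite mul0r normr0.
have [/eqP E|xiN] := boolP (xi x - xi z == 0); first by rewrite /psi E !mul0r mulr0 normr0.
rewrite mul1r /psi normrM (ger0_norm g0) normrM (ger0_norm (riesz_ge0 _ _)).
rewrite (_ : M * _ * _ = 2 * B * (M * ((1 + enorm x) `^ (- q) * (1 + enorm z) `^ (- q))) * gam be (enorm z)); last by rewrite /gam_wt; ring.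
apply: ler_wpM2r => //; apply: ler_pM => //; first exact: riesz_ge0.
  by apply: le_trans (ler_normB _ _) _; have := xiB x; have := xiB z; lra.
apply: HM => //; case: xr => xr; first by left.
have [xx|xx] := leP (enorm x) r; first by left.
right; rewrite leNgt; apply: contra xiN => zr.
by rewrite !(t_supp T) ?subrr//; [apply: le_trans xr (ltW zr)|apply: le_trans xr (ltW xx)].
Qed.

Definition wfl_integrand (e : R) x z : R := phi (enorm x) * (cut e x z * psi x z).

Lemma measurable_wfl_integrand e d (U : measurableType d) (f g : U -> 'rV[R]_n) :
  measurable_fun setT f -> measurable_fun setT g -> measurable_fun setT (fun t => wfl_integrand e (f t) (g t)).
Proof.
move=> mf mg; apply: measurable_funM; first exact: measurable_phi_enorm.
by apply: measurable_funM; [exact: measurable_cut|exact: measurable_psi].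
Qed.

Lemma wfl_integrand_integrable e : 0 < e ->
  (lam \x lam)%E.-integrable setT (fun w => (wfl_integrand e w.1 w.2)%:E).
Proof.
move=> e0; have rho0 : 0 <= rho by apply: le_trans (t_rho T).
have [M M0 HM] := psi_cut_le e0 rho0.
have H := integrable_prod measurable_phi_wt measurable_gam_wt phi_wt_ge0 gam_wt_ge0
  phi_wt_finite gam_wt_finite.
apply: (le_integrable measurableT _ _ (integrableZl measurableT M H)).
  by apply/measurable_EFinP; apply: measurable_wfl_integrand; [exact: measurable_fst|exact: measurable_snd].
move=> [x z] _ /=; rewrite lee_fin [leRHS]ger0_norm; last first.
  by apply: mulr_ge0 => //; apply: mulr_ge0; [exact: phi_wt_ge0|exact: gam_wt_ge0].
rewrite /wfl_integrand normrM /phi_wt.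
rewrite (_ : M * _ = `|phi (enorm x)| * (M * ((1 + enorm x) `^ (- q) * gam_wt z))); last ring.
by apply: ler_wpM2l => //; apply: HM; right.
Qed.

Lemma psi_cut_integrable e x : 0 < e -> lam.-integrable setT (fun z => (cut e x z * psi x z)%:E).
Proof.
move=> e0; have [M M0 HM] := psi_cut_le e0 (enorm_ge0 x).
have H := integrable_ge0_fin measurable_gam_wt gam_wt_ge0 gam_wt_finite.
have H1 := integrableZl measurableT (M * (1 + enorm x) `^ (- q)) H.
apply: (le_integrable measurableT _ _ H1).
  by apply/measurable_EFinP; apply: measurable_funM; [exact: measurable_cut|exact: measurable_psi].
move=> z _ /=; rewrite lee_fin [leRHS]ger0_norm; last first.
  apply: mulr_ge0; last exact: gam_wt_ge0.
  by apply: mulr_ge0 => //; exact: powR_ge0.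
by rewrite -mulrA; apply: HM; left.
Qed.

End products.

(** * The principal value *)

Section principal_value.
Context {R : realType} (n : nat) (s al be h : R) (phi p : R -> R).
Hypothesis W : weights n s al be h phi p.
Variables (xi : 'rV[R]_n -> R) (C C2 rho : R).
Hypothesis T : test_fun xi C C2 rho.
Local Notation lam := (@lam R n).
Local Notation riesz := (riesz s).
Local Notation wt := (wt s).
Local Notation q := (n%:R + 2 * s).
Implicit Types (x y z k : 'rV[R]_n).

Let n_gt0 := w_n W.
Let s01 := w_s W.
Let h01 := w_h W.
Let h0 : 0 < h. Proof. by case/andP : h01. Qed.
Let s1 : s < 1. Proof. by case/andP : s01. Qed.
Let mxi d (U : measurableType d) (f : U -> 'rV[R]_n) : measurable_fun setT f ->
  measurable_fun setT (fun t => xi (f t)).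
Proof.
by move=> mf; have H := measurableT_comp (lipschitz_measurable (t_C T) (t_lip T)) mf; exact: H.
Qed.

Local Notation sd := (symm_diff xi be).

Lemma measurable_symm_diff x : measurable_fun setT (sd x).
Proof.
have m1 : measurable_fun setT (fun k => x + k) by exact: measurable_rV_add.
have m2 : measurable_fun setT (fun k => x - k) by exact: measurable_rV_sub.
apply: measurable_funD; apply: measurable_funM.
- by apply: measurable_funB => //; exact: mxi.
- exact: measurable_gam_enorm.
- by apply: measurable_funB => //; exact: mxi.
- exact: measurable_gam_enorm.
Qed.

(** Rescale by k = |x| w. For |w| <= 1/2 the second-order cancellation leaves |w|^(2-n-2s),
    integrable because s < 1. For |w| > 1/2 the two terms are bounded separately, and the kernel is
    replaced by the weight (1 + |u + w|)^(-n-2s) or (1 + |u - w|)^(-n-2s) of the shifted point, u =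
    x/|x|; this gives translates of the integrable function [v]. The powers of |x| add up to be -
    2s. *)
Lemma symm_diff_integral : exists2 M, 0 <= M & forall x, x != 0 ->
  (\int[lam]_k (`|sd x k| * riesz k)%:E <= (M * (min_powR h (enorm x) * enorm x `^ (be - 2 * s)))%:E)%E.
Proof.
have [M1 M10 near] := test_difference_min_powR n_gt0 (t_C T) (t_lip T) (t_rho T) (t_supp T) h01.
have [M2 M20 nearS] := symm_diff_near be (t_C T) (t_lip T) (t_C2 T) (t_second T)
  (t_rho T) (t_supp T) h01.
have [v vE] : {v : 'rV[R]_n -> R | v = fun y => wt (be + h) y + wt (be - h) y} by eexists.
have v0 y : 0 <= v y by rewrite vE addr_ge0// wt_ge0.
have mv : measurable_fun setT v by rewrite vE; apply: measurable_funD; exact: measurable_wt.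
(* The first factor is [far_kernel_le] at distance 1/2; the second comes from 1 + |y| <= 2 (1 + |w|)
   when |y| <= 1 + |w|. *)
pose K := (2^-1 / (1 + 2^-1) : R) `^ (- q) * 2 `^ q.
have K0 : 0 <= K by rewrite mulr_ge0 ?powR_ge0.
have [nr nrE] : {nr : 'rV[R]_n -> R | nr = fun k => (enorm k <= 2)%R%:R * enorm k `^ (2 - q)} by eexists.
have nr0 k : 0 <= nr k by rewrite nrE mulr_ge0 ?powR_ge0.
have mnr : measurable_fun setT nr.
  rewrite nrE; apply: measurable_funM; last exact: measurable_enorm_powR.
  by apply: measurable_nat_ler => //; exact: measurable_enorm_id.
have Ws := w_sum W; have Wl := w_le W; have Wa := w_al W; have hp := h0.
have Iv : (\int[lam]_y (v y)%:E < +oo)%E.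
  rewrite vE -(_ : (fun y => (1 * (wt (be + h) y + wt (be - h) y))%:E) = (fun y => (wt (be + h) y + wt (be - h) y)%:E)); last by apply/funext => y; rewrite mul1r.
  by apply: (wt_sum_finite W) => //; apply/andP; split; lra.
have Inr : (\int[lam]_y (nr y)%:E < +oo)%E.
  by rewrite nrE; apply: (near_finite n_gt0); move: s1; lra.
have Iv0 : (0 <= \int[lam]_y (v y)%:E)%E by apply: integral_ge0 => y _; rewrite lee_fin.
have Inr0 : (0 <= \int[lam]_y (nr y)%:E)%E by apply: integral_ge0 => y _; rewrite lee_fin.
pose iv := fine (\int[lam]_y (v y)%:E)%E; pose inr := fine (\int[lam]_y (nr y)%:E)%E.
have ivE : (\int[lam]_y (v y)%:E)%E = iv%:E by rewrite fineK// ge0_fin_numE.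
have inrE : (\int[lam]_y (nr y)%:E)%E = inr%:E by rewrite fineK// ge0_fin_numE.
have iv0 : 0 <= iv by exact: fine_ge0.
have inr0 : 0 <= inr by exact: fine_ge0.
exists (M2 * inr + K * M1 * (iv + iv)).
  by rewrite addr_ge0// ?mulr_ge0// addr_ge0.
move=> x xN0; have r0 : 0 < enorm x by rewrite enorm_gt0.
set r := enorm x in r0 *.
pose u := r^-1 *: x.
have u1 : enorm u = 1 by rewrite enormZ gtr0_norm ?invr_gt0// mulVf// gt_eqF.
have xE : x = r *: u by rewrite scalerA divff ?gt_eqF// scale1r.
have m0 : 0 <= min_powR h r by exact: min_powR_ge0.
pose c := r `^ (- q) * (min_powR h r * r `^ be).
have c0 : 0 <= c by rewrite !mulr_ge0 ?powR_ge0.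
have mf : measurable_fun setT (fun k => (`|sd x k| * riesz k)%:E).
  apply/measurable_EFinP; apply: measurable_funM; last exact: measurable_riesz.
  have H := measurableT_comp (@normr_measurable R setT) (measurable_symm_diff x); exact: H.
rewrite (@ge0_integral_homothety R n r 0)//; last first.
  by move=> k; rewrite lee_fin mulr_ge0// riesz_ge0.
have mvp : measurable_fun setT (fun w : 'rV[R]_n => v (u + w)).
  by have H := measurableT_comp mv (measurable_rV_add (@measurable_cst _ _ _ _ setT u) (@measurable_id _ _ setT)); exact: H.
have mvm : measurable_fun setT (fun w : 'rV[R]_n => v (u - w)).
  by have H := measurableT_comp mv (measurable_rV_sub (@measurable_cst _ _ _ _ setT u) (@measurable_id _ _ setT)); exact: H.
have Ivp : (\int[lam]_w (v (u + w))%:E = iv%:E)%E.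
  rewrite -ivE -(integral_translate u (f := fun y => (v y)%:E)); last exact/measurable_EFinP.
  by apply: eq_integral => w _; rewrite addrC.
have Ivm : (\int[lam]_w (v (u - w))%:E = iv%:E)%E.
  rewrite -Ivp -(integral_opp (f := fun w => (v (u + w))%:E))//.
  exact/measurable_EFinP.
apply: (@le_trans _ _ ((r ^+ n)%:E * \int[lam]_w (c * (M2 * nr w + K * M1 * (v (u + w) + v (u - w))))%:E)%E).
  apply: lee_wpmul2l; first by rewrite lee_fin exprn_ge0// ltW.
  apply: ge0_le_integral; first exact: measurableT.
  - by move=> w _; rewrite lee_fin mulr_ge0// riesz_ge0.
  - have H := measurableT_comp mf (measurable_rV_add (@measurable_cst _ _ _ _ setT (0 : 'rV[R]_n)) (@measurable_rV_scalel R n r)); exact: H.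
  - apply/measurable_EFinP; apply: measurable_funM => //.
    apply: measurable_funD; apply: measurable_funM => //.
    exact: measurable_funD.
  move=> w _; rewrite lee_fin add0r.
  have R0 : 0 <= M2 * nr w + K * M1 * (v (u + w) + v (u - w)).
    by rewrite addr_ge0// ?mulr_ge0// addr_ge0.
  have [w0|w0] := eqVneq w 0; first by rewrite [in leLHS]w0 scaler0 (riesz0 n_gt0 s01) mulr0 mulr_ge0.
  have wp : 0 < enorm w by rewrite enorm_gt0.
  rewrite rieszZ// (_ : c * _ = r `^ (- q) * ((min_powR h r * r `^ be) * (M2 * nr w + K * M1 * (v (u + w) + v (u - w))))); last by rewrite /c; ring.
  rewrite mulrCA; apply: ler_wpM2l; first exact: powR_ge0.
  have [wn|wf] := leP (2 * enorm w) 1.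
    have near1 : 2 * enorm (r *: w) <= enorm x.
      by rewrite enormZ gtr0_norm// -/r mulrCA ger_pMr.
    apply: (@le_trans _ _ ((min_powR h r * r `^ be) * (M2 * nr w))); last first.
      by apply: ler_wpM2l; [rewrite mulr_ge0 ?powR_ge0|rewrite lerDl !mulr_ge0// addr_ge0].
    have := nearS x (r *: w) xN0 near1; rewrite -/r enormZ (gtr0_norm r0).
    rewrite (_ : r * enorm w / r = enorm w); last by field; rewrite gt_eqF.
    move=> H; apply: le_trans (ler_wpM2r (riesz_ge0 s w) H) _.
    rewrite nrE (_ : (enorm w <= 2) = true) ?mul1r; last by apply/idP; lra.
    rewrite powRDg// powR_mulrn ?(ltW wp)// -/(riesz w) le_eqVlt; apply/orP; left; apply/eqP; ring.
  have krw y : enorm y <= 1 + enorm w -> riesz w <= K * (1 + enorm y) `^ (- q).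
    move=> yw; have half : 0 < (2^-1 : R) by lra.
    have wh : 2^-1 <= enorm w by lra.
    have H := far_kernel_le s01 half wh; apply: le_trans H _.
    rewrite /K -mulrA; apply: ler_wpM2l; first exact: powR_ge0.
    have y0 := enorm_ge0 y; have w10 : 0 < 1 + enorm w by lra.
    have y10 : 0 < 1 + enorm y by lra.
    rewrite !powRN ler_pdivlMr ?powR_gt0// mulrC ler_pdivrMr ?powR_gt0//.
    rewrite -powRM ?(ltW w10)//; apply: ge0_ler_powR => //; rewrite ?nnegrE; lra.
  have one y : enorm y <= 1 + enorm w ->
      `|(xi x - xi (r *: y)) * gam be (enorm (r *: y))| * riesz w <= (min_powR h r * r `^ be) * (K * M1 * v y).
    move=> yw; have [->|y0] := eqVneq y 0.
      rewrite scaler0 enorm0 gam0 mulr0 normr0 mul0r mulr_ge0// ?mulr_ge0 ?powR_ge0//.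
    have yp : 0 < enorm y by rewrite enorm_gt0.
    have yE : enorm (r *: y) = r * enorm y by rewrite enormZ gtr0_norm.
    have ry0 : r *: y != 0 by rewrite -enorm_gt0 yE mulr_gt0.
    have := near x (r *: y) xN0 ry0; rewrite -/r yE.
    rewrite (_ : r * enorm y / r = enorm y); last by field; rewrite gt_eqF.
    move=> H; rewrite gamE ?mulr_gt0// normrM (ger0_norm (powR_ge0 _ _)) powRM ?(ltW r0) ?(ltW yp)//.
    apply: (@le_trans _ _ (M1 * (min_powR h r * (enorm y `^ h + enorm y `^ (- h))) * (r `^ be * enorm y `^ be) * (K * (1 + enorm y) `^ (- q)))).
      apply: ler_pM; [by rewrite mulr_ge0// mulr_ge0 ?powR_ge0|exact: riesz_ge0| |exact: krw].
      by apply: ler_wpM2r => //; rewrite mulr_ge0 ?powR_ge0.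
    rewrite le_eqVlt; apply/orP; left; apply/eqP.
    rewrite vE /wt !(powRDg _ _ yp); ring.
  apply: (@le_trans _ _ ((min_powR h r * r `^ be) * (K * M1 * (v (u + w) + v (u - w))))); last first.
    by apply: ler_wpM2l; [rewrite mulr_ge0 ?powR_ge0|rewrite lerDr mulr_ge0].
  have up : x + r *: w = r *: (u + w) by rewrite scalerDr -xE.
  have um : x - r *: w = r *: (u - w) by rewrite scalerBr -xE.
  rewrite /symm_diff up um; apply: le_trans (ler_wpM2r (riesz_ge0 s w) (ler_normD _ _)) _.
  rewrite mulrDl !mulrDr; apply: lerD; apply: one.
    by apply: le_trans (ler_enormD _ _) _; rewrite u1.
  by apply: le_trans (ler_enormB _ _) _; rewrite u1.
have -> : (\int[lam]_w (c * (M2 * nr w + K * M1 * (v (u + w) + v (u - w))))%:E =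
   (c * (M2 * inr + K * M1 * (iv + iv)))%:E)%E.
  rewrite (eq_integral (fun w => c%:E * (M2%:E * (nr w)%:E +
    (K * M1)%:E * ((v (u + w))%:E + (v (u - w))%:E)))%E)//.
  have e1 : measurable_fun setT (fun w => (nr w)%:E) by exact/measurable_EFinP.
  have e2 : measurable_fun setT (fun w : 'rV[R]_n => (v (u + w))%:E) by exact/measurable_EFinP.
  have e3 : measurable_fun setT (fun w : 'rV[R]_n => (v (u - w))%:E) by exact/measurable_EFinP.
  have e4 : measurable_fun setT (fun w : 'rV[R]_n => ((v (u + w))%:E + (v (u - w)%R)%:E)%E) by exact: emeasurable_funD.
  have KM : (0 <= (K * M1)%:E)%E by rewrite lee_fin mulr_ge0.
  have M2e : (0 <= M2%:E)%E by rewrite lee_fin.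
  have p1 w : (0 <= (nr w)%:E)%E by rewrite lee_fin.
  have p2 w : (0 <= (v (u + w))%:E + (v (u - w)%R)%:E)%E by rewrite adde_ge0 ?lee_fin.
  have p3 w : (0 <= M2%:E * (nr w)%:E)%E by exact: mule_ge0.
  have p4 w : (0 <= (K * M1)%:E * ((v (u + w))%:E + (v (u - w)%R)%:E))%E by exact: mule_ge0.
  have p5 w : (0 <= M2%:E * (nr w)%:E + (K * M1)%:E * ((v (u + w))%:E + (v (u - w)%R)%:E))%E by exact: adde_ge0.
  have m3 := measurable_funeM M2%:E e1.
  have m4 := measurable_funeM (K * M1)%:E e4.
  have c0e : (0 <= c%:E)%E by rewrite lee_fin.
  rewrite (ge0_integralZl _ measurableT (emeasurable_funD m3 m4) (fun w _ => p5 w) c0e).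
  rewrite (ge0_integralD _ measurableT (fun w _ => p3 w) m3 (fun w _ => p4 w) m4).
  rewrite (ge0_integralZl _ measurableT e1 (fun w _ => p1 w) M2e).
  rewrite (ge0_integralZl _ measurableT e4 (fun w _ => p2 w) KM).
  rewrite (ge0_integralD _ measurableT _ e2 _ e3); [|by move=> w _; rewrite lee_fin..].
  by rewrite Ivp Ivm inrE.
rewrite -EFinM lee_fin /c le_eqVlt; apply/orP; left; apply/eqP.
rewrite -powR_mulrn ?(ltW r0)//.
have -> : r `^ (be - 2 * s) = r `^ n%:R * r `^ (- q) * r `^ be.
  by rewrite -!powRDg//; congr (_ `^ _); ring.
ring.
Qed.

End principal_value.

Lemma natr_bool_mul_le {R : realType} (b : bool) (y : R) : 0 <= y -> b%:R * y <= y.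
Proof. by move=> y0; case: b; rewrite ?mulr1n ?mulr0n ?mul1r ?mul0r. Qed.

Section swap.
Context {R : realType} (n : nat).
Local Notation lam := (@lam R n).
Local Notation lam2 := (lam \x lam)%E.

Lemma integrable_swap (f : 'rV[R]_n * 'rV[R]_n -> \bar R) :
  lam2.-integrable setT f -> lam2.-integrable setT (fun w => f (w.2, w.1)).
Proof.
move=> fi; have mf := measurable_int _ fi.
have ms : measurable_fun setT (fun w : 'rV[R]_n * 'rV[R]_n => f (w.2, w.1)).
  have H := measurableT_comp mf (@measurable_fun_pair _ _ _ _ _ _ snd fst measurable_snd measurable_fst); exact: H.
apply/integrable12ltyP => //; exact: (integrable21ltyP _ _ mf).1 fi.
Qed.

Lemma integral_swap (f : 'rV[R]_n * 'rV[R]_n -> \bar R) :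
  lam2.-integrable setT f ->
  (\int[lam2]_w f (w.2, w.1) = \int[lam2]_w f w)%E.
Proof.
move=> fi; rewrite -(integral12_prod_meas1 (integrable_swap fi)).
by rewrite -(integral21_prod_meas1 fi).
Qed.

Lemma integrable_preserving (phi : 'rV[R]_n -> 'rV[R]_n) (f : 'rV[R]_n -> \bar R) :
  measurable_fun setT phi ->
  (forall A, measurable A -> lam [set x | A (phi x)] = lam A) ->
  lam.-integrable setT f -> lam.-integrable setT (f \o phi).
Proof.
move=> mphi Hphi fi; have mf := measurable_int _ fi.
apply/integrableP; split; first exact: measurableT_comp.
rewrite (integral_preserving (f := fun x => `|f x|)%E mphi Hphi); last exact: measurableT_comp.
by case/integrableP : fi.
Qed.

Lemma integral_subr (c : 'rV[R]_n) (f : 'rV[R]_n -> \bar R) : measurable_fun setT f ->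
  (\int[lam]_w f (c - w)%R = \int[lam]_w f w)%E.
Proof.
move=> mf; pose g w := f (w + c).
have mg : measurable_fun setT g by have H := measurableT_comp mf (measurable_rV_translate c); exact: H.
rewrite -(integral_translate c mf) -/g -(integral_opp mg).
by apply: eq_integral => w _; rewrite /g addrC.
Qed.

Lemma integral_symmetrize (g : 'rV[R]_n -> \bar R) (x : 'rV[R]_n) :
  lam.-integrable setT g ->
  (\int[lam]_k (g (k + x)%R + g (- k + x)%R) = \int[lam]_z g z + \int[lam]_z g z)%E.
Proof.
move=> gi; have mg := measurable_int _ gi.
pose f k := g (k + x).
have fi : lam.-integrable setT f.
  apply: (integrable_preserving (phi := fun k => k + x)) gi.
    exact: measurable_rV_translate.
  by move=> A mA; rewrite lam_translate.
have mf := measurable_int _ fi.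
have foi : lam.-integrable setT (fun k => f (- k)).
  apply: (integrable_preserving (phi := fun k => - k)) fi.
    exact: measurable_rV_opp.
  apply: lam_isometry; [exact: measurable_rV_opp|exact: opprK| |exact: enormN].
  by move=> u v; rewrite opprD.
rewrite -(integral_translate x mg) -/f -[X in (_ + X)%E](integral_opp mf).
exact: (integralD measurableT fi foi).
Qed.

End swap.

Section principal_value_limit.
Context {R : realType} (n : nat) (s al be h : R) (phi p : R -> R).
Hypothesis W : weights n s al be h phi p.
Variables (xi : 'rV[R]_n -> R) (C C2 rho : R).
Hypothesis T : test_fun xi C C2 rho.
Local Notation lam := (@lam R n).
Local Notation riesz := (riesz s).
Local Notation wt := (wt s).
Implicit Types (x y z k : 'rV[R]_n).

Let n_gt0 := w_n W.
Let s01 := w_s W.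
Let s0 : 0 < s. Proof. by case/andP : s01. Qed.

Local Notation sd := (symm_diff xi be).
Local Notation psi := (psi s be xi).

Definition wfl_cut e x : \bar R := (\int[lam]_z (cut e x z * psi x z)%:E)%E.
(** The principal value written as an absolutely convergent integral; the factor 1/2 averages z = x
    + k and z = x - k. *)
Definition wfl_lim x : \bar R := (2^-1%:E * \int[lam]_k (sd x k * riesz k)%:E)%E.

Let msd x : measurable_fun setT (fun k => sd x k * riesz k).
Proof.
apply: measurable_funM; first exact: (measurable_symm_diff be T).
exact: measurable_riesz.
Qed.

Let mcutn e : measurable_fun setT (fun k : 'rV[R]_n => (e <= enorm k)%R%:R : R).
Proof. by apply: measurable_nat_ler => //; exact: measurable_enorm_id. Qed.

Lemma symm_diff_integrable x : x != 0 -> lam.-integrable setT (fun k => (sd x k * riesz k)%:E).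
Proof.
move=> x0; have [M M0 HM] := symm_diff_integral W T.
apply/integrableP; split; first exact/measurable_EFinP.
apply: le_lt_trans (le_lt_trans (HM x x0) (ltry _)).
rewrite le_eqVlt; apply/orP; left; apply/eqP; apply: eq_integral => k _.
by rewrite abse_EFin normrM (ger0_norm (riesz_ge0 _ _)).
Qed.

Lemma wfl_cut_symm e x : 0 < e ->
  wfl_cut e x = (2^-1%:E * \int[lam]_k ((e <= enorm k)%R%:R * (sd x k * riesz k))%:E)%E.
Proof.
move=> e0; have gi := psi_cut_integrable W T x e0.
have E3 : (\int[lam]_k ((e <= enorm k)%R%:R * (sd x k * riesz k))%:E = wfl_cut e x + wfl_cut e x)%E.
  rewrite -(integral_symmetrize x gi); apply: eq_integral => k _.
  rewrite -EFinD /cut /psi; congr _%:E.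
  have e1 : x - (k + x) = - k by rewrite opprD addrCA subrr addr0.
  have e2 : x - (- k + x) = k by rewrite opprD opprK addrCA subrr addr0.
  rewrite e1 e2 rieszN enormN /symm_diff (addrC k x) (addrC (- k) x).
  move: (_ %:R) (riesz k) (gam _ _) (gam _ _) => a b c d; ring.
have : wfl_cut e x \is a fin_num by exact: integrable_fin_num.
rewrite E3; case: (wfl_cut e x) => // r _; rewrite -EFinD -EFinM; congr _%:E.
by rewrite -mulr2n -[r *+ 2]mulr_natl mulrA mulVf ?mul1r.
Qed.

Lemma wfl_cut_fin e x : 0 < e -> wfl_cut e x \is a fin_num.
Proof. by move=> e0; apply: integrable_fin_num => //; exact: (psi_cut_integrable W T). Qed.

(** The bound does not depend on the cut-off [e], so it dominates the outer integral when [e] tends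
    to 0. *)
Lemma wfl_cut_bound : exists2 M, 0 <= M & forall e x, 0 < e -> x != 0 ->
  (`|wfl_cut e x| <= (M * (min_powR h (enorm x) * enorm x `^ (be - 2 * s)))%:E)%E.
Proof.
have [M M0 HM] := symm_diff_integral W T.
exists M => // e x e0 x0; rewrite wfl_cut_symm// abseM.
rewrite -[leRHS]mul1e.
apply: lee_pmul => //.
  by rewrite abse_EFin lee_fin ger0_norm ?invr_ge0// invf_le1// ler1n.
apply: le_trans (HM x x0); apply: le_trans (le_abse_integral _ _ _) _ => //.
  by apply/measurable_EFinP; exact: measurable_funM.
apply: ge0_le_integral => //.
- by apply: measurableT_comp => //; apply/measurable_EFinP; exact: measurable_funM.
- apply/measurable_EFinP; apply: measurable_funM; last exact: measurable_riesz.
  have H := measurableT_comp (@normr_measurable R setT) (measurable_symm_diff be T x); exact: H.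
- move=> k _; rewrite abse_EFin lee_fin !normrM (ger0_norm (riesz_ge0 _ _)).
  by rewrite normr_nat natr_bool_mul_le// mulr_ge0// riesz_ge0.
Qed.

Lemma wfl_cut_cvg x (u : nat -> R) : x != 0 -> (forall i, 0 < u i) -> u @ \oo --> 0 ->
  wfl_cut (u i) x @[i --> \oo] --> wfl_lim x.
Proof.
move=> x0 u0 ucvg.
under eq_cvg do rewrite wfl_cut_symm//.
apply: cvgeZl => //.
have gi := symm_diff_integrable x0.
pose f_ i k : \bar R := ((u i <= enorm k)%R%:R * (sd x k * riesz k))%:E.
have H1 : {ae lam, forall k, setT k -> f_ i k @[i --> \oo] --> (sd x k * riesz k)%:E}.
  apply: aeW => k _; rewrite /f_; have [->|k0] := eqVneq k 0.
    by apply: cvg_near_cst; apply: nearW => i; rewrite (riesz0 n_gt0 s01) !mulr0.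
  apply: cvg_near_cst; have kp : 0 < enorm k by rewrite enorm_gt0.
  have Hu := (cvgrPdist_lt _ _).1 ucvg _ kp.
  near=> i; have : `|0 - u i| < enorm k by near: i; exact: Hu.
  rewrite sub0r normrN gtr0_norm// => ik.
  by rewrite (ltW ik) mulr1n mul1r.
have H2 : {ae lam, forall k i, setT k -> `|f_ i k| <= `|(sd x k * riesz k)%:E|}%E.
  apply: aeW => k i _; rewrite /f_ !abse_EFin lee_fin !normrM normr_nat.
  by rewrite natr_bool_mul_le// mulr_ge0.
have mf_ i : measurable_fun setT (f_ i).
  by apply/measurable_EFinP; exact: measurable_funM.
have [_ _] := dominated_convergence measurableT mf_ (measurable_int _ gi) H1 (integrable_abse gi) H2.
exact.
Unshelve. all: by end_near. Qed.

Lemma wfl_lim_fin x : x != 0 -> wfl_lim x \is a fin_num.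
Proof.
by move=> x0; rewrite /wfl_lim fin_numM// integrable_fin_num// symm_diff_integrable.
Qed.

Lemma wfl_cut_cvg_right x : x != 0 -> wfl_cut e x @[e --> 0^'+] --> wfl_lim x.
Proof.
move=> x0.
have H : fine (wfl_cut e x) @[e --> 0^'+] --> fine (wfl_lim x).
  apply/cvg_at_rightP => u [u0 ucvg].
  apply: fine_cvg; rewrite fineK ?wfl_lim_fin//; exact: wfl_cut_cvg.
rewrite -(fineK (wfl_lim_fin x0)).
apply: cvg_EFin H; near=> e; apply: wfl_cut_fin.
by near: e; exact: nbhs_right_gt.
Unshelve. all: by end_near. Qed.

End principal_value_limit.

(** * The symmetrized pairing *)

Section inner_scaling.
Context {R : realType} (n : nat) (s : R).
Hypothesis n_gt0 : (0 < n)%N.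
Local Notation lam := (@lam R n).
Local Notation riesz := (riesz s).
Local Notation q := (n%:R + 2 * s).

(** The integrand is rotation invariant and homogeneous of degree (2s - n) - (n + 2s) = -2n in (x,
    z), so that integrating over z leaves a multiple of |x|^(-n). The profile [F] also sees |x -
    z|/|x|, to accommodate the Lipschitz gain. *)
Lemma inner_scaling (F : R -> R -> R) (x : 'rV[R]_n) : x != 0 ->
  (forall a b, 0 <= F a b) -> measurable_fun setT (fun ab : R * R => F ab.1 ab.2) ->
  (\int[lam]_z (enorm x `^ (2 * s - n%:R) *
      (F (enorm z / enorm x) (enorm (x - z) / enorm x) * riesz (x - z)))%:E =
   (enorm x `^ (- n%:R))%:E * \int[lam]_w (F (enorm w) (enorm (e1 n - w)) * riesz (e1 n - w))%:E)%E.
Proof.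
move=> x0 F0 mF; have r0 : 0 < enorm x by rewrite enorm_gt0.
have mFc d (T : measurableType d) (g1 g2 : T -> R) : measurable_fun setT g1 ->
    measurable_fun setT g2 -> measurable_fun setT (fun t => F (g1 t) (g2 t)).
  move=> m1 m2; have m12 : measurable_fun setT (fun t => (g1 t, g2 t)) by exact: measurable_fun_pair.
  by have H := measurableT_comp mF m12; exact: H.
set r := enorm x in r0 *.
pose f a b : \bar R := (r `^ (2 * s - n%:R) * (F (a / r) (b / r) * b `^ (- q)))%:E.
have := @integral_radial_inner R n n_gt0 f x x0.
rewrite /f /= => -> //; first last.
- apply/measurable_EFinP; apply: measurable_funM => //; apply: measurable_funM.
    by apply: mFc; apply: measurable_funM.
  by apply: measurable_fun_powR; exact: measurable_snd.
- by move=> a b; rewrite lee_fin !mulr_ge0 ?powR_ge0.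
rewrite -/r.
have E w : (r `^ (2 * s - n%:R) * (F (r * enorm w / r) (r * enorm (e1 n - w) / r) *
     (r * enorm (e1 n - w)) `^ (- q)))%:E = ((r `^ (2 * s - n%:R) * r `^ (- q))%:E *
   (F (enorm w) (enorm (e1 n - w)) * riesz (e1 n - w))%:E)%E.
  rewrite -EFinM; congr _%:E; rewrite powRM ?(ltW r0) ?enorm_ge0//.
  rewrite (_ : r * enorm w / r = enorm w); last by field; rewrite gt_eqF.
  rewrite (_ : r * enorm (e1 n - w) / r = enorm (e1 n - w)); last by field; rewrite gt_eqF.
  by rewrite /riesz -!mulrA; congr (_ * _); rewrite mulrCA.
under eq_integral do rewrite E.
rewrite ge0_integralZl//.
- rewrite muleA -EFinM -powR_mulrn ?(ltW r0)// -!powRDg//.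
  by congr (_ * _)%E; congr ((_ `^ _)%:E); ring.
- apply/measurable_EFinP; apply: measurable_funM.
    apply: mFc; first exact: measurable_enorm_id.
    by apply: measurable_enorm; exact: measurable_rV_sub.
  by apply: measurable_riesz; exact: measurable_rV_sub.
- by move=> w _; rewrite lee_fin mulr_ge0// riesz_ge0.
- by rewrite lee_fin mulr_ge0 ?powR_ge0.
Qed.

End inner_scaling.

Section finite_sum.
Context {R : realType} (n : nat).
Local Notation lam := (@lam R n).

Lemma wt2_finite (K : R) (A B : 'rV[R]_n -> R) : 0 <= K ->
  measurable_fun setT A -> measurable_fun setT B ->
  (forall x, 0 <= A x) -> (forall x, 0 <= B x) ->
  (\int[lam]_x (A x)%:E < +oo)%E -> (\int[lam]_x (B x)%:E < +oo)%E ->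
  (\int[lam]_x (K * (A x + B x))%:E < +oo)%E.
Proof.
move=> K0 mA mB A0 B0 Ai Bi.
have mE1 := (measurable_EFinP _ _).2 mA; have mE2 := (measurable_EFinP _ _).2 mB.
have g1 x : (0 <= (A x)%:E)%E by rewrite lee_fin.
have g2 x : (0 <= (B x)%:E)%E by rewrite lee_fin.
have g12 x : (0 <= (A x)%:E + (B x)%:E)%E by exact: adde_ge0.
have K0e : (0 <= K%:E)%E by rewrite lee_fin.
rewrite (eq_integral (fun x => K%:E * ((A x)%:E + (B x)%:E))%E)//.
rewrite (ge0_integralZl _ measurableT (emeasurable_funD mE1 mE2) (fun x _ => g12 x) K0e).
rewrite (ge0_integralD _ measurableT (fun x _ => g1 x) mE1 (fun x _ => g2 x) mE2).
by rewrite lte_mul_pinfty// lte_add_pinfty.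
Qed.

End finite_sum.

Section pairing.
Context {R : realType} (n : nat) (s al be h : R) (phi p : R -> R).
Hypothesis W : weights n s al be h phi p.
Variables (xi : 'rV[R]_n -> R) (C C2 rho : R).
Hypothesis T : test_fun xi C C2 rho.
Local Notation lam := (@lam R n).
Local Notation riesz := (riesz s).
Local Notation wt := (wt s).
Local Notation q := (n%:R + 2 * s).
Implicit Types (x y z k : 'rV[R]_n).

Let n_gt0 := w_n W.
Let s01 := w_s W.
Let h01 := w_h W.
Let h0 : 0 < h. Proof. by case/andP : h01. Qed.
Let s1 : s < 1. Proof. by case/andP : s01. Qed.


Definition antisym x z : R := (phi (enorm x) * gam be (enorm z) - phi (enorm z) * gam be (enorm x)) *
  ((xi x - xi z) * riesz (x - z)).

(* The half [|z| < |x|] of the antisymmetrized kernel, truncated further to [|z| < th * |x|]. *)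
Definition trunc_kernel (th : R) x z : R := (enorm z < th * enorm x)%R%:R *
  (enorm x `^ (2 * s - n%:R) * (p (enorm z / enorm x) * riesz (x - z))).

(** The Wronskian identity is applied with the larger of the two norms as [r], so that [p] is
    evaluated only below 1; when the norms agree, the antisymmetric factor vanishes. *)
Lemma antisym_split x z : antisym x z = trunc_kernel 1 x z * (xi z - xi x) + trunc_kernel 1 z x * (xi x - xi z).
Proof.
have wr := w_wronskian W; have kB := rieszB s z x.
have x0 := enorm_ge0 x; have z0 := enorm_ge0 z.
rewrite /antisym /trunc_kernel kB !mul1r; move: (enorm x) (enorm z) x0 z0 wr => r t r0 t0 wr.
have [tr|rt|<-] := ltgtP t r.
- move: (wr r t (le_lt_trans t0 tr) t0).
  move: (_ - _) (p _) (p _) (_ `^ _) (_ `^ _) => D A B E F ->.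
  by rewrite mulr1n mulr0n; ring.
- move: (wr t r (le_lt_trans r0 rt) r0).
  move: (phi r) (phi t) (gam be r) (gam be t) (p _) (p _) (_ `^ _) (_ `^ _) => a b c d A B E F H.
  have -> : a * d - b * c = F * B by rewrite -[RHS]opprK -H; ring.
  by rewrite mulr1n mulr0n; ring.
- by move: (phi t * _) => A; rewrite subrr mulr0n !mul0r addr0.
Qed.

Let mkap (a : R) : measurable_fun setT (fun x : 'rV[R]_n => (enorm x <= 2)%R%:R * enorm x `^ a).
Proof.
apply: measurable_funM; last exact: measurable_enorm_powR.
by apply: measurable_nat_ler => //; exact: measurable_enorm_id.
Qed.

(** The dominating density once [x] is normalized to [e1]: the kernel multiplied by the Lipschitz
    gain |e1 - w| and by the small loss |w|^(-h) of [test_difference_near]. *)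
Definition core (w : 'rV[R]_n) : R := (enorm w < 1)%R%:R *
  (`|p (enorm w)| * (enorm (e1 n - w) * enorm w `^ (- h))) * riesz (e1 n - w).

Lemma mp_comp d (U : measurableType d) (f : U -> R) : measurable_fun setT f ->
  measurable_fun setT (fun t => `|p (f t)|).
Proof.
move=> mf; have H := measurableT_comp (@normr_measurable R setT) (measurable_fun_comp (w_mp W) mf).
exact: H.
Qed.

Lemma measurable_core : measurable_fun setT core.
Proof.
have m1 : measurable_fun setT (fun w : 'rV[R]_n => e1 n - w) by exact: measurable_rV_sub.
have m2 : measurable_fun setT (@enorm R n) by exact: measurable_enorm_id.
apply: measurable_funM; last exact: measurable_riesz.
apply: measurable_funM; first exact: measurable_nat_ltr.
apply: measurable_funM; first exact: mp_comp.
by apply: measurable_funM; [exact: measurable_enorm|exact: measurable_enorm_powR].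
Qed.

Lemma core_ge0 w : 0 <= core w.
Proof. by rewrite !mulr_ge0 ?powR_ge0 ?enorm_ge0 ?riesz_ge0. Qed.

Lemma one_sub_enorm_le w : 1 - enorm w <= enorm (e1 n - w : 'rV[R]_n).
Proof. by rewrite -{1}(enorm_e1 (R := R) n_gt0); exact: ler_enorm_sub. Qed.

Definition cap (a : R) x : R := (enorm x <= 2)%R%:R * enorm x `^ a.

Lemma cap_ge0 a x : 0 <= cap a x. Proof. by rewrite mulr_ge0 ?powR_ge0. Qed.

(** The bound on [p] and [neg_ln_le] give p(|w|) a second factor 1 - |w| <= |e1 - w|. The density is
    then at most a multiple of |w|^(al-2h) |e1 - w|^(2-n-2s), whose singularities at 0 and at [e1]
    are each integrable. *)
Lemma core_le : exists2 K, 0 <= K & forall w, w != 0 ->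
  core w <= K * (cap (al - 2 * h) w + cap (2 - q) (e1 n - w)).
Proof.
have [M M0 HM] := w_p_le W.
have Wa := w_al W; have hp := h0; have sp := s1.
pose a := al - 2 * h; pose b := 2 - q.
pose K := M * h^-1 * (2 `^ `|a| + 2 `^ `|b|).
have hi : 0 < h^-1 by rewrite invr_gt0.
have K0 : 0 <= K by rewrite !mulr_ge0 ?(ltW hi)// addr_ge0 ?powR_ge0.
exists K => // w; rewrite -enorm_gt0 => w0; rewrite /core -/a -/b.
have [w1|w1] := ltP (enorm w) 1; last first.
  by rewrite mulr0n !mul0r; exact: mulr_ge0 K0 (addr_ge0 (cap_ge0 _ _) (cap_ge0 _ _)).
have d0 : 0 < enorm (e1 n - w) by apply: lt_le_trans (one_sub_enorm_le w); rewrite subr_gt0.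
have d2 : enorm (e1 n - w) <= 2.
  apply: le_trans (ler_enormB _ _) _; rewrite (enorm_e1 n_gt0).
  by rewrite -[leRHS]/(1 + 1) lerD2l; exact: ltW.
have pw : `|p (enorm w)| <= M * h^-1 * (enorm w `^ (al - h) * enorm (e1 n - w)).
  rewrite ger0_norm ?(w_p_ge0 W) ?w0//; apply: (le_trans (HM _ _)); first by rewrite w0.
  rewrite -mulrA; apply: ler_wpM2l => //.
  have Hln : - ln (enorm w) <= h^-1 * ((1 - enorm w) * enorm w `^ (- h)).
    by apply: neg_ln_le; rewrite ?w0 ?(ltW w1).
  apply: (le_trans (ler_wpM2l (powR_ge0 _ _) Hln)).
  rewrite (powRDg _ _ w0) (_ : _ * (h^-1 * _) = h^-1 * (enorm w `^ al * enorm w `^ (- h) * (1 - enorm w))); last ring.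
  apply: ler_wpM2l; first exact: ltW.
  apply: ler_wpM2l; first by rewrite mulr_ge0 ?powR_ge0.
  exact: one_sub_enorm_le.
rewrite mulr1n mul1r.
have kp := riesz_ge0 s (e1 n - w).
set d := enorm (e1 n - w) in d0 d2 pw *.
apply: (@le_trans _ _ (M * h^-1 * (enorm w `^ a * d `^ b))).
  have -> : M * h^-1 * (enorm w `^ a * d `^ b) =
      M * h^-1 * (enorm w `^ (al - h) * d) * (d * enorm w `^ (- h)) * riesz (e1 n - w).
    have -> : a = (al - h) + (- h) by rewrite /a; ring.
    rewrite /b (powRDg _ _ w0) (powRDg _ _ d0) powR_mulrn ?(ltW d0)// /riesz -/d; ring.
  apply: ler_wpM2r => //; apply: ler_wpM2r; last exact: pw.
  by rewrite mulr_ge0 ?powR_ge0 ?(ltW d0).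
rewrite /K -[leRHS]mulrA; apply: ler_wpM2l; first by rewrite mulr_ge0 ?(ltW hi).
rewrite /cap -/d (_ : (enorm w <= 2) = true); last first.
  by apply: (le_trans (ltW w1)); rewrite ler1n.
rewrite d2 mulr1n !mul1r.
have ka : 0 <= 2 `^ `|a| :> R by exact: powR_ge0.
have kb : 0 <= 2 `^ `|b| :> R by exact: powR_ge0.
have wa : 0 <= enorm w `^ a by exact: powR_ge0.
have db : 0 <= d `^ b by exact: powR_ge0.
(* On either side of |w| = 1/2 one of the two powers is bounded, which separates the
   singularities. *)
have [wh|wh] := leP (enorm w) 2^-1.
  have Hd : d `^ b <= 2 `^ `|b|.
    apply: powR_half_le; rewrite d2 andbT.
    by apply: le_trans (one_sub_enorm_le w); lra.
  have : enorm w `^ a * d `^ b <= enorm w `^ a * 2 `^ `|b| by exact: ler_wpM2l.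
  by move: (enorm w `^ a) (d `^ b) (2 `^ `|a|) (2 `^ `|b|) ka kb wa db => A B D F; nra.
have Hw : enorm w `^ a <= 2 `^ `|a| by apply: powR_half_le; lra.
have : enorm w `^ a * d `^ b <= 2 `^ `|a| * d `^ b by exact: ler_wpM2r.
by move: (enorm w `^ a) (d `^ b) (2 `^ `|a|) (2 `^ `|b|) ka kb wa db => A B D F; nra.
Qed.

Lemma core_finite : (\int[lam]_w (core w)%:E < +oo)%E.
Proof.
have [K K0 HK] := core_le.
have a1 : - n%:R < al - 2 * h by move: (w_al W) h0; lra.
have b1 : - n%:R < 2 - q by move: s1; lra.
have I1 := near_finite n_gt0 a1; have I2 := near_finite n_gt0 b1.
pose N1 := cap (al - 2 * h); pose N2 w := cap (2 - q) (e1 n - w).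
have mN1 : measurable_fun setT N1 := mkap _.
have mE : measurable_fun setT (fun w => (cap (2 - q) w)%:E).
  by apply/measurable_EFinP; exact: mkap.
have mN2 : measurable_fun setT N2.
  have H := measurableT_comp (mkap (2 - q)) (measurable_rV_sub (@measurable_cst _ _ _ _ setT (e1 n : 'rV[R]_n)) (@measurable_id _ _ setT)); exact: H.
have mE1 := (measurable_EFinP _ _).2 mN1; have mE2 := (measurable_EFinP _ _).2 mN2.
have g1 w : 0 <= N1 w := cap_ge0 _ _.
have g2 w : 0 <= N2 w := cap_ge0 _ _.
have E2 := integral_subr (e1 n) mE.
rewrite -E2 in I2.
have [A AE] : {A : 'rV[R]_n -> R | A = N1} by exists N1.
have [B BE] : {B : 'rV[R]_n -> R | B = N2} by exists N2.
have mA : measurable_fun setT A by rewrite AE; exact: mN1.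
have mB : measurable_fun setT B by rewrite BE; exact: mN2.
have A0 w : 0 <= A w by rewrite AE; exact: g1.
have B0 w : 0 <= B w by rewrite BE; exact: g2.
have IA : (\int[lam]_w (A w)%:E < +oo)%E by rewrite AE; exact: I1.
have IB : (\int[lam]_w (B w)%:E < +oo)%E by rewrite BE; exact: I2.
have mAB : measurable_fun setT (fun w => K * (A w + B w)).
  apply: measurable_funM; [exact: measurable_cst|exact: measurable_funD].
have AB0 w : 0 <= K * (A w + B w) by exact: mulr_ge0 K0 (addr_ge0 (A0 w) (B0 w)).
have cAB w : w != 0 -> core w <= K * (A w + B w) by move=> w0; rewrite AE BE; exact: HK.
apply: le_lt_trans (wt2_finite K0 mA mB A0 B0 IA IB).
exact: (ge0_le_integral_ne0 n_gt0 measurable_core mAB core_ge0 AB0 cAB).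
Qed.

End pairing.

Section pairing_integrable.
Context {R : realType} (n : nat) (s al be h : R) (phi p : R -> R).
Hypothesis W : weights n s al be h phi p.
Variables (xi : 'rV[R]_n -> R) (C C2 rho : R).
Hypothesis T : test_fun xi C C2 rho.
Local Notation lam := (@lam R n).
Local Notation riesz := (riesz s).
Local Notation wt := (wt s).
Implicit Types (x y z k : 'rV[R]_n).

Let n_gt0 := w_n W.
Let s01 := w_s W.
Let h01 := w_h W.
Let h0 : 0 < h. Proof. by case/andP : h01. Qed.
Let s0 : 0 < s. Proof. by case/andP : s01. Qed.
Let mxi d (U : measurableType d) (f : U -> 'rV[R]_n) : measurable_fun setT f ->
  measurable_fun setT (fun t => xi (f t)).
Proof.
by move=> mf; have H := measurableT_comp (lipschitz_measurable (t_C T) (t_lip T)) mf; exact: H.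
Qed.

Local Notation lam2 := (lam \x lam)%E.
Local Notation trunc_kernel := (trunc_kernel s p).
Local Notation antisym := (antisym s be phi xi).
Local Notation core := (core s h p).

Definition FC (t d : R) : R := (t < 1)%R%:R * (`|p t| * (d * t `^ (- h))).

Lemma coreE (w : 'rV[R]_n) : core w = FC (enorm w) (enorm (e1 n - w)) * riesz (e1 n - w).
Proof. by []. Qed.

Lemma p_norm t : 0 <= t < 1 -> `|p t| = p t.
Proof.
move=> /andP[]; rewrite le_eqVlt => /predU1P[<-|t0] t1; first by rewrite (w_p0 W) normr0.
by rewrite ger0_norm// (w_p_ge0 W)// t0.
Qed.

Lemma trunc_kernel_ge0 th x z : 0 < th <= 1 -> 0 <= trunc_kernel th x z.
Proof.
move=> /andP[t0 t1]; rewrite /trunc_kernel; have [zx|_] := ltP (enorm z) (th * enorm x); last by rewrite mulr0n mul0r.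
have zx' : enorm z < enorm x by apply: lt_le_trans zx _; rewrite -[leRHS]mul1r ler_wpM2r ?enorm_ge0.
have x0 : 0 < enorm x by apply: le_lt_trans zx'; exact: enorm_ge0.
have t01 : 0 <= enorm z / enorm x < 1.
  by rewrite ltr_pdivrMr// mul1r zx' andbT divr_ge0 ?enorm_ge0.
by rewrite mulr1n mul1r -(p_norm t01) mulr_ge0 ?powR_ge0// mulr_ge0// riesz_ge0.
Qed.

Lemma measurable_trunc_kernel th d (U : measurableType d) (f g : U -> 'rV[R]_n) :
  measurable_fun setT f -> measurable_fun setT g -> measurable_fun setT (fun t => trunc_kernel th (f t) (g t)).
Proof.
move=> mf mg.
have mff := measurable_enorm mf. have mgg := measurable_enorm mg.
apply: measurable_funM.
  by apply: measurable_nat_ltr => //; apply: measurable_funM.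
apply: measurable_funM; first exact: measurable_enorm_powR.
apply: measurable_funM; last by apply: measurable_riesz; exact: measurable_rV_sub.
apply: measurable_fun_comp (w_mp W) _; apply: measurable_funM => //.
by under eq_fun do rewrite -powR_inv1 ?enorm_ge0//; exact: measurable_enorm_powR.
Qed.

Lemma FC_ge0 t d : 0 <= d -> 0 <= FC t d.
Proof. by move=> d0; rewrite !mulr_ge0 ?powR_ge0. Qed.

Lemma pairing_le : exists2 M, 0 <= M & forall th x z, 0 < th <= 1 ->
  `|trunc_kernel th x z * (xi z - xi x)| <= M * min_powR h (enorm x) *
    (enorm x `^ (2 * s - n%:R) * (FC (enorm z / enorm x) `|enorm (x - z) / enorm x| * riesz (x - z))).
Proof.
have [M M0 HM] := test_difference_near n_gt0 (t_C T) (t_lip T) (t_rho T) (t_supp T) h01.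
exists M => // th x z th01; have /andP[t0 t1] := th01.
have R0 : 0 <= M * min_powR h (enorm x) *
    (enorm x `^ (2 * s - n%:R) * (FC (enorm z / enorm x) `|enorm (x - z) / enorm x| * riesz (x - z))).
  by rewrite !mulr_ge0 ?min_powR_ge0 ?powR_ge0.
have [zx|zx] := ltP (enorm z) (th * enorm x); last first.
  by rewrite /trunc_kernel ltNge zx mulr0n !mul0r normr0.
have zx' : enorm z < enorm x by apply: lt_le_trans zx _; rewrite -[leRHS]mul1r ler_wpM2r ?enorm_ge0.
have x0 : 0 < enorm x by apply: le_lt_trans zx'; exact: enorm_ge0.
have [z0|z0] := eqVneq z 0.
  have E : trunc_kernel th x z = 0 by rewrite /trunc_kernel z0 enorm0 mul0r (w_p0 W) mul0r !mulr0.
  by rewrite E mul0r normr0.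
rewrite normrM (ger0_norm (trunc_kernel_ge0 _ _ th01)) distrC.
apply: (le_trans (ler_wpM2l (trunc_kernel_ge0 _ _ th01) (HM x z z0 zx'))).
have t01 : 0 <= enorm z / enorm x < 1.
  by rewrite ltr_pdivrMr// mul1r zx' andbT divr_ge0 ?enorm_ge0.
have d0 : 0 <= enorm (x - z) / enorm x by rewrite divr_ge0 ?enorm_ge0.
rewrite /trunc_kernel /FC zx (ger0_norm d0) (p_norm t01); case/andP: t01 => _ ->.
rewrite !mulr1n !mul1r le_eqVlt; apply/orP; left; apply/eqP.
move: (min_powR _ _) (_ `^ _) (_ `^ _) (riesz _) (p _) => A B D E F; ring.
Qed.

(** By [inner_scaling] the inner integral is at most a multiple of |x|^(-n) [min_powR h], with the
    integral of [core] as a factor. It is the difference of xi that makes this work up to th = 1. *)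
Lemma pairing_integrable th : 0 < th <= 1 ->
  lam2.-integrable setT (fun w => (trunc_kernel th w.1 w.2 * (xi w.2 - xi w.1))%:E).
Proof.
move=> th01; have [M M0 HM] := pairing_le.
have mf : measurable_fun setT (fun w : 'rV[R]_n * 'rV[R]_n => (trunc_kernel th w.1 w.2 * (xi w.2 - xi w.1))%:E).
  apply/measurable_EFinP; apply: measurable_funM.
    by apply: measurable_trunc_kernel; [exact: measurable_fst|exact: measurable_snd].
  by apply: measurable_funB; apply: mxi; [exact: measurable_snd|exact: measurable_fst].
apply/(integrable12ltyP _ _ mf).
pose F (t d : R) := FC t `|d|.
have F0 a b : 0 <= F a b by apply: FC_ge0.
have mF : measurable_fun setT (fun ab : R * R => F ab.1 ab.2).
  apply: measurable_funM; first by apply: measurable_nat_ltr.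
  apply: measurable_funM; first by apply: (mp_comp W).
  apply: measurable_funM; last by apply: measurable_fun_powR.
  have H := measurableT_comp (@normr_measurable R setT) (@measurable_snd _ _ (measurableTypeR R) (measurableTypeR R)); exact: H.
have mI x : measurable_fun setT (fun z => (enorm x `^ (2 * s - n%:R) *
    (F (enorm z / enorm x) (enorm (x - z) / enorm x) * riesz (x - z)))%:E).
  apply/measurable_EFinP; apply: measurable_funM => //; apply: measurable_funM; last first.
    by apply: measurable_riesz; exact: measurable_rV_sub.
  have m12 : measurable_fun setT (fun z => (enorm z / enorm x, enorm (x - z) / enorm x)).
    apply: measurable_fun_pair; apply: measurable_funM => //; first exact: measurable_enorm_id.
    by apply: measurable_enorm; exact: measurable_rV_sub.
  have H := measurableT_comp mF m12; exact: H.
pose I := (\int[lam]_w (core w)%:E)%E.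
have I0 : (0 <= I)%E by apply: integral_ge0 => w _; rewrite lee_fin core_ge0.
have Ioo : (I < +oo)%E by exact: (core_finite W).
have IE : I = (fine I)%:E by rewrite fineK// ge0_fin_numE.
pose g x : R := M * fine I * (enorm x `^ (- n%:R) * min_powR h (enorm x)).
have inner x : (\int[lam]_z `|(trunc_kernel th x z * (xi z - xi x))%:E| <= (g x)%:E)%E.
  have [x0|x0] := eqVneq x 0.
    rewrite integral0_eq ?lee_fin.
      by rewrite !mulr_ge0 ?powR_ge0 ?min_powR_ge0// fine_ge0.
    move=> z _; rewrite /trunc_kernel x0 enorm0 mulr0 ltNge enorm_ge0 mulr0n !mul0r abse_EFin normr0//.
  apply: (@le_trans _ _ (\int[lam]_z ((M * min_powR h (enorm x))%:E * (enorm x `^ (2 * s - n%:R) *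
    (F (enorm z / enorm x) (enorm (x - z) / enorm x) * riesz (x - z)))%:E))%E).
    apply: ge0_le_integral => //.
    - apply: measurableT_comp => //; apply/measurable_EFinP; apply: measurable_funM.
        by apply: measurable_trunc_kernel; [exact: measurable_cst|exact: measurable_id].
      by apply: measurable_funB => //; apply: mxi; exact: measurable_id.
    - by apply: measurable_funeM; exact: mI.
    - by move=> z _; rewrite abse_EFin -EFinM lee_fin; exact: HM.
  have nn z : (0 <= (enorm x `^ (2 * s - n%:R) *
    (F (enorm z / enorm x) (enorm (x - z) / enorm x) * riesz (x - z)))%:E)%E.
    by rewrite lee_fin; apply: mulr_ge0; [exact: powR_ge0|apply: mulr_ge0; [exact: F0|exact: riesz_ge0]].
  have Mm : (0 <= (M * min_powR h (enorm x))%:E)%E by rewrite lee_fin mulr_ge0// min_powR_ge0.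
  rewrite (ge0_integralZl _ measurableT (mI x) (fun z _ => nn z) Mm).
  rewrite (inner_scaling s n_gt0 x0 F0 mF).
  rewrite (eq_integral (fun w => (core w)%:E)); last first.
    by move=> w _; rewrite coreE /F ger0_norm// enorm_ge0.
  rewrite -/I IE -!EFinM lee_fin /g le_eqVlt; apply/orP; left; apply/eqP.
  move: (min_powR _ _) (_ `^ _) (fine I) => A B D; ring.
have mg : measurable_fun setT (fun x => (g x)%:E).
  apply/measurable_EFinP; apply: measurable_funM => //; apply: measurable_funM.
    exact: measurable_enorm_powR.
  by apply: measurable_min_powR; exact: measurable_enorm_id.
apply: (@le_lt_trans _ _ (\int[lam]_x (g x)%:E)%E).
  apply: ge0_le_integral => //.
  - by move=> x _; apply: integral_ge0.
  - have ma := measurableT_comp (@abse_measurable R setT) mf.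
    by have H := measurable_fun_fubini_tonelli_F (m2 := lam) _ ma (fun w => abse_ge0 _); exact: H.
  - by move=> x _; exact: inner.
have nn x : (0 <= (enorm x `^ (- n%:R) * min_powR h (enorm x))%:E)%E by rewrite lee_fin mulr_ge0 ?powR_ge0 ?min_powR_ge0.
have mm' : measurable_fun setT (fun x : 'rV[R]_n => (enorm x `^ (- n%:R) * min_powR h (enorm x))%:E).
  apply/measurable_EFinP; apply: measurable_funM; first exact: measurable_enorm_powR.
  by apply: measurable_min_powR; exact: measurable_enorm_id.
have fI0 : 0 <= fine I by exact: fine_ge0.
have MI0 : (0 <= (M * fine I)%:E)%E by rewrite lee_fin; exact: mulr_ge0 M0 fI0.
rewrite (eq_integral (fun x => (M * fine I)%:E * (enorm x `^ (- n%:R) * min_powR h (enorm x))%:E)%E)//.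
rewrite (ge0_integralZl _ measurableT mm' (fun x _ => nn x) MI0).
by rewrite lte_mul_pinfty//; exact: radial_min_powR_finite.
Qed.

End pairing_integrable.

Section representation.
Context {R : realType} (n : nat) (s al be h : R) (phi p : R -> R).
Hypothesis W : weights n s al be h phi p.
Variables (xi : 'rV[R]_n -> R) (C C2 rho : R).
Hypothesis T : test_fun xi C C2 rho.
Local Notation lam := (@lam R n).
Local Notation riesz := (riesz s).
Local Notation wt := (wt s).
Implicit Types (x y z k : 'rV[R]_n).

Let n_gt0 := w_n W.
Let s01 := w_s W.
Let h01 := w_h W.
Let h0 : 0 < h. Proof. by case/andP : h01. Qed.
Let s0 : 0 < s. Proof. by case/andP : s01. Qed.

Local Notation lam2 := (lam \x lam)%E.
Local Notation trunc_kernel := (trunc_kernel s p).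
Local Notation antisym := (antisym s be phi xi).
Local Notation wfl_cut := (wfl_cut s be xi).
Local Notation wfl_lim := (wfl_lim s be xi).
Local Notation wfl_integrand := (wfl_integrand s be phi xi).

Definition trunc_pairing th : \bar R := (\int[lam2]_w (trunc_kernel th w.1 w.2 * (xi w.2 - xi w.1))%:E)%E.

Let one01 : 0 < (1 : R) <= 1. Proof. by rewrite ltr01 lexx. Qed.

Lemma antisym_integrable : lam2.-integrable setT (fun w => (antisym w.1 w.2)%:E).
Proof.
have H := pairing_integrable W T one01.
have H2 := integrable_swap H.
apply: eq_integrable (integrableD measurableT H H2) => // w _ /=.
by rewrite (antisym_split W) EFinD.
Qed.

Lemma antisym_integral : (\int[lam2]_w (antisym w.1 w.2)%:E = trunc_pairing 1 + trunc_pairing 1)%E.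
Proof.
have H := pairing_integrable W T one01.
have H2 := integrable_swap H.
rewrite -[X in (_ = _ + X)%E](integral_swap H) -(integralD measurableT H H2).
by apply: eq_integral => w _ /=; rewrite (antisym_split W) EFinD.
Qed.

Lemma trunc_pairing_fin th : 0 < th <= 1 -> trunc_pairing th \is a fin_num.
Proof. by move=> th01; apply: integrable_fin_num => //; exact: (pairing_integrable W T th01). Qed.

Lemma trunc_kernel_cvg (u : nat -> R) x z : (forall i, 0 < u i <= 1) -> u @ \oo --> (1 : R) ->
  \forall i \near \oo, trunc_kernel (u i) x z = trunc_kernel 1 x z.
Proof.
move=> u01 ucvg; have [zx|xz] := ltP (enorm z) (enorm x).
  have x0 : 0 < enorm x by apply: le_lt_trans zx; exact: enorm_ge0.
  have e0 : 0 < 1 - enorm z / enorm x by rewrite subr_gt0 ltr_pdivrMr// mul1r.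
  have Hu := (cvgrPdist_lt _ _).1 ucvg _ e0.
  near=> i; have : `|1 - u i| < 1 - enorm z / enorm x by near: i; exact: Hu.
  have /andP[_ ui1] := u01 i.
  rewrite ger0_norm ?subr_ge0// ltrD2l ltrN2 ltr_pdivrMr// => zui.
  by rewrite /trunc_kernel zui mul1r zx.
near=> i; rewrite /trunc_kernel mul1r [enorm z < enorm x]ltNge xz.
have -> : (enorm z < u i * enorm x) = false; last by [].
apply/negbTE; rewrite -leNgt; apply: le_trans xz.
by have /andP[_ ui1] := u01 i; rewrite -[leRHS]mul1r ler_wpM2r ?enorm_ge0.
Unshelve. all: by end_near. Qed.

Lemma trunc_pairing_cvg (u : nat -> R) : (forall i, 0 < u i <= 1) -> u @ \oo --> (1 : R) ->
  trunc_pairing (u i) @[i --> \oo] --> trunc_pairing 1.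
Proof.
move=> u01 ucvg; have gi := pairing_integrable W T one01.
pose f_ i (w : 'rV[R]_n * 'rV[R]_n) : \bar R := (trunc_kernel (u i) w.1 w.2 * (xi w.2 - xi w.1))%:E.
have H1 : {ae lam2, forall w, setT w -> f_ i w @[i --> \oo] --> (trunc_kernel 1 w.1 w.2 * (xi w.2 - xi w.1))%:E}.
  apply: aeW => w _; apply: cvg_near_cst; rewrite /f_.
  by near=> i; congr ((_ * _)%:E); near: i; exact: trunc_kernel_cvg.
have H2 : {ae lam2, forall w i, setT w -> `|f_ i w| <= `|(trunc_kernel 1 w.1 w.2 * (xi w.2 - xi w.1))%:E|}%E.
  apply: aeW => w i _; rewrite /f_ !abse_EFin lee_fin [leLHS]normrM [leRHS]normrM; apply: ler_wpM2r => //.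
  rewrite (ger0_norm (trunc_kernel_ge0 W _ _ (u01 i))) (ger0_norm (trunc_kernel_ge0 W _ _ one01)).
  rewrite /trunc_kernel mul1r; have [zx|xz] := ltP (enorm w.2) (u i * enorm w.1).
    have -> : enorm w.2 < enorm w.1.
      apply: lt_le_trans zx _; have /andP[_ ui1] := u01 i.
      by rewrite -[leRHS]mul1r ler_wpM2r ?enorm_ge0.
    by [].
  by rewrite mulr0n mul0r; have := trunc_kernel_ge0 W w.1 w.2 one01; rewrite /trunc_kernel mul1r.
have mf_ i : measurable_fun setT (f_ i) by exact: measurable_int (pairing_integrable W T (u01 i)).
have [_ _] := dominated_convergence measurableT mf_ (measurable_int _ gi) H1 (integrable_abse gi) H2.
exact.
Unshelve. all: by end_near. Qed.

(** Since al + be - 2s = -n, the product of [phi] and the bound on the principal value has the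
    borderline power. Half of [h] pays for the factor r^(h/2) + r^(-h/2) allowed in [phi], and the
    other half remains. *)
Lemma phi_min_powR_le : exists2 M, 0 <= M & forall r, 0 < r ->
  `|phi r| * (min_powR h r * r `^ (be - 2 * s)) <= M * (r `^ (- n%:R) * min_powR (h / 2) r).
Proof.
have [M M0 HM] := w_phi_le W; exists (M * 2); first by rewrite mulr_ge0.
move=> r r0; have h20 : 0 <= h / 2 by rewrite divr_ge0// ltW.
have m0 := min_powR_ge0 h r.
apply: (@le_trans _ _ (M * (r `^ al * (r `^ (h / 2) + r `^ (- (h / 2)))) * (min_powR h r * r `^ (be - 2 * s)))).
  by apply: ler_wpM2r; [rewrite mulr_ge0 ?powR_ge0|exact: HM].
have -> : - n%:R = al + (be - 2 * s) by rewrite addrA (w_sum W); ring.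
rewrite (powRDg al (be - 2 * s) r0).
rewrite [leLHS](_ : _ = M * (r `^ al * r `^ (be - 2 * s)) * (min_powR h r * r `^ (h / 2) + min_powR h r * r `^ (- (h / 2)))); last ring.
rewrite [leRHS](_ : _ = M * (r `^ al * r `^ (be - 2 * s)) * (min_powR (h / 2) r + min_powR (h / 2) r)); last ring.
apply: ler_wpM2l; first by rewrite !mulr_ge0 ?powR_ge0.
have hE : h = h / 2 + h / 2 by field.
have [r1|r1] := leP r 1.
  rewrite !min_powR_le1 ?r0 ?(ltW h0)//; have A1 : r `^ (h / 2) <= 1 by rewrite powR_le1 ?r0.
  apply: lerD; rewrite -powRDg//; apply: ger_powR; rewrite ?r0//; lra.
rewrite !min_powR_ge1 ?(ltW h0) ?(ltW r1)//.
apply: lerD; rewrite -powRDg//; apply: ler_powR; lra.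
Qed.

Lemma wfl_integrand_inner e x : 0 < e ->
  ((phi (enorm x))%:E * wfl_cut e x = \int[lam]_z (wfl_integrand e x z)%:E)%E.
Proof.
move=> e0; rewrite -(integralZl measurableT (psi_cut_integrable W T x e0)).
by apply: eq_integral => z _; rewrite -EFinM.
Qed.

Lemma wfl_integrand_symm e x z : wfl_integrand e x z + wfl_integrand e z x = cut e x z * antisym x z.
Proof.
rewrite /wfl_integrand /antisym /psi (cutC e z x) (rieszB s z x).
move: (cut _ _ _) (riesz _) (gam _ _) (gam _ _) (phi _) (phi _) => A B D E F G; ring.
Qed.

(** With the cut-off the double integral converges absolutely, so it may be added to its copy with
    the two variables exchanged; the sum is the antisymmetrized kernel. *)
Lemma wfl_cut_double e : 0 < e ->
  (\int[lam]_x ((phi (enorm x))%:E * wfl_cut e x) + \int[lam]_x ((phi (enorm x))%:E * wfl_cut e x) =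
   \int[lam2]_w (cut e w.1 w.2 * antisym w.1 w.2)%:E)%E.
Proof.
move=> e0; have FLi := wfl_integrand_integrable W T e0; have FLs := integrable_swap FLi.
under eq_integral do rewrite wfl_integrand_inner//.
have E1 : (\int[lam]_x \int[lam]_z (wfl_integrand e x z)%:E = \int[lam2]_w (wfl_integrand e w.1 w.2)%:E)%E.
  by rewrite -(integral12_prod_meas1 FLi).
rewrite E1 -[X in (_ + X)%E](integral_swap FLi) -(integralD measurableT FLi FLs).
by apply: eq_integral => w _; rewrite -EFinD wfl_integrand_symm.
Qed.

Lemma cut_antisym_cvg (u : nat -> R) : (forall i, 0 < u i) -> u @ \oo --> (0 : R) ->
  (\int[lam2]_w (cut (u i) w.1 w.2 * antisym w.1 w.2)%:E)%E @[i --> \oo] -->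
  (\int[lam2]_w (antisym w.1 w.2)%:E)%E.
Proof.
move=> u0 ucvg; have gi := antisym_integrable.
pose f_ i (w : 'rV[R]_n * 'rV[R]_n) : \bar R := (cut (u i) w.1 w.2 * antisym w.1 w.2)%:E.
have H1 : {ae lam2, forall w, setT w -> f_ i w @[i --> \oo] --> (antisym w.1 w.2)%:E}.
  apply: aeW => w _; apply: cvg_near_cst; rewrite /f_.
  have [->|d0] := eqVneq w.1 w.2.
    by apply: nearW => i; rewrite /antisym subrr !mul0r !mulr0.
  have e0 : 0 < enorm (w.1 - w.2) by rewrite enorm_gt0 subr_eq0.
  have Hu := (cvgrPdist_lt _ _).1 ucvg _ e0.
  near=> i; have : `|0 - u i| < enorm (w.1 - w.2) by near: i; exact: Hu.
  by rewrite sub0r normrN gtr0_norm// => ui; rewrite /cut (ltW ui) mulr1n mul1r.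
have H2 : {ae lam2, forall w i, setT w -> `|f_ i w| <= `|(antisym w.1 w.2)%:E|}%E.
  apply: aeW => w i _; rewrite /f_ !abse_EFin lee_fin normrM /cut normr_nat.
  exact: natr_bool_mul_le.
have mf_ i : measurable_fun setT (f_ i).
  apply/measurable_EFinP; apply: measurable_funM.
    by apply: measurable_cut; [exact: measurable_fst|exact: measurable_snd].
  exact: (measurable_EFinP _ _).1 (measurable_int _ gi).
have [_ _] := dominated_convergence measurableT mf_ (measurable_int _ gi) H1 (integrable_abse gi) H2.
exact.
Unshelve. all: by end_near. Qed.

(** Let the cut-off tend to 0 on both sides of [wfl_cut_double]: on the left the bound of
    [wfl_cut_bound] dominates, on the right [antisym] itself does. The limits are twice the two
    sides of the claim, and finite. *)
Lemma pairing_wfl_lim : lam.-integrable setT (fun x => (phi (enorm x))%:E * wfl_lim x)%E /\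
  (\int[lam]_x ((phi (enorm x))%:E * wfl_lim x) = trunc_pairing 1)%E.
Proof.
have [M M0 HM] := phi_min_powR_le; have [M' M'0 HM'] := wfl_cut_bound W T.
pose u (i : nat) : R := i.+1%:R^-1.
have u0 i : 0 < u i by rewrite invr_gt0.
have ucvg : u @ \oo --> (0 : R) by exact: cvg_harmonic.
pose g x : R := M' * M * (enorm x `^ (- n%:R) * min_powR (h / 2) (enorm x)).
have g0 x : 0 <= g x by rewrite /g mulr_ge0 ?mulr_ge0 ?powR_ge0 ?min_powR_ge0.
have h20 : 0 < h / 2 by rewrite divr_gt0.
have gi : lam.-integrable setT (EFin \o g).
  have H : lam.-integrable setT (EFin \o (fun x : 'rV[R]_n => enorm x `^ (- n%:R) * min_powR (h / 2) (enorm x))).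
    apply: integrable_ge0_fin.
    - apply: measurable_funM; first exact: measurable_enorm_powR.
      by apply: measurable_min_powR; exact: measurable_enorm_id.
    - by move=> x; rewrite mulr_ge0 ?powR_ge0 ?min_powR_ge0.
    - exact: radial_min_powR_finite.
  exact: (integrableZl measurableT (M' * M) H).
pose f_ i x : \bar R := ((phi (enorm x))%:E * wfl_cut (u i) x)%E.
pose f x : \bar R := ((phi (enorm x))%:E * wfl_lim x)%E.
have f_f x : f_ i x @[i --> \oo] --> f x.
  rewrite /f_ /f; have [->|x0] := eqVneq x 0.
    by apply: cvg_near_cst; apply: nearW => i; rewrite enorm0 (w_phi0 W) !mul0e.
  by apply: cvgeZl => //; exact: (wfl_cut_cvg W T x0 u0 ucvg).
have mf_ i : measurable_fun setT (f_ i).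
  rewrite (_ : f_ i = fun x => (\int[lam]_z (wfl_integrand (u i) x z)%:E)%E).
    exact: (measurable_fubini_F (wfl_integrand_integrable W T (u0 i))).
  by apply/funext => x; rewrite /f_ wfl_integrand_inner.
have mf : measurable_fun setT f.
  by apply: (emeasurable_fun_cvg f_) => // x _; exact: f_f.
have H1 : {ae lam, forall x, setT x -> f_ i x @[i --> \oo] --> f x}.
  by apply: aeW => x _; exact: f_f.
have H2 : {ae lam, forall x i, setT x -> `|f_ i x| <= (EFin \o g) x}%E.
  apply: aeW => x i _; rewrite /f_ /=; have [->|x0] := eqVneq x 0.
    by rewrite enorm0 (w_phi0 W) mul0e abse0 lee_fin.
  rewrite abseM abse_EFin.
  apply: (@le_trans _ _ (`|phi (enorm x)|%:E * (M' * (min_powR h (enorm x) * enorm x `^ (be - 2 * s)))%:E)%E).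
    by apply: lee_wpmul2l => //; exact: HM'.
  rewrite -EFinM lee_fin /g -mulrA mulrCA; apply: ler_wpM2l => //.
  by apply: HM; rewrite enorm_gt0.
have [fi _ fcvg] := dominated_convergence measurableT mf_ mf H1 gi H2.
split; first exact: fi.
have If : (\int[lam]_x f x)%E \is a fin_num by exact: integrable_fin_num.
have D1 : ((\int[lam]_x f_ i x) + (\int[lam]_x f_ i x))%E @[i --> \oo] -->
    (\int[lam]_x f x + \int[lam]_x f x)%E.
  by apply: cvgeD => //; exact: fin_num_adde_defr.
have D2 := cut_antisym_cvg u0 ucvg.
have E i : ((\int[lam]_x f_ i x) + (\int[lam]_x f_ i x))%E =
    (\int[lam2]_w (cut (u i) w.1 w.2 * antisym w.1 w.2)%:E)%E by exact: wfl_cut_double.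
rewrite (eq_cvg _ _ E) in D1.
have EQ : (\int[lam]_x f x + \int[lam]_x f x = \int[lam2]_w (antisym w.1 w.2)%:E)%E.
  by apply: cvg_unique D1 D2.
move: EQ; rewrite antisym_integral.
have := trunc_pairing_fin one01.
move: If; rewrite -/(f _); move: (\int[lam]_x f x)%E (trunc_pairing 1) => [a||] [b||]// _ _.
by rewrite -!EFinD => -[H]; congr _%:E; lra.
Qed.

End representation.

(** * Flux of the truncated kernel *)

Section flux.
Context {R : realType} (n : nat) (s al be h : R) (phi p : R -> R).
Hypothesis W : weights n s al be h phi p.
Local Notation lam := (@lam R n).
Local Notation riesz := (riesz s).
Local Notation wt := (wt s).
Implicit Types (x y z k : 'rV[R]_n).

Let n_gt0 := w_n W.
Let s01 := w_s W.
Let h01 := w_h W.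
Let h0 : 0 < h. Proof. by case/andP : h01. Qed.
Let s0 : 0 < s. Proof. by case/andP : s01. Qed.
Let n0 : (0 : R) < n%:R. Proof. by rewrite ltr0n. Qed.
Local Notation lam2 := (lam \x lam)%E.
Local Notation trunc_kernel := (trunc_kernel s p).
Local Notation core := (core s h p).

Definition mass_density th (w : 'rV[R]_n) : R := (enorm w < th)%R%:R * (`|p (enorm w)| * riesz (e1 n - w)).
(** The factor - ln |w| is the logarithmic length of the range r < |x| <= r/|w| of those |x| for
    which a jump from x to a point of norm |w| |x| crosses the sphere of radius [r]. *)
Definition log_density th (w : 'rV[R]_n) : R := mass_density th w * - ln (enorm w).

Let me1 : measurable_fun setT (fun w : 'rV[R]_n => e1 n - w).
Proof. exact: measurable_rV_sub. Qed.

Let men : measurable_fun setT (@enorm R n).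
Proof. exact: measurable_enorm_id. Qed.

Lemma measurable_mass_density th : measurable_fun setT (mass_density th).
Proof.
apply: measurable_funM; first exact: measurable_nat_ltr.
by apply: measurable_funM; [exact: (mp_comp W)|exact: measurable_riesz].
Qed.

Lemma mass_density_ge0 th w : 0 <= mass_density th w.
Proof. by rewrite !mulr_ge0// riesz_ge0. Qed.

Lemma measurable_log_density th : measurable_fun setT (log_density th).
Proof.
apply: measurable_funM; first exact: measurable_mass_density.
have H := measurableT_comp (@oppr_measurable R setT) (measurable_fun_ln men); exact: H.
Qed.

Lemma log_density_ge0 th w : th <= 1 -> 0 <= log_density th w.
Proof.
move=> th1; rewrite /log_density /mass_density; have [wt|_] := ltP (enorm w) th; last by rewrite mulr0n !mul0r.
rewrite mulr_ge0 ?mass_density_ge0//; first by rewrite !mulr_ge0// riesz_ge0.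
by rewrite oppr_ge0 ln_le0// (ltW (lt_le_trans wt th1)).
Qed.

Lemma log_density_le_core th w : th <= 1 -> log_density th w <= h^-1 * core w.
Proof.
move=> th1; have c0 : 0 <= h^-1 * core w by rewrite mulr_ge0 ?core_ge0// invr_ge0 ltW.
rewrite /log_density /mass_density; have [wt|_] := ltP (enorm w) th; last by rewrite mulr0n !mul0r.
have w1 : enorm w < 1 by exact: lt_le_trans wt th1.
have [w0|w0] := eqVneq w 0.
  by rewrite {1}w0 enorm0 (w_p0 W) normr0 mul0r mulr0 mul0r.
move: w0; rewrite -enorm_gt0 => w0; rewrite /core w1 !mulr1n !mul1r.
have Hln : - ln (enorm w) <= h^-1 * ((1 - enorm w) * enorm w `^ (- h)).
  by apply: neg_ln_le; rewrite ?w0 ?(ltW w1).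
have H2 : (1 - enorm w) * enorm w `^ (- h) <= enorm (e1 n - w) * enorm w `^ (- h).
  by apply: ler_wpM2r; [exact: powR_ge0|exact: (one_sub_enorm_le W)].
rewrite [leRHS](_ : _ = (`|p (enorm w)| * riesz (e1 n - w)) * (h^-1 * (enorm (e1 n - w) * enorm w `^ (- h)))); last ring.
apply: ler_wpM2l; first by rewrite mulr_ge0// riesz_ge0.
apply: (le_trans Hln); apply: ler_wpM2l => //.
by rewrite invr_ge0 ltW.
Qed.

Lemma log_density_integrable th : th <= 1 -> lam.-integrable setT (fun w => (log_density th w)%:E).
Proof.
move=> th1; have H := integrable_ge0_fin (measurable_core W) (@core_ge0 R n s h p) (core_finite W).
apply: (le_integrable measurableT _ _ (integrableZl measurableT h^-1 H)).
  by apply/measurable_EFinP; exact: measurable_log_density.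
move=> w _ /=; rewrite lee_fin ger0_norm ?log_density_ge0//.
by apply: (le_trans (log_density_le_core _ th1)); exact: ler_norm.
Qed.

Variable th : R.
Hypothesis th01 : 0 < th < 1.
Let th0 : 0 < th. Proof. by case/andP : th01. Qed.
Let th1 : th < 1. Proof. by case/andP : th01. Qed.
Let th01' : 0 < th <= 1. Proof. by rewrite th0 ltW. Qed.

Definition mass_in : \bar R := (\int[lam]_w (mass_density th w)%:E)%E.
(** The marginal in the other variable, normalized at |z| = 1: here [w] plays the part of x, whence
    1/|w| inside [p]. *)
Definition mass_out : \bar R := (\int[lam]_w ((1 < th * enorm w)%R%:R *
  (enorm w `^ (2 * s - n%:R) * `|p (enorm w `^ (- 1))|) * riesz (e1 n - w))%:E)%E.

(** For th < 1 the support stays at distance at least 1 - th from [e1], so the factor |e1 - w| of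
    [core] can be inserted at that cost. *)
Lemma mass_density_le_core w : mass_density th w <= (1 - th)^-1 * core w.
Proof.
have t10 : 0 < 1 - th by rewrite subr_gt0.
have c0 : 0 <= (1 - th)^-1 * core w by rewrite mulr_ge0 ?core_ge0// invr_ge0 ltW.
rewrite /mass_density; have [wt|_] := ltP (enorm w) th; last by rewrite mulr0n mul0r.
have w1 : enorm w < 1 by exact: lt_trans wt th1.
have [w0|w0] := eqVneq w 0.
  by rewrite {1}w0 enorm0 (w_p0 W) normr0 mul0r mulr0.
move: w0; rewrite -enorm_gt0 => w0; rewrite /core w1 !mulr1n !mul1r.
rewrite [leRHS](_ : _ = (`|p (enorm w)| * riesz (e1 n - w)) * ((1 - th)^-1 * enorm (e1 n - w) * enorm w `^ (- h))); last ring.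
rewrite ler_peMr//; first by rewrite mulr_ge0// riesz_ge0.
apply: (@le_trans _ _ ((1 - th)^-1 * enorm (e1 n - w))).
  rewrite ler_pdivlMl// mulr1; apply: le_trans (one_sub_enorm_le W w).
  by rewrite lerD2l lerN2 ltW.
have u1 : 1 <= enorm w `^ (- h) by apply: powRN_ge1; rewrite ?w0 ltW.
by apply: ler_peMr u1; rewrite mulr_ge0 ?enorm_ge0// invr_ge0 ltW.
Qed.

Lemma mass_in_fin : (mass_in < +oo)%E.
Proof.
have t10 : 0 <= (1 - th)^-1 by rewrite invr_ge0 subr_ge0 ltW.
have I := core_finite W.
have m0 (w : 'rV[R]_n) : (0 <= (core w)%:E)%E by rewrite lee_fin core_ge0.
have mc : measurable_fun setT (fun w : 'rV[R]_n => (core w)%:E).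
  exact: (measurable_EFinP _ _).2 (measurable_core W).
apply: (@le_lt_trans _ _ (\int[lam]_w ((1 - th)^-1%:E * (core w)%:E))%E).
  apply: ge0_le_integral.
  - exact: measurableT.
  - by move=> w _; rewrite lee_fin mass_density_ge0.
  - by apply/measurable_EFinP; exact: measurable_mass_density.
  - exact: measurable_funeM.
  - by move=> w _; rewrite -EFinM lee_fin mass_density_le_core.
have te : (0 <= (1 - th)^-1%:E)%E by rewrite lee_fin.
rewrite (ge0_integralZl _ measurableT mc (fun w _ => m0 w) te).
by rewrite lte_mul_pinfty.
Qed.

Let mr2 : measurable_fun setT (fun ab : R * R => ab.1 : R).
Proof. exact: measurable_fst. Qed.

(** The weight [c] serves two purposes: the constant 1 gives the marginal, and the indicator of t
    |x| <= r gives the flux through a sphere. *)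
Lemma integral_trunc_kernel_weighted (c : R -> R) x : x != 0 -> measurable_fun setT c -> (forall t, 0 <= c t) ->
  (\int[lam]_z (trunc_kernel th x z * c (enorm z / enorm x))%:E =
   (enorm x `^ (- n%:R))%:E * \int[lam]_w (mass_density th w * c (enorm w))%:E)%E.
Proof.
move=> x0 mc c0; have r0 : 0 < enorm x by rewrite enorm_gt0.
pose F (t d : R) : R := (t < th)%R%:R * `|p t| * c t.
have F0 a b : 0 <= F a b by rewrite !mulr_ge0.
have mF : measurable_fun setT (fun ab : R * R => F ab.1 ab.2).
  apply: measurable_funM; last exact: measurable_fun_comp mc mr2.
  by apply: measurable_funM; [exact: measurable_nat_ltr|exact: (mp_comp W)].
have := inner_scaling s n_gt0 x0 F0 mF.
have -> : (\int[lam]_w (F (enorm w) (enorm (e1 n - w)) * riesz (e1 n - w))%:E =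
    \int[lam]_w (mass_density th w * c (enorm w))%:E)%E.
  apply: eq_integral => w _; rewrite /F /mass_density; congr _%:E.
  by rewrite -!mulrA; congr (_ * (_ * _)); rewrite mulrC.
move=> <-; apply: eq_integral => z _; congr _%:E; rewrite /F /trunc_kernel.
rewrite -ltr_pdivrMr//; have [zx|_] := ltP (enorm z / enorm x) th; last by rewrite mulr0n !mul0r mulr0.
have t01 : 0 <= enorm z / enorm x < 1.
  by rewrite (lt_trans zx th1) andbT divr_ge0 ?enorm_ge0.
rewrite (p_norm W t01) !mulr1n; move: (p _) (c _) (riesz _) (_ `^ _) => A B D E; ring.
Qed.

Lemma integral_trunc_kernel_outer z : z != 0 ->
  (\int[lam]_x (trunc_kernel th x z)%:E = (enorm z `^ (- n%:R))%:E * mass_out)%E.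
Proof.
move=> z0; have r0 : 0 < enorm z by rewrite enorm_gt0.
pose F (t d : R) : R := (1 < th * t)%R%:R * (t `^ (2 * s - n%:R) * `|p (t `^ (- 1))|).
have F0 a b : 0 <= F a b by rewrite !mulr_ge0 ?powR_ge0.
have mF : measurable_fun setT (fun ab : R * R => F ab.1 ab.2).
  apply: measurable_funM; first by apply: measurable_nat_ltr => //; exact: measurable_funM.
  apply: measurable_funM; first exact: measurable_fun_powR.
  by apply: (mp_comp W); exact: measurable_fun_powR.
have := inner_scaling s n_gt0 z0 F0 mF.
rewrite -/mass_out => <-; apply: eq_integral => x _; congr _%:E; rewrite /F /trunc_kernel.
have -> : (1 < th * (enorm x / enorm z)) = (enorm z < th * enorm x).
  by rewrite mulrA ltr_pdivlMr// mul1r.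
have [zx|_] := ltP (enorm z) (th * enorm x); last by rewrite mulr0n !mul0r mulr0.
have x0 : 0 < enorm x by rewrite -(pmulr_rgt0 _ th0); exact: lt_trans zx.
have t01 : 0 <= enorm z / enorm x < 1.
  rewrite divr_ge0 ?enorm_ge0//= ltr_pdivrMr// mul1r (lt_trans zx)//.
  by rewrite -[ltRHS]mul1r ltr_pM2r.
rewrite powR_inv1 ?divr_ge0 ?enorm_ge0// invf_div (p_norm W t01).
have -> : enorm x `^ (2 * s - n%:R) = enorm z `^ (2 * s - n%:R) * (enorm x / enorm z) `^ (2 * s - n%:R).
  by rewrite -powRM ?divr_ge0 ?enorm_ge0// (mulrC (enorm z)) divfK ?gt_eqF.
rewrite [riesz (x - z)]rieszB.
rewrite !mulr1n !mul1r.
move: (p _) (riesz _) (_ `^ _) (_ `^ _) => A B D E; ring.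
Qed.

Let W1 := n%:R * fine (lam (cball 1)).

Let annf a b (x : 'rV[R]_n) : R := \1_(ann a b) x * enorm x `^ (- n%:R).

Let mannf a b : measurable_fun setT (fun x => (annf a b x)%:E).
Proof.
apply/measurable_EFinP; apply: measurable_funM; last exact: measurable_enorm_powR.
by apply: measurable_indic; exact: measurable_ann.
Qed.

Let annf_ge0 a b x : 0 <= annf a b x. Proof. by rewrite mulr_ge0 ?powR_ge0. Qed.

Lemma annI_dilate r t : 0 < r -> 0 < t <= 1 -> annI n r (r / t) = (W1 * - ln t)%:E :> \bar R.
Proof.
move=> r0 /andP[t0 t1]; have := annI_scale n 1 t^-1 r0; rewrite mulr1 => ->.
by rewrite (annI_ln n) ?invf_ge1// lnV ?posrE.
Qed.

(** Substitute z = |x| w up to a rotation and exchange the integrals. For fixed [w] the condition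
    |w| |x| <= r < |x| describes the shell between r and r/|w|, whose mass for |x|^(-n) dx is [W1]
    times - ln |w|. The result does not depend on [r]. *)
Lemma flux_through_sphere r : 0 < r ->
  (\int[lam2]_w (trunc_kernel th w.1 w.2 * ((enorm w.2 <= r)%R%:R * (r < enorm w.1)%R%:R))%:E =
   \int[lam]_w (W1 * log_density th w)%:E)%E.
Proof.
move=> r0.
have mP : measurable_fun setT (fun w : 'rV[R]_n * 'rV[R]_n =>
    (trunc_kernel th w.1 w.2 * ((enorm w.2 <= r)%R%:R * (r < enorm w.1)%R%:R))%:E).
  apply/measurable_EFinP; apply: measurable_funM.
    by apply: (measurable_trunc_kernel W); [exact: measurable_fst|exact: measurable_snd].
  apply: measurable_funM.
    by apply: measurable_nat_ler => //; apply: measurable_enorm; exact: measurable_snd.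
  by apply: measurable_nat_ltr => //; apply: measurable_enorm; exact: measurable_fst.
rewrite (fubini_tonelli1 (m1 := lam) (m2 := lam) _ mP); last first.
  by move=> w; rewrite lee_fin mulr_ge0 ?(trunc_kernel_ge0 W)// mulr_ge0.
pose G (w : 'rV[R]_n * 'rV[R]_n) : R := (r < enorm w.1)%R%:R * enorm w.1 `^ (- n%:R) *
  (mass_density th w.2 * (enorm w.2 * enorm w.1 <= r)%R%:R).
have mG : measurable_fun setT (fun w => (G w)%:E).
  apply/measurable_EFinP; apply: measurable_funM.
    apply: measurable_funM; last by apply: measurable_enorm_powR; exact: measurable_fst.
    by apply: measurable_nat_ltr => //; apply: measurable_enorm; exact: measurable_fst.
  apply: measurable_funM.
    by have H := measurableT_comp (measurable_mass_density th) measurable_snd; exact: H.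
  apply: measurable_nat_ler => //; apply: measurable_funM.
    by apply: measurable_enorm; exact: measurable_snd.
  by apply: measurable_enorm; exact: measurable_fst.
have G0 w : (0 <= (G w)%:E)%E by rewrite lee_fin !mulr_ge0 ?powR_ge0 ?mass_density_ge0.
transitivity (\int[lam]_x \int[lam]_w (G (x, w))%:E)%E.
  apply: eq_integral => x _; rewrite /fubini_F /=.
  have [xr|xr] := ltP r (enorm x); last first.
    by rewrite !integral0_eq// => z _; rewrite ?/G/= ?[r < _]ltNge ?xr/= ?mulr0n ?mul0r ?mulr0 ?mul0r.
  have x0 : x != 0 by rewrite -enorm_gt0 (lt_trans r0).
  pose c t : R := (t * enorm x <= r)%R%:R.
  have mc : measurable_fun setT c by apply: measurable_nat_ler => //; exact: measurable_funM.
  have c0 t : 0 <= c t by [].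
  have := integral_trunc_kernel_weighted x0 mc c0.
  have xg : enorm x != 0 by rewrite enorm_eq0.
  rewrite (eq_integral (fun z => (trunc_kernel th x z * ((enorm z <= r)%R%:R * true%:R))%:E)); last first.
    by move=> z _; rewrite /c divfK// mulr1n mulr1.
  move=> ->; rewrite -ge0_integralZl//.
  - by apply: eq_integral => w _; rewrite -EFinM /G/= xr mulr1n mul1r.
  - apply/measurable_EFinP; apply: measurable_funM; first exact: measurable_mass_density.
    exact: measurable_fun_comp mc men.
  - by move=> w _; rewrite lee_fin mulr_ge0 ?mass_density_ge0.
  - by rewrite lee_fin powR_ge0.
rewrite (fubini_tonelli (m1 := lam) (m2 := lam) _ mG G0); apply: eq_integral => w _.
have [w0|w0] := eqVneq w 0.
  rewrite integral0_eq; first by rewrite /log_density /mass_density w0 enorm0 (w_p0 W) normr0 !(mul0r, mulr0).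
  by move=> x _; rewrite /G/= /mass_density w0 enorm0 (w_p0 W) normr0 !(mul0r, mulr0).
have [wt|wt] := ltP (enorm w) th; last first.
  rewrite integral0_eq; first by rewrite /log_density /mass_density [enorm w < th]ltNge wt mulr0n !(mul0r, mulr0).
  by move=> x _; rewrite /G/= /mass_density [enorm w < th]ltNge wt mulr0n !(mul0r, mulr0).
have wp : 0 < enorm w by rewrite enorm_gt0.
have w1 : 0 < enorm w <= 1 by rewrite wp ltW// (lt_trans wt).
rewrite (eq_integral (fun x => (mass_density th w)%:E * (annf r (r / enorm w) x)%:E)%E); last first.
  move=> x _; rewrite -EFinM /G/= /annf; congr _%:E.
  have -> : \1_(ann r (r / enorm w)) x = (r < enorm x)%R%:R * (enorm w * enorm x <= r)%R%:R :> R.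
    rewrite indicE -natrM mulnb; congr (nat_of_bool _)%:R.
    apply/idP/andP; rewrite inE /ann/= ler_pdivlMr// mulrC; first by case.
    by case.
  move: (_%:R) (_%:R) (mass_density _ _) (_ `^ _) => A B D E; ring.
rewrite (ge0_integralZl _ measurableT (mannf _ _) (fun x _ => _)); last 2 first.
- by move=> x _; rewrite lee_fin.
- by rewrite lee_fin mass_density_ge0.
rewrite -/(annI n r (r / enorm w)) annI_dilate// -EFinM /log_density; congr _%:E; ring.
Qed.

Lemma flux_finite : (\int[lam]_w (W1 * log_density th w)%:E < +oo)%E.
Proof.
have W10 : 0 <= W1 by rewrite mulr_ge0 ?fine_ge0.
have H := integrable_lty measurableT (integrableZl measurableT W1 (log_density_integrable (ltW th1))).
exact: H.
Qed.

Let enorm0_powRn (z : 'rV[R]_n) : z = 0 -> enorm z `^ (- n%:R) = 0 :> R.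
Proof. by move=> ->; rewrite enorm0 powR0// oppr_eq0 gt_eqF. Qed.

Let mPT : measurable_fun setT (fun w : 'rV[R]_n * 'rV[R]_n => trunc_kernel th w.1 w.2).
Proof. by apply: (measurable_trunc_kernel W); [exact: measurable_fst|exact: measurable_snd]. Qed.

Let P0 (w : 'rV[R]_n * 'rV[R]_n) : 0 <= trunc_kernel th w.1 w.2 := trunc_kernel_ge0 W _ _ th01'.

Lemma mass_out_ge0 : (0 <= mass_out)%E.
Proof. by apply: integral_ge0 => w _; rewrite lee_fin !mulr_ge0 ?powR_ge0 ?riesz_ge0. Qed.

Lemma mass_in_ge0 : (0 <= mass_in)%E.
Proof. by apply: integral_ge0 => w _; rewrite lee_fin mass_density_ge0. Qed.

Lemma integral_trunc_kernel_in x : (\int[lam]_z (trunc_kernel th x z)%:E = (enorm x `^ (- n%:R))%:E * mass_in)%E.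
Proof.
have [x0|x0] := eqVneq x 0.
  rewrite (enorm0_powRn x0) mul0e integral0_eq// => z _.
  by rewrite /trunc_kernel x0 enorm0 mulr0 ltNge enorm_ge0 mulr0n mul0r.
have m1 : measurable_fun setT (cst 1 : R -> R) by [].
have := integral_trunc_kernel_weighted x0 m1 (fun=> ler01).
rewrite (_ : (\int[lam]_w (mass_density th w * cst 1 (enorm w))%:E)%E = mass_in); last first.
  by apply: eq_integral => w _; rewrite /= mulr1.
by move=> <-; apply: eq_integral => z _; rewrite /= mulr1.
Qed.

Lemma integral_trunc_kernel_out z : (\int[lam]_x (trunc_kernel th x z)%:E = (enorm z `^ (- n%:R))%:E * mass_out)%E.
Proof.
have [z0|z0] := eqVneq z 0; last exact: integral_trunc_kernel_outer.
rewrite (enorm0_powRn z0) mul0e integral0_eq// => x _.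
by rewrite /trunc_kernel z0 enorm0 mul0r (w_p0 W) mul0r !mulr0.
Qed.

Lemma flux_in (g : 'rV[R]_n -> R) : measurable_fun setT g -> (forall x, 0 <= g x) ->
  (\int[lam2]_w (trunc_kernel th w.1 w.2 * g w.1)%:E = mass_in * \int[lam]_x (g x * enorm x `^ (- n%:R))%:E)%E.
Proof.
move=> mg g0.
have mG : measurable_fun setT (fun w : 'rV[R]_n * 'rV[R]_n => (trunc_kernel th w.1 w.2 * g w.1)%:E).
  apply/measurable_EFinP; apply: measurable_funM => //.
  by have H := measurableT_comp mg measurable_fst; exact: H.
have mK : measurable_fun setT (fun x => (g x * enorm x `^ (- n%:R))%:E).
  by apply/measurable_EFinP; apply: measurable_funM => //; exact: measurable_enorm_powR.
have K0 x : (0 <= (g x * enorm x `^ (- n%:R))%:E)%E by rewrite lee_fin mulr_ge0 ?powR_ge0.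
rewrite (fubini_tonelli1 (m1 := lam) (m2 := lam) _ mG); last first.
  by move=> w; rewrite lee_fin mulr_ge0.
rewrite -(ge0_integralZl _ measurableT mK (fun x _ => K0 x) mass_in_ge0).
apply: eq_integral => x _; rewrite /fubini_F /=.
under eq_integral do rewrite mulrC EFinM.
have mx : measurable_fun setT (fun z : 'rV[R]_n => (trunc_kernel th x z)%:E).
  by apply/measurable_EFinP; apply: (measurable_trunc_kernel W).
have gx : (0 <= (g x)%:E)%E by rewrite lee_fin.
have Px z : setT z -> (0 <= (trunc_kernel th x z)%:E)%E by move=> _; rewrite lee_fin; exact: (P0 (x, z)).
by rewrite (ge0_integralZl _ measurableT mx Px gx) integral_trunc_kernel_in muleA -EFinM muleC.
Qed.

Lemma flux_out (g : 'rV[R]_n -> R) : measurable_fun setT g -> (forall x, 0 <= g x) ->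
  (\int[lam2]_w (trunc_kernel th w.1 w.2 * g w.2)%:E = mass_out * \int[lam]_x (g x * enorm x `^ (- n%:R))%:E)%E.
Proof.
move=> mg g0.
have mG : measurable_fun setT (fun w : 'rV[R]_n * 'rV[R]_n => (trunc_kernel th w.1 w.2 * g w.2)%:E).
  apply/measurable_EFinP; apply: measurable_funM => //.
  by have H := measurableT_comp mg measurable_snd; exact: H.
have mK : measurable_fun setT (fun x => (g x * enorm x `^ (- n%:R))%:E).
  by apply/measurable_EFinP; apply: measurable_funM => //; exact: measurable_enorm_powR.
have K0 x : (0 <= (g x * enorm x `^ (- n%:R))%:E)%E by rewrite lee_fin mulr_ge0 ?powR_ge0.
rewrite (fubini_tonelli2 (m1 := lam) (m2 := lam) _ mG); last first.
  by move=> w; rewrite lee_fin mulr_ge0.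
rewrite -(ge0_integralZl _ measurableT mK (fun x _ => K0 x) mass_out_ge0).
apply: eq_integral => z _; rewrite /fubini_G /=.
under eq_integral do rewrite mulrC EFinM.
have mx : measurable_fun setT (fun x : 'rV[R]_n => (trunc_kernel th x z)%:E).
  by apply/measurable_EFinP; apply: (measurable_trunc_kernel W).
have gx : (0 <= (g z)%:E)%E by rewrite lee_fin.
have Px x : setT x -> (0 <= (trunc_kernel th x z)%:E)%E by move=> _; rewrite lee_fin; exact: (P0 (x, z)).
by rewrite (ge0_integralZl _ measurableT mx Px gx) integral_trunc_kernel_out muleA -EFinM muleC.
Qed.

(* Compare the fluxes of the kernel through the spheres of radius [1] and [expR 1]. *)
Lemma mass_out_eq_in : mass_out = mass_in.
Proof.
have v0 : 0 < W1 by rewrite mulr_gt0// fine_gt0// cball_gt0 cball_finite.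
have e1 : (1 : R) <= expR 1 by rewrite -[leLHS]expR0 ler_expR.
have annE : annI n 1 (expR 1) = W1%:E :> \bar R by rewrite (annI_ln n e1) expRK mulr1.
pose c1 (w : 'rV[R]_n * 'rV[R]_n) : R := trunc_kernel th w.1 w.2 * \1_(ann 1 (expR 1)) w.2.
pose c2 (w : 'rV[R]_n * 'rV[R]_n) : R := trunc_kernel th w.1 w.2 * ((enorm w.2 <= 1)%R%:R * (1 < enorm w.1)%R%:R).
pose c3 (w : 'rV[R]_n * 'rV[R]_n) : R := trunc_kernel th w.1 w.2 * \1_(ann 1 (expR 1)) w.1.
pose c4 (w : 'rV[R]_n * 'rV[R]_n) : R := trunc_kernel th w.1 w.2 * ((enorm w.2 <= expR 1)%R%:R * (expR 1 < enorm w.1)%R%:R).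
have mef : measurable_fun setT (fun w : 'rV[R]_n * 'rV[R]_n => enorm w.1).
  by apply: measurable_enorm; exact: measurable_fst.
have mes : measurable_fun setT (fun w : 'rV[R]_n * 'rV[R]_n => enorm w.2).
  by apply: measurable_enorm; exact: measurable_snd.
have mann := measurable_ann (1 : R) (expR 1) (n := n).
have m1 : measurable_fun setT (fun w => (c1 w)%:E).
  apply/measurable_EFinP; apply: measurable_funM => //.
  exact: measurable_indic_comp mann measurable_snd.
have m3 : measurable_fun setT (fun w => (c3 w)%:E).
  apply/measurable_EFinP; apply: measurable_funM => //.
  exact: measurable_indic_comp mann measurable_fst.
have m24 (r : R) : measurable_fun setT (fun w : 'rV[R]_n * 'rV[R]_n =>
    (trunc_kernel th w.1 w.2 * ((enorm w.2 <= r)%R%:R * (r < enorm w.1)%R%:R))%:E).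
  apply/measurable_EFinP; apply: measurable_funM => //.
  by apply: measurable_funM; [exact: measurable_nat_ler|exact: measurable_nat_ltr].
have p1 w : (0 <= (c1 w)%:E)%E by rewrite lee_fin; apply: mulr_ge0.
have p3 w : (0 <= (c3 w)%:E)%E by rewrite lee_fin; apply: mulr_ge0.
have p2 w : (0 <= (c2 w)%:E)%E by rewrite lee_fin; apply: mulr_ge0 => //; exact: mulr_ge0.
have p4 w : (0 <= (c4 w)%:E)%E by rewrite lee_fin; apply: mulr_ge0 => //; exact: mulr_ge0.
have mi : measurable_fun setT (\1_(ann 1 (expR 1)) : 'rV[R]_n -> R) by exact: measurable_indic.
have i0 (x : 'rV[R]_n) : 0 <= \1_(ann 1 (expR 1)) x :> R by [].
have I1 : (\int[lam2]_w (c1 w)%:E = mass_out * W1%:E)%E by rewrite (flux_out mi i0) -annE.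
have I3 : (\int[lam2]_w (c3 w)%:E = mass_in * W1%:E)%E by rewrite (flux_in mi i0) -annE.
(* On the support |z| < |x| both sums of indicators equal the indicator of |z| <= expR 1 and |x| >
   1. *)
have E : (\int[lam2]_w (c1 w)%:E + \int[lam2]_w (c2 w)%:E =
          \int[lam2]_w (c3 w)%:E + \int[lam2]_w (c4 w)%:E)%E.
  rewrite -(ge0_integralD _ measurableT (fun w _ => p1 w) m1 (fun w _ => p2 w) (m24 1)).
  rewrite -(ge0_integralD _ measurableT (fun w _ => p3 w) m3 (fun w _ => p4 w) (m24 (expR 1))).
  apply: eq_integral => w _; rewrite -!EFinD /c1 /c2 /c3 /c4 -!mulrDr; congr _%:E.
  rewrite /trunc_kernel; have [zx|_] := ltP (enorm w.2) (th * enorm w.1); last by rewrite mulr0n !mul0r.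
  have zx' : enorm w.2 < enorm w.1.
    by apply: lt_le_trans zx _; rewrite -[leRHS]mul1r ler_wpM2r ?enorm_ge0// ltW.
  congr (_ * _); rewrite !indicE -!natrM -!natrD; congr _%:R.
  rewrite !mulnb.
  have H1 : (w.2 \in ann 1 (expR 1)) = (1 < enorm w.2) && (enorm w.2 <= expR 1).
    by apply/idP/andP; rewrite inE.
  have H2 : (w.1 \in ann 1 (expR 1)) = (1 < enorm w.1) && (enorm w.1 <= expR 1).
    by apply/idP/andP; rewrite inE.
  rewrite H1 H2.
  have [a1|a1] := leP (enorm w.2) 1; have [a2|a2] := leP (enorm w.1) 1;
  have [a3|a3] := leP (enorm w.2) (expR 1); have [a4|a4] := leP (enorm w.1) (expR 1) => //=; exfalso; lra.
move: E; rewrite I1 I3.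
rewrite [X in (_ + X = _)%E](flux_through_sphere ltr01).
rewrite [X in (_ = _ + X)%E](flux_through_sphere (expR_gt0 1)).
have := flux_finite; have : (0 <= \int[lam]_w (W1 * log_density th w)%:E)%E.
  by apply: integral_ge0 => w _; rewrite lee_fin mulr_ge0 ?(ltW v0)// log_density_ge0// ltW.
have := mass_in_fin; move: mass_out_ge0 mass_in_ge0.
move: (\int[lam]_w _)%E mass_out mass_in => [m||] [a||] [b||]//.
(* The two fluxes are the same finite number and cancel; the masses remain, each multiplied by [W1]
   > 0. *)
- rewrite -!EFinM -!EFinD => _ _ _ _ _ [H]; congr _%:E.
  by apply: (mulIf (lt0r_neq0 v0)); move: H; lra.
- by rewrite gt0_mulye// => _ _ _ _ _.
Qed.

End flux.

Section flux_value.
Context {R : realType} (n : nat) (s al be h : R) (phi p : R -> R).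
Hypothesis W : weights n s al be h phi p.
Variables (xi : 'rV[R]_n -> R) (C C2 rho : R).
Hypothesis T : test_fun xi C C2 rho.
Local Notation lam := (@lam R n).
Local Notation riesz := (riesz s).
Local Notation wt := (wt s).
Implicit Types (x y z k : 'rV[R]_n).

Let n_gt0 := w_n W.
Let s01 := w_s W.
Let h01 := w_h W.
Let h0 : 0 < h. Proof. by case/andP : h01. Qed.
Let s0 : 0 < s. Proof. by case/andP : s01. Qed.
Let mxi d (U : measurableType d) (f : U -> 'rV[R]_n) : measurable_fun setT f ->
  measurable_fun setT (fun t => xi (f t)).
Proof.
by move=> mf; have H := measurableT_comp (lipschitz_measurable (t_C T) (t_lip T)) mf; exact: H.
Qed.

Local Notation lam2 := (lam \x lam)%E.
Local Notation trunc_kernel := (trunc_kernel s p).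
Local Notation trunc_pairing := (trunc_pairing s p xi).
Local Notation log_density := (log_density s p).
Local Notation core := (core s h p).

Let W1 := n%:R * fine (lam (cball 1)).

Section truncated.
Variable th : R.
Hypothesis th01 : 0 < th < 1.
Let th01' : 0 < th <= 1. Proof. by case/andP: th01 => -> /ltW. Qed.
Let mPT : measurable_fun setT (fun w : 'rV[R]_n * 'rV[R]_n => trunc_kernel th w.1 w.2).
Proof. by apply: (measurable_trunc_kernel W); [exact: measurable_fst|exact: measurable_snd]. Qed.

Lemma integrable2_ge0_fin (f : 'rV[R]_n * 'rV[R]_n -> R) : measurable_fun setT f ->
  (forall w, 0 <= f w) -> (\int[lam2]_w (f w)%:E < +oo)%E ->
  lam2.-integrable setT (fun w => (f w)%:E).
Proof.
move=> mf f0 ffin; apply/integrableP; split; first exact/measurable_EFinP.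
rewrite (_ : (\int[lam2]_w `|(f w)%:E| = \int[lam2]_w (f w)%:E)%E)//.
by apply: eq_integral => w _; rewrite gee0_abs// lee_fin.
Qed.

(** The terms with g w.2 and g w.1 have the same finite integral, because the two marginals of the
    truncated kernel agree. *)
Lemma balanced_flux (g : 'rV[R]_n -> R) : measurable_fun setT g -> (forall x, 0 <= g x) ->
  (\int[lam]_x (g x * enorm x `^ (- n%:R))%:E < +oo)%E ->
  lam2.-integrable setT (fun w => (trunc_kernel th w.1 w.2 * (g w.2 - g w.1))%:E) /\
  (\int[lam2]_w (trunc_kernel th w.1 w.2 * (g w.2 - g w.1))%:E = 0)%E.
Proof.
move=> mg g0 gfin.
have Gge0 : (0 <= \int[lam]_x (g x * enorm x `^ (- n%:R))%:E)%E.
  by apply: integral_ge0 => x _; rewrite lee_fin mulr_ge0 ?powR_ge0.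
have bfin := mass_in_fin W th01.
have bge0 := mass_in_ge0 n s p th.
have P0 (w : 'rV[R]_n * 'rV[R]_n) : 0 <= trunc_kernel th w.1 w.2 := trunc_kernel_ge0 W _ _ th01'.
have Eo := flux_out W th01 mg g0; rewrite (mass_out_eq_in W th01) in Eo.
have Ei := flux_in W th01 mg g0.
have prodfin : (mass_in n s p th * \int[lam]_x (g x * enorm x `^ (- n%:R))%:E < +oo)%E.
  by apply: lte_mul_pinfty => //; rewrite ge0_fin_numE.
have Io : lam2.-integrable setT (fun w => (trunc_kernel th w.1 w.2 * g w.2)%:E).
  apply: integrable2_ge0_fin.
  - apply: measurable_funM => //.
    by have H := measurableT_comp mg measurable_snd; exact: H.
  - by move=> w; rewrite mulr_ge0.
  - by rewrite Eo.
have Ii : lam2.-integrable setT (fun w => (trunc_kernel th w.1 w.2 * g w.1)%:E).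
  apply: integrable2_ge0_fin.
  - apply: measurable_funM => //.
    by have H := measurableT_comp mg measurable_fst; exact: H.
  - by move=> w; rewrite mulr_ge0.
  - by rewrite Ei.
have E w : ((trunc_kernel th w.1 w.2 * (g w.2 - g w.1))%:E = (trunc_kernel th w.1 w.2 * g w.2)%:E - (trunc_kernel th w.1 w.2 * g w.1)%:E)%E.
  by rewrite mulrBr EFinB.
split; first by apply: eq_integrable (integrableB measurableT Io Ii) => // w _; rewrite E.
under eq_integral do rewrite E.
rewrite (integralB measurableT Io Ii).
rewrite Eo Ei subee// ge0_fin_numE//.
by rewrite mule_ge0.
Qed.

Lemma trunc_pairing_truncated : (trunc_pairing th = (xi 0)%:E * \int[lam]_w (W1 * log_density th w)%:E)%E.
Proof.
have [M M0 zM] := test_minus_ball_min_powR n_gt0 (t_C T) (t_lip T) (t_rho T) (t_supp T) h01.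
pose zeta x := xi x - xi 0 * \1_(cball 1) x.
have mzeta : measurable_fun setT zeta.
  apply: measurable_funB; first exact: mxi.
  apply: measurable_funM => //; apply: measurable_indic.
  exact: measurable_cball.
(* The flux identities rest on Tonelli and apply to nonnegative functions, hence the positive and
   negative parts. *)
pose zp x := Num.max (zeta x) 0; pose zm x := Num.max (- zeta x) 0.
have zpm x : zeta x = zp x - zm x.
  rewrite /zp /zm; move: (zeta x) => t.
  by case: (leP t 0) => ?; case: (leP (- t) 0) => ?; lra.
have zp0 x : 0 <= zp x by rewrite le_max lexx orbT.
have zm0 x : 0 <= zm x by rewrite le_max lexx orbT.
have mzp : measurable_fun setT zp by exact: measurable_funrpos.
have mzm : measurable_fun setT zm by exact: measurable_funrneg.
have zpM x : zp x <= M * min_powR h (enorm x).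
  by rewrite ge_max (le_trans (ler_norm _) (zM x))/= (le_trans (normr_ge0 _) (zM x)).
have zmM x : zm x <= M * min_powR h (enorm x).
  rewrite ge_max (le_trans (normr_ge0 _) (zM x)) andbT.
  by apply: le_trans (zM x); rewrite -normrN; exact: ler_norm.
have fin (g : 'rV[R]_n -> R) : measurable_fun setT g -> (forall x, 0 <= g x) -> (forall x, g x <= M * min_powR h (enorm x)) ->
    (\int[lam]_x (g x * enorm x `^ (- n%:R))%:E < +oo)%E.
  move=> mg g0 gM.
  have mk : measurable_fun setT (fun x : 'rV[R]_n => (enorm x `^ (- n%:R) * min_powR h (enorm x))%:E).
    apply/measurable_EFinP; apply: measurable_funM; first exact: measurable_enorm_powR.
    by apply: measurable_min_powR; exact: measurable_enorm_id.
  have k0 (x : 'rV[R]_n) : setT x -> (0 <= (enorm x `^ (- n%:R) * min_powR h (enorm x))%:E)%E.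
    move=> _; rewrite lee_fin mulr_ge0 ?powR_ge0//.
    by rewrite /min_powR le_min !powR_ge0.
  apply: (@le_lt_trans _ _ (\int[lam]_x (M%:E * (enorm x `^ (- n%:R) * min_powR h (enorm x))%:E))%E).
    apply: ge0_le_integral.
    - exact: measurableT.
    - by move=> x _; rewrite lee_fin mulr_ge0 ?powR_ge0.
    - by apply/measurable_EFinP; apply: measurable_funM => //; exact: measurable_enorm_powR.
    - exact: measurable_funeM.
    - move=> x _; rewrite -EFinM lee_fin mulrCA mulrC; apply: ler_wpM2l => //; exact: powR_ge0.
  have M0e : (0 <= M%:E)%E by rewrite lee_fin.
  rewrite (ge0_integralZl _ measurableT mk k0 M0e).
  by apply: lte_mul_pinfty => //; exact: radial_min_powR_finite.
have [Ip Ep] := balanced_flux mzp zp0 (fin _ mzp zp0 zpM).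
have [Im Em] := balanced_flux mzm zm0 (fin _ mzm zm0 zmM).
have Es := flux_through_sphere W th01 ltr01.
have IS : lam2.-integrable setT (fun w =>
    (trunc_kernel th w.1 w.2 * ((enorm w.2 <= 1)%R%:R * (1 < enorm w.1)%R%:R))%:E).
  apply: integrable2_ge0_fin.
  - apply: measurable_funM => //.
    apply: measurable_funM.
      by apply: measurable_nat_ler => //; apply: measurable_enorm; exact: measurable_snd.
    by apply: measurable_nat_ltr => //; apply: measurable_enorm; exact: measurable_fst.
  - by move=> w; rewrite mulr_ge0 ?(trunc_kernel_ge0 W)// mulr_ge0.
  - by rewrite Es; exact: (flux_finite W th01).
have IS' := integrableZl measurableT (xi 0) IS.
have IB := integrableB measurableT Ip Im.
transitivity (\int[lam2]_w (((xi 0)%:E * (trunc_kernel th w.1 w.2 * ((enorm w.2 <= 1)%R%:R * (1 < enorm w.1)%R%:R))%:E)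
    + ((trunc_kernel th w.1 w.2 * (zp w.2 - zp w.1))%:E - (trunc_kernel th w.1 w.2 * (zm w.2 - zm w.1))%:E)))%E.
  apply: eq_integral => w _; rewrite -EFinM -EFinB -EFinD; congr _%:E.
  have -> : xi w.2 - xi w.1 = xi 0 * (\1_(cball 1) w.2 - \1_(cball 1) w.1) + ((zp w.2 - zp w.1) - (zm w.2 - zm w.1)).
    have e2 x : xi x = (zp x - zm x) + xi 0 * \1_(cball 1) x by rewrite -zpm /zeta subrK.
    rewrite [xi w.2]e2 [xi w.1]e2; move: (zp _) (zm _) (zp _) (zm _) (xi 0) (\1_(cball 1) w.1) (\1_(cball 1) w.2).
    by move=> A1 A2 A3 A4 A5 A6 A7; ring.
  rewrite mulrDr -mulrBr; congr (_ + _).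
  rewrite mulrCA; congr (_ * _).
  rewrite /trunc_kernel; have [zx|_] := ltP (enorm w.2) (th * enorm w.1); last by rewrite mulr0n !mul0r.
  have zx' : enorm w.2 < enorm w.1.
    apply: lt_le_trans zx _; rewrite -[leRHS]mul1r; apply: ler_wpM2r; first exact: enorm_ge0.
    by case/andP: th01'.
  congr (_ * _).
  have cE (x : 'rV[R]_n) : \1_(cball 1) x = (enorm x <= 1)%R%:R :> R.
    by rewrite indicE; congr (nat_of_bool _)%:R; apply/idP/idP; rewrite inE.
  rewrite !cE [(1 < _)%R]ltNge.
  have [a1|a1] := leP (enorm w.2) 1; have [a2|a2] := leP (enorm w.1) 1; rewrite /= ?(mulr0n, mulr1n, mul0r, mulr0, mulr1, subrr, subr0)//.
  (* The case left is |x| <= 1 < |z|, excluded by |z| < |x|. *)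
  exfalso; lra.
rewrite (integralD measurableT IS' IB) (integralB measurableT Ip Im) Ep Em subee// adde0.
by rewrite (integralZl measurableT IS) Es.
Qed.

End truncated.

(** Both sides of [trunc_pairing_truncated] survive th -> 1: the pairing through the difference of
    xi, the flux because - ln |w| vanishes on the unit sphere, which puts [log_density] below a
    multiple of [core]. *)
Lemma trunc_pairing1 : (trunc_pairing 1 = (xi 0)%:E * \int[lam]_w (W1 * log_density 1 w)%:E)%E.
Proof.
pose u (i : nat) : R := 1 - i.+2%:R^-1.
have u01 i : 0 < u i < 1.
  rewrite /u subr_gt0 gtrBl invr_gt0 ltr0n andbT.
  by rewrite invf_lt1 ?ltr0n// ltr1n.
have u01' i : 0 < u i <= 1 by case/andP: (u01 i) => -> /ltW.
have ucvg : u @ \oo --> (1 : R).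
  rewrite -[X in _ --> X]subr0; apply: cvgB; first exact: cvg_cst.
  have H := @cvg_harmonic R; rewrite -cvg_shiftS in H; exact: H.
have W10 : 0 <= W1 by rewrite mulr_ge0 ?fine_ge0.
have D1 := trunc_pairing_cvg W T u01' ucvg.
have Hc : lam.-integrable setT (fun w => (W1 * (h^-1 * core w))%:E).
  have H := integrable_ge0_fin (measurable_core W) (@core_ge0 R n s h p) (core_finite W).
  have H2 := integrableZl measurableT W1 (integrableZl measurableT h^-1 H).
  exact: H2.
have D2 : (\int[lam]_w (W1 * log_density (u i) w)%:E @[i --> \oo] --> \int[lam]_w (W1 * log_density 1 w)%:E)%E.
  have [] := @dominated_convergence _ _ _ lam setT measurableT
    (fun i w => (W1 * log_density (u i) w)%:E) (fun w => (W1 * log_density 1 w)%:E)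
    (fun w => (W1 * (h^-1 * core w))%:E) => //.
  - move=> i; apply/measurable_EFinP; apply: measurable_funM => //.
    exact: (measurable_log_density W).
  - by apply/measurable_EFinP; apply: measurable_funM => //; exact: (measurable_log_density W).
  - apply/aeW => w _; apply: cvg_near_cst.
    have [w1|w1] := ltP (enorm w) 1.
      have e0 : 0 < 1 - enorm w by rewrite subr_gt0.
      have Hu := (cvgrPdist_lt _ _).1 ucvg _ e0.
      near=> i; congr _%:E; congr (_ * _); rewrite /log_density /mass_density w1.
      have -> : enorm w < u i; last by [].
      have : `|1 - u i| < 1 - enorm w by near: i; exact: Hu.
      by move=> /(le_lt_trans (ler_norm _)); lra.
    near=> i; congr _%:E; congr (_ * _); rewrite /log_density /mass_density !ltNge w1.
    have -> : (u i <= enorm w); last by [].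
    by apply: le_trans w1; case/andP: (u01' i).
  - apply/aeW => w i _; rewrite /= lee_fin.
    have [_ ui1] := andP (u01' i).
    rewrite ger0_norm; first by apply: ler_wpM2l => //; exact: (log_density_le_core W).
    by apply: mulr_ge0 => //; exact: log_density_ge0.
have H1 := integrableZl measurableT W1 (log_density_integrable W (lexx 1)).
have F : (\int[lam]_w (W1 * log_density 1 w)%:E)%E \is a fin_num.
  by apply: integrable_fin_num => //; exact: H1.
have D3 : (trunc_pairing (u i) @[i --> \oo] --> (xi 0)%:E * \int[lam]_w (W1 * log_density 1 w)%:E)%E.
  under eq_fun do rewrite trunc_pairing_truncated//.
  by apply: cvgeZl.
by apply: cvg_unique D1 D3.
Unshelve. all: by end_near. Qed.

End flux_value.

(** * Layer-cake form of the normalization constant *)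

Section layers.
Context {R : realType}.

Lemma integral_inv (a : R) : 0 < a < 1 ->
  (\int[lebesgue_measure]_(t in `]a, 1%R[) (t^-1)%:E = (- ln a)%:E)%E.
Proof.
move=> /andP[a0 a1].
have ci x : x \in `[a, 1] -> {for x, continuous (fun t : R => t^-1)}.
  rewrite in_itv/= => /andP[ax _]; apply: inv_continuous.
  by rewrite gt_eqF// (lt_le_trans a0).
have cW : {within `[a, 1%R], continuous (fun t : R => t^-1)}.
  by apply: continuous_in_subspaceT => x; rewrite inE; exact: ci.
have D : derivable_oo_LRcontinuous (@ln R) a 1.
  split.
  - move=> x; rewrite in_itv/= => /andP[ax _].
    have x0 : 0 < x by exact: lt_trans ax.
    by have [] := is_derive1_ln x0.
  - by apply: cvg_at_right_filter; exact: continuous_ln.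
  - by apply: cvg_at_left_filter; exact: continuous_ln.
have mi : measurable_fun `]a, 1%R[ (fun t : R => (t^-1)%:E).
  apply/measurable_EFinP; apply: (@measurable_funS _ _ _ _ `[a, 1%R]) => //.
    by apply: subset_itvW.
  exact: subspace_continuous_measurable_fun.
rewrite -(integral_itv_bndoo true false mi) (continuous_FTC2 a1 cW D).
  by rewrite ln1 sub0e.
move=> x; rewrite in_itv/= => /andP[ax _].
have x0 : 0 < x by exact: lt_trans ax.
by rewrite derive1E; have [_ ->] := is_derive1_ln x0.
Qed.

Lemma integral_powRN1 (a : R) : 0 < a < 1 ->
  (\int[lebesgue_measure]_(t in `]a, 1%R[) (t `^ (- 1))%:E = (- ln a)%:E)%E.
Proof.
move=> a01; rewrite -integral_inv//; apply: eq_integral => t.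
rewrite inE/= in_itv/= => /andP[at_ _]; rewrite powR_inv1//.
by rewrite ltW// (lt_trans _ at_)//; case/andP: a01.
Qed.

End layers.


Section layer_cake.
Context {R : realType} (n : nat) (s al be h : R) (phi p : R -> R).
Hypothesis W : weights n s al be h phi p.
Local Notation lam := (@lam R n).
Local Notation riesz := (riesz s).
Local Notation mass_density := (mass_density s p).
Local Notation log_density := (log_density s p).
Local Notation mu := (@lebesgue_measure R).

(** The integrand of the normalization constant and the profile [p] may have different default
    values at the origin, so they are compared almost everywhere. *)
Lemma integral_eball (f : 'rV[R]_n -> R) t : measurable_fun setT f -> t <= 1 ->
  (forall z, 0 < enorm z < 1 -> f z = `|p (enorm z)| * riesz (e1 n - z)) ->
  (\int[lam]_(z in eball 0 t) (f z)%:E = \int[lam]_z (mass_density t z)%:E)%E.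
Proof.
move=> mf t1 fE.
have meb : measurable (eball (0 : 'rV[R]_n) t).
  rewrite (_ : eball _ _ = [set z | enorm z < t]).
    by apply: measurable_ltr_set => //; exact: measurable_enorm_id.
  by apply/seteqP; split => z /=; rewrite /eball/= subr0.
rewrite integral_mkcond; apply: ae_eq_integral => //.
- by apply/(measurable_restrictT _ meb)/measurable_EFinP; apply: measurable_funTS.
- by apply/measurable_EFinP; exact: (measurable_mass_density W).
exists [set 0]; split.
  exact: measurable_origin.
  exact: lam_set0 (w_n W).
move=> z /= /not_implyP[_ zN]; apply/eqP/negP => /negP z0; apply: zN.
have zE : (z \in eball 0 t) = (enorm z < t).
  by apply/idP/idP; rewrite inE /eball/= subr0.
rewrite patchE /mass_density zE; have [zt|_] := ltP (enorm z) t; last by rewrite mul0r.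
by rewrite mul1r fE// enorm_gt0 z0 (lt_le_trans zt).
Qed.

(** In [mass_density t z] the parameter [t] occurs only in the indicator of |z| < t, so Tonelli
    leaves the integral of 1/t over |z| < t < 1. *)
Lemma layer_cake : (\int[mu]_(t in `]0%R, 1%R[) ((t^-1)%:E * \int[lam]_z (mass_density t z)%:E) =
  \int[lam]_z (log_density 1 z)%:E)%E.
Proof.
pose G (w : R * 'rV[R]_n) : R := (0 < w.1)%R%:R * (w.1 < 1)%R%:R * w.1 `^ (- 1) * mass_density w.1 w.2.
have mG : measurable_fun setT (fun w : measurableTypeR R * 'rV[R]_n => (G w)%:E).
  apply/measurable_EFinP; apply: measurable_funM.
    apply: measurable_funM; last by apply: measurable_fun_powR; exact: measurable_fst.
    by apply: measurable_funM; apply: measurable_nat_ltr.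
  apply: measurable_funM.
    by apply: measurable_nat_ltr => //; apply: measurable_enorm; exact: measurable_snd.
  have H := measurableT_comp (f := fun z : 'rV[R]_n => `|p (enorm z)| * riesz (e1 n - z)) _ measurable_snd.
  apply: H; apply: measurable_funM; first by apply: (mp_comp W); exact: measurable_enorm_id.
  by apply: measurable_riesz; exact: measurable_rV_sub.
have G0 w : (0 <= (G w)%:E)%E.
  rewrite lee_fin /G; apply: mulr_ge0; last exact: mass_density_ge0.
  by have [w0|w0] := ltP 0 w.1; rewrite ?mul0r// mul1r mulr_ge0// powR_ge0.
rewrite integral_mkcond; transitivity (\int[mu]_t \int[lam]_z (G (t, z))%:E)%E.
  apply: eq_integral => t _; rewrite patchE; case: ifPn.
    rewrite inE/= in_itv/= => /andP[t0 t1].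
    rewrite /G/= t0 t1 -powR_inv1 ?(ltW t0)//.
    under [RHS]eq_integral do rewrite !mul1r EFinM.
    rewrite ge0_integralZl//.
    - by apply/measurable_EFinP; exact: (measurable_mass_density W).
    - by move=> z _; rewrite lee_fin mass_density_ge0.
    - by rewrite lee_fin powR_ge0.
  move=> tN; rewrite integral0_eq// => z _; rewrite /G/= -natrM mulnb.
  rewrite (_ : (0 < t) && (t < 1) = false) ?mul0r//.
  by apply/negP => t01; move/negP: tN; apply; rewrite inE/= in_itv.
rewrite (fubini_tonelli (m1 := mu) (m2 := lam) _ mG G0); apply: eq_integral => z _.
have [z0|z0] := eqVneq z 0.
  rewrite integral0_eq; first by rewrite /log_density /mass_density z0 enorm0 (w_p0 W) normr0 !(mul0r, mulr0).
  by move=> x _; rewrite /G/= /mass_density z0 enorm0 (w_p0 W) normr0 !(mul0r, mulr0).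
have [z1|z1] := ltP (enorm z) 1; last first.
  rewrite integral0_eq; first by rewrite /log_density /mass_density [enorm z < 1]ltNge z1 mulr0n !(mul0r, mulr0).
  move=> t _; rewrite /G/= /mass_density; have [zt|_] := ltP (enorm z) t; last by rewrite !(mul0r, mulr0).
  by rewrite [t < 1]ltNge (ltW (le_lt_trans z1 zt)) !(mulr0, mul0r).
have z0' : 0 < enorm z by rewrite enorm_gt0.
have k0 : 0 <= `|p (enorm z)| * riesz (e1 n - z) by rewrite mulr_ge0 ?riesz_ge0.
transitivity ((`|p (enorm z)| * riesz (e1 n - z))%:E * \int[mu]_(t in `](enorm z), 1%R[) (t `^ (- 1))%:E)%E.
  rewrite -ge0_integralZl//.
  - rewrite [RHS]integral_mkcond; apply: eq_integral => t _; rewrite patchE; case: ifPn.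
      rewrite inE/= in_itv/= => /andP[zt t1]; rewrite /G/= /mass_density zt t1 (lt_trans z0' zt).
      by rewrite !mul1r mulrC EFinM.
    move=> tN; rewrite /G/= /mass_density; have [zt|_] := ltP (enorm z) t; last by rewrite mul0r mulr0.
    have [t1|_] := ltP t 1; last by rewrite !(mulr0, mul0r).
    by exfalso; move/negP: tN; apply; rewrite inE/= in_itv/= zt.
  - by apply/measurable_EFinP; apply: measurable_funTS; exact: measurable_fun_powR.
  - by move=> t _; rewrite lee_fin powR_ge0.
rewrite integral_powRN1 ?z0'// -EFinM /log_density /mass_density z1 mul1r//.
Qed.

End layer_cake.

(** * The Gamma function *)

Section gamma_integral.
Context {R : realType}.
Local Notation mu := (@lebesgue_measure R).
Implicit Types x t u : R.

Lemma integral_expN u : (\int[mu]_(t in `]u, +oo[) (expR (- t))%:E = (expR (- u))%:E)%E.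
Proof.
have ce : continuous (fun t : R => expR (- t)).
  by move=> t; apply: continuous_comp; [exact: opp_continuous|exact: continuous_expR].
have D t : is_derive t 1 (fun t : R => - expR (- t)) (expR (- t)).
  by apply: is_derive_eq; rewrite mulrN1 opprK.
have mf : measurable_fun setT (fun t : R => expR (- t)) by exact: continuous_measurable_fun.
rewrite integral_itv_obnd_cbnd; last by apply/measurable_EFinP; exact: measurable_funTS.
rewrite (@ge0_continuous_FTC2y _ _ (fun t => - expR (- t)) u 0).
- by rewrite sub0e -EFinN opprK.
- by move=> t _; exact: expR_ge0.
- exact: continuous_subspaceT.
- by rewrite -oppr0; apply: cvgN; exact: cvgr_expR.
- by move=> t _; have [] := D t.
- by apply: cvg_at_right_filter; apply: cvgN; exact: ce.
- by move=> t _; rewrite derive1E; have [_ ->] := D t.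
Qed.

(** For x < 1 the integrand is unbounded at 0, so the fundamental theorem is applied on [t/(k+2), t]
    and the intervals increase to the whole. *)
Lemma integral_powRB1 x t : 0 < x -> 0 < t ->
  (\int[mu]_(u in `]0%R, t]) (u `^ (x - 1))%:E = (x^-1 * t `^ x)%:E)%E.
Proof.
move=> x0 t0.
pose F k : set R := `[t / k.+2%:R, t]%classic.
have m k (A : set R) : measurable A -> measurable_fun A (fun u : R => (u `^ k)%:E).
  by move=> mA; apply/measurable_EFinP; apply: measurable_funTS; exact: measurable_powR.
have FE : \bigcup_k F k = `]0, t]%classic.
  apply/seteqP; split => u /=.
    move=> [k _]; rewrite /F/= !in_itv/= => /andP[ku ->]; rewrite andbT.
    by apply: lt_le_trans ku; rewrite divr_gt0.
  rewrite in_itv/= => /andP[u0 ut]; exists (Num.truncn (t / u)) => //.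
  rewrite /F/= in_itv/= ut andbT ler_pdivrMr// mulrC -ler_pdivrMr//.
  by apply: ltW; apply: (lt_trans (truncnS_gt _)); rewrite ltr_nat.
have Fk k : (\int[mu]_(u in F k) (u `^ (x - 1))%:E = (x^-1 * t `^ x)%:E - (x^-1 * (t / k.+2%:R) `^ x)%:E)%E.
  have a0 : 0 < t / k.+2%:R by rewrite divr_gt0.
  have D u : 0 < u -> is_derive u 1 (fun u : R => x^-1 * u `^ x) (u `^ (x - 1)).
    move=> u0; have H := is_derive1_powR x u0.
    by apply: is_derive_eq; rewrite /GRing.scale/= mulrA mulVf ?mul1r ?gt_eqF.
  have c k' u : 0 < u -> {for u, continuous (fun u : R => u `^ k')}.
    move=> u0; apply: differentiable_continuous; apply/derivable1_diffP.
    by apply: derivable_powR; rewrite in_itv/= u0.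
  apply: (@continuous_FTC2 _ (fun u => u `^ (x - 1)) (fun u => x^-1 * u `^ x)).
  - by rewrite ltr_pdivrMr// -[ltLHS]mulr1 ltr_pM2l// ltr1n.
  - apply: continuous_in_subspaceT => u; rewrite inE/= in_itv/= => /andP[au _].
    exact/c/(lt_le_trans a0 au).
  - split.
    + move=> u; rewrite in_itv/= => /andP[au _].
      by have [] := D _ (lt_trans a0 au).
    + apply: cvg_at_right_filter; apply: cvgM; first exact: cvg_cst.
      exact: c.
    + apply: cvg_at_left_filter; apply: cvgM; first exact: cvg_cst.
      exact: c.
  - move=> u; rewrite in_itv/= => /andP[au _]; rewrite derive1E.
    by have [_ ->] := D _ (lt_trans a0 au).
have H : (\int[mu]_(u in F k) (u `^ (x - 1))%:E @[k --> \oo] --> \int[mu]_(u in \bigcup_k F k) (u `^ (x - 1))%:E)%E.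
  apply: ge0_nondecreasing_set_cvg_integral.
  - move=> i j ij; apply/subsetPset; apply: subset_itvr.
    rewrite bnd_simp ler_pM2l// lef_pV2 ?posrE//.
    by rewrite ler_nat.
  - by move=> k; exact: measurable_itv.
  - by move=> k; apply: m; exact: measurable_itv.
  - by move=> k u _; rewrite lee_fin powR_ge0.
rewrite FE in H.
suff H2 : (\int[mu]_(u in F k) (u `^ (x - 1))%:E @[k --> \oo] --> (x^-1 * t `^ x)%:E)%E.
  by apply: cvg_unique H H2.
rewrite (_ : (fun k => _) = (fun k => (x^-1 * t `^ x - x^-1 * (t / k.+2%:R) `^ x)%:E)); last first.
  by apply/funext => k; rewrite Fk -EFinB.
apply: cvg_EFin; first exact: nearW.
rewrite -[X in _ --> X]subr0; apply: cvgB; first exact: cvg_cst.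
rewrite -(mulr0 x^-1); apply: cvgM; first exact: cvg_cst.
have /(_ (fun k => t / k.+2%:R)) := (cvg_at_rightP (fun u : R => u `^ x) 0 0).1 (powR_cvg0 x0).
apply.
split; first by move=> k; rewrite divr_gt0.
rewrite -(mulr0 t); apply: cvgM; first exact: cvg_cst.
by have H2 := @cvg_harmonic R; rewrite -cvg_shiftS in H2; exact: H2.
Qed.

End gamma_integral.

Lemma integral_gt0 d (T : measurableType d) (R : realType) (m : {measure set T -> \bar R})
    (D : set T) (f : T -> R) :
  measurable D -> measurable_fun D f -> (0 < m D)%E -> (forall x, D x -> 0 < f x) ->
  (0 < \int[m]_(x in D) (f x)%:E)%E.
Proof.
move=> mD mf D0 f0; rewrite lt0e integral_ge0 ?andbT; last first.
  by move=> x Dx; rewrite lee_fin ltW// f0.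
apply/negP => /eqP I0.
have mf' : measurable_fun D (fun x => (f x)%:E) by exact/measurable_EFinP.
have [] := (ae_eq_integral_abs m mD mf').1.
  rewrite -I0; apply: eq_integral => x; rewrite inE => Dx.
  by rewrite gee0_abs// lee_fin ltW// f0.
move=> A [mA A0 sA].
suff : (m D <= m A)%E by rewrite A0 leNgt D0.
apply: le_measure; rewrite ?inE// => x Dx; apply: sA => /= /(_ Dx) [fx].
by have := f0 _ Dx; rewrite fx ltxx.
Qed.

Section gamma_integral.
Context {R : realType}.
Local Notation mu := (@lebesgue_measure R).
Implicit Types x t u : R.

Definition gammae x : \bar R := (\int[mu]_(t in `]0%R, +oo[) (t `^ (x - 1) * expR (- t))%:E)%E.

Lemma measurable_gamma_integrand x : measurable_fun setT (fun t => t `^ (x - 1) * expR (- t)).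
Proof.
apply: measurable_funM; first exact: measurable_powR.
by have H := measurableT_comp (@measurable_expR R) (@oppr_measurable R setT); exact: H.
Qed.

Lemma gamma_integrand_ge0 x t : 0 <= t `^ (x - 1) * expR (- t).
Proof. by rewrite mulr_ge0 ?powR_ge0 ?expR_ge0. Qed.

Lemma gammae_ge0 x : (0 <= gammae x)%E.
Proof. by apply: integral_ge0 => t _; rewrite lee_fin gamma_integrand_ge0. Qed.

(* Tonelli for [u^(x-1) exp(-t)] on [0 < u < t]. *)
Lemma gammaeD1 x : 0 < x -> gammae (x + 1) = (x%:E * gammae x)%E.
Proof.
move=> x0.
pose G (w : R * R) : R := (0 < w.2)%R%:R * (w.2 < w.1)%R%:R * (w.2 `^ (x - 1) * expR (- w.1)).
have mG : measurable_fun setT (fun w : measurableTypeR R * measurableTypeR R => (G w)%:E).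
  apply/measurable_EFinP; apply: measurable_funM.
    by apply: measurable_funM; apply: measurable_nat_ltr.
  apply: measurable_funM; first by apply: measurable_fun_powR; exact: measurable_snd.
  have H := measurableT_comp (@measurable_expR R) (measurableT_comp (@oppr_measurable R setT) measurable_fst).
  exact: H.
have G0 w : (0 <= (G w)%:E)%E by rewrite lee_fin /G !mulr_ge0 ?powR_ge0 ?expR_ge0.
have := fubini_tonelli (m1 := mu) (m2 := mu) _ mG G0.
have -> : (\int[mu]_t \int[mu]_u (G (t, u))%:E = x^-1%:E * gammae (x + 1))%E.
  rewrite /gammae -ge0_integralZl//; last 3 first.
  - by apply/measurable_EFinP; apply: measurable_funTS; exact: measurable_gamma_integrand.
  - by move=> t _; rewrite lee_fin gamma_integrand_ge0.
  - by rewrite lee_fin invr_ge0 ltW.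
  rewrite [RHS]integral_mkcond; apply: eq_integral => t _; rewrite patchE.
  have -> : (t \in `]0%R, +oo[%classic) = (0 < t) by apply/idP/idP; rewrite inE/= in_itv/= andbT.
  have [t0|t0] := ltP 0 t; last first.
    rewrite integral0_eq// => u _; rewrite /G/=.
    have [u0|_] := ltP 0 u; last by rewrite !mul0r.
    by rewrite [u < t]ltNge (ltW (le_lt_trans t0 u0)) mulr0 mul0r.
  rewrite addrK -EFinM mulrA EFinM -integral_powRB1// -ge0_integralZr//; last 2 first.
  - by apply/measurable_EFinP; apply: measurable_funTS; exact: measurable_powR.
  - by move=> u _; rewrite lee_fin powR_ge0.
  have mr : measurable_fun (`]0, t[%classic : set R) (fun u => (u `^ (x - 1) * expR (- t))%:E).
    by apply/measurable_EFinP; apply: measurable_funTS; apply: measurable_funM => //; exact: measurable_powR.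
  under [RHS]eq_integral do rewrite -EFinM.
  rewrite -(integral_itv_bndo_bndc mr) [RHS]integral_mkcond; apply: eq_integral => u _; rewrite patchE.
  have -> : (u \in `]0%R, t[%classic) = (0 < u) && (u < t) by apply/idP/idP; rewrite inE/= in_itv.
  by rewrite /G/=; case: (0 < u); case: (u < t); rewrite ?(mul0r, mulr0, mul1r) ?EFinM.
have -> : (\int[mu]_u \int[mu]_t (G (t, u))%:E = gammae x)%E.
  rewrite /gammae [RHS]integral_mkcond; apply: eq_integral => u _; rewrite patchE.
  have -> : (u \in `]0%R, +oo[%classic) = (0 < u) by apply/idP/idP; rewrite inE/= in_itv/= andbT.
  have [u0|u0] := ltP 0 u; last first.
    by rewrite integral0_eq// => t _; rewrite /G/= [0 < u]ltNge u0 !mul0r.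
  rewrite EFinM -integral_expN -ge0_integralZl//; last 2 first.
  - apply/measurable_EFinP; apply: measurable_funTS.
    by have H := measurableT_comp (@measurable_expR R) (@oppr_measurable R setT); exact: H.
  - by rewrite lee_fin powR_ge0.
  rewrite [RHS]integral_mkcond; apply: eq_integral => t _; rewrite patchE.
  have -> : (t \in `]u, +oo[%classic) = (u < t) by apply/idP/idP; rewrite inE/= in_itv/= andbT.
  by rewrite /G/= u0; case: (u < t); rewrite ?(mul0r, mulr0, mul1r) ?EFinM.
move=> <-; rewrite muleA -EFinM mulfV ?mul1e// gt_eqF//.
Qed.

Lemma gammae1 : gammae 1 = 1%E.
Proof.
transitivity (\int[mu]_(t in `]0%R, +oo[) (expR (- t))%:E)%E.
  by apply: eq_integral => t _; rewrite subrr powRr0 mul1r.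
by rewrite integral_expN oppr0 expR0.
Qed.

Lemma gammae_nat k : gammae k.+1%:R = (k`!%:R)%:E.
Proof.
elim: k => [|k IH]; first exact: gammae1.
rewrite -[k.+2%:R]natr1 gammaeD1// IH -EFinM factS natrM//.
Qed.

(** The functional equation reduces finiteness at x to finiteness at x + 1; there t^x <= 1 + t^k
    with k >= x leaves the integrals at 1 and at k + 1, and the latter is k!. *)
Lemma gammae_fin x : 0 < x -> (gammae x < +oo)%E.
Proof.
move=> x0; suff H : (gammae (x + 1) < +oo)%E.
  have := gammaeD1 x0; move: H; have := gammae_ge0 x; case: (gammae x) => [r _ _ _|_ H E|//].
    exact: ltry.
  by move: H; rewrite E gt0_muley ?lte_fin.
have [k xk] : exists k, x <= k%:R by exists (Num.truncn x).+1; exact/ltW/truncnS_gt.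
have mgi (y : R) : measurable_fun (`]0, +oo[%classic : set R) (fun t => (t `^ (y - 1) * expR (- t))%:E).
  by apply/measurable_EFinP; apply: measurable_funTS; exact: measurable_gamma_integrand.
apply: (@le_lt_trans _ _ (gammae 1 + gammae k.+1%:R)%E); last first.
  by rewrite gammae1 gammae_nat -EFinD ltry.
have mD : measurable (`]0, +oo[%classic : set R) by exact: measurable_itv.
have gi0 (y t : R) : (`]0, +oo[%classic : set R) t -> (0 <= (t `^ (y - 1) * expR (- t))%:E)%E.
  by move=> _; rewrite lee_fin gamma_integrand_ge0.
rewrite /gammae -(ge0_integralD mu mD (gi0 1) (mgi 1) (gi0 k.+1%:R) (mgi k.+1%:R)).
apply: (ge0_le_integral mu mD (gi0 (x + 1)) (mgi (x + 1))).
- exact: emeasurable_funD (mgi 1) (mgi k.+1%:R).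
move=> t; rewrite /= in_itv/= andbT => t0.
rewrite -EFinD lee_fin -mulrDl; apply: ler_wpM2r; first exact: expR_ge0.
rewrite subrr powRr0 addrK -natr1 addrK.
have [t1|t1] := leP t 1.
  rewrite -[leLHS]addr0; apply: lerD; last exact: powR_ge0.
  by apply: powR_le1; rewrite ?t0 ?t1 ?(ltW x0).
rewrite -[leLHS]add0r; apply: lerD => //.
by apply: ler_powR => //; exact: ltW.
Qed.

Lemma gammae_gt0 x : (0 < gammae x)%E.
Proof.
apply: integral_gt0 => //.
- by apply: measurable_funTS; exact: measurable_gamma_integrand.
- by rewrite [X in (0 < X)%E](lebesgue_measure_itv `]0, +oo[) /= ltry addye ?lt0y.
- by move=> t /=; rewrite in_itv/= andbT => t0; rewrite mulr_gt0 ?powR_gt0 ?expR_gt0.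
Qed.

Lemma gamma_integralE x : gamma_integral x = fine (gammae x).
Proof. by []. Qed.

Lemma EFin_gamma_integral x : 0 < x -> (gamma_integral x)%:E = gammae x.
Proof.
move=> x0; rewrite gamma_integralE fineK// ge0_fin_numE ?gammae_ge0//.
exact: gammae_fin.
Qed.

Lemma gamma_integral_gt0 x : 0 < x -> 0 < gamma_integral x.
Proof. by move=> x0; rewrite -lte_fin EFin_gamma_integral// gammae_gt0. Qed.

Lemma gamma_integralD1 x : 0 < x -> gamma_integral (x + 1) = x * gamma_integral x.
Proof.
move=> x0; apply: EFin_inj; rewrite EFinM !EFin_gamma_integral ?gammaeD1//.
by rewrite addr_gt0.
Qed.

Lemma powRB1 x s : 0 < x -> x `^ (s - 1) = x `^ s / x.
Proof.
move=> x0; apply: (mulIf (lt0r_neq0 x0)); rewrite divfK ?gt_eqF//.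
by rewrite -[X in _ * X](powRr1 (ltW x0)) -powRDg// subrK.
Qed.

(** The concave function t^s lies below its tangent at t = x. *)
Lemma young_tangent t x s : 0 < t -> 0 < x -> 0 < s < 1 ->
  t `^ s <= (1 - s) * x `^ s + s * x `^ (s - 1) * t.
Proof.
move=> t0 x0 /andP[s0 s1].
have s1' : 0 < 1 - s by rewrite subr_gt0.
have tx : 0 < t / x by rewrite divr_gt0.
have := @conjugate_powR R ((t / x) `^ s) 1 s^-1 (1 - s)^-1 (powR_ge0 _ _) ler01.
rewrite !invr_gt0 !invrK => /(_ s0 s1').
rewrite addrC subrK => /(_ erefl).
rewrite powR1 mul1r mulr1 -powRrM mulfV ?gt_eqF// powRr1 ?(ltW tx)// => H.
have -> : t `^ s = x `^ s * (t / x) `^ s.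
  by rewrite -powRM ?(ltW x0) ?(ltW tx)// mulrC divfK// gt_eqF.
have -> : (1 - s) * x `^ s + s * x `^ (s - 1) * t = x `^ s * (t / x * s + (1 - s)).
  rewrite powRB1//.
  by field; rewrite gt_eqF.
by apply: ler_wpM2l; first exact: powR_ge0.
Qed.

(** Integrate the tangent bound against t^(x-1) exp(-t). Since Gamma(x + 1) = x Gamma(x), the two
    terms add up to x^s Gamma(x) exactly when the tangent is taken at t = x. *)
Lemma gamma_integral_shift_le x s : 0 < x -> 0 < s < 1 ->
  gamma_integral (x + s) <= x `^ s * gamma_integral x.
Proof.
move=> x0 s01; have [s0 s1] := andP s01.
have xs0 : 0 < x + s by rewrite addr_gt0.
have mgi (y : R) : measurable_fun (`]0, +oo[%classic : set R) (fun t => (t `^ (y - 1) * expR (- t))%:E).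
  by apply/measurable_EFinP; apply: measurable_funTS; exact: measurable_gamma_integrand.
have c1 : 0 <= (1 - s) * x `^ s by rewrite mulr_ge0 ?powR_ge0// subr_ge0 ltW.
have c2 : 0 <= s * x `^ (s - 1) by rewrite mulr_ge0 ?powR_ge0// ltW.
suff : (gammae (x + s) <= ((1 - s) * x `^ s)%:E * gammae x + (s * x `^ (s - 1))%:E * gammae (x + 1))%E.
  rewrite gammaeD1// -!EFin_gamma_integral// -!EFinM -EFinD lee_fin.
  move=> /le_trans; apply; rewrite le_eqVlt; apply/orP; left; apply/eqP.
  rewrite powRB1//.
  by field; rewrite gt_eqF.
have mD : measurable (`]0, +oo[%classic : set R) by exact: measurable_itv.
have gi0 (y t : R) : (`]0, +oo[%classic : set R) t -> (0 <= (t `^ (y - 1) * expR (- t))%:E)%E.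
  by move=> _; rewrite lee_fin gamma_integrand_ge0.
have cgi0 (c y t : R) : 0 <= c -> (`]0, +oo[%classic : set R) t -> (0 <= c%:E * (t `^ (y - 1) * expR (- t))%:E)%E.
  by move=> c0 t0; rewrite mule_ge0 ?gi0.
have cmgi (c y : R) : measurable_fun (`]0, +oo[%classic : set R) (fun t => c%:E * (t `^ (y - 1) * expR (- t))%:E)%E.
  exact: measurable_funeM.
rewrite /gammae -(ge0_integralZl mu mD (mgi x) (gi0 x)) ?lee_fin//.
rewrite -(ge0_integralZl mu mD (mgi (x + 1)) (gi0 (x + 1))) ?lee_fin//.
rewrite -(ge0_integralD mu mD (fun t => cgi0 _ x t c1) (cmgi _ x) (fun t => cgi0 _ (x + 1) t c2) (cmgi _ (x + 1))).
apply: (ge0_le_integral mu mD (gi0 (x + s)) (mgi (x + s))).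
- exact: emeasurable_funD (cmgi _ x) (cmgi _ (x + 1)).
move=> t; rewrite /= in_itv/= andbT => t0.
rewrite -!EFinM -EFinD lee_fin !mulrA -mulrDl; apply: ler_wpM2r; first exact: expR_ge0.
have := young_tangent t0 x0 s01; move=> H.
have -> : x + s - 1 = (x - 1) + s by ring.
have -> : x + 1 - 1 = (x - 1) + 1 by ring.
rewrite (powRDg (x - 1) s t0) (powRDg (x - 1) 1 t0) [t `^ 1]powRr1 ?(ltW t0)//.
rewrite [leRHS](_ : _ = t `^ (x - 1) * ((1 - s) * x `^ s + s * x `^ (s - 1) * t)); last ring.
by apply: ler_wpM2l; first exact: powR_ge0.
Qed.

End gamma_integral.

(* [u / v] is nondecreasing and its limit is at most [1]. *)
Lemma ratio_limit_le {R : realType} (u v : nat -> R) :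
  (forall k, 0 < u k) -> (forall k, 0 < v k) ->
  (forall k, u k * v k.+1 <= v k * u k.+1) ->
  (forall k, (k%:R / k.+1%:R) ^+ 2 * u k.+1 <= v k.+1) -> u 0%N <= v 0%N.
Proof.
move=> u0 v0 uv lim.
have mono k : u 0%N / v 0%N <= u k / v k.
  elim: k => // k IH; apply: (le_trans IH).
  by rewrite ler_pdivrMr// mulrAC ler_pdivlMr// [leRHS]mulrC.
have B (k : nat) : (k%:R / k.+1%:R) ^+ 2 * (u 0%N / v 0%N) <= 1.
  apply: (@le_trans _ _ ((k%:R / k.+1%:R) ^+ 2 * (u k.+1 / v k.+1))).
    by apply: ler_wpM2l; [rewrite sqr_ge0|exact: mono].
  by rewrite mulrA ler_pdivrMr// mul1r.
rewrite -[leRHS]mul1r -ler_pdivrMr//; set r := u 0%N / v 0%N in B *.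
rewrite leNgt; apply/negP => r1.
have r0 : 0 < r by rewrite (lt_trans _ r1).
have d0 : 0 < r - 1 by rewrite subr_gt0.
(* With e = 1/(m+1) this choice gives 2 r e < r - 1, hence (1 - e)^2 r >= r - 2 r e > 1, against the
   bound at [m]. *)
pose m := (Num.truncn (2 * r / (r - 1))).+1.
have mlt : 2 * r / (r - 1) < m%:R by exact: truncnS_gt.
have m0 : (0 : R) < m.+1%:R by [].
have := B m; rewrite leNgt => /negP; apply.
have -> : m%:R / m.+1%:R = 1 - m.+1%:R^-1 :> R.
  by rewrite -natr1; field; rewrite natr1 gt_eqF.
have : 2 * r / m.+1%:R < r - 1.
  rewrite ltr_pdivrMr// [ltRHS]mulrC -ltr_pdivrMr//; apply: (lt_trans mlt).
  by rewrite ltr_nat.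
have : 0 <= r * m.+1%:R^-1 ^+ 2 by rewrite mulr_ge0 ?sqr_ge0// ltW.
move: (m.+1%:R^-1) => e; nra.
Qed.

(** A product of two Gamma quotients can be negative, so no single factorization compares two of
    them. For p' <= 0 the one with the decreasing factor [q] decides, for p' > 0 the one with the
    increasing factor [w]. *)
Lemma compare_factorizations {R : realFieldType} (p p' f f' w w' q q' : R) :
  0 < w -> w <= w' -> 0 < q' -> q' <= q -> p < p' -> f < f' -> (0 < p' -> 0 <= f') ->
  p * q = f * w -> p' * q' = f' * w' -> f * w < f' * w'.
Proof.
move=> w0 ww q0' qq pp ff F E E'; have q0 : 0 < q by exact: lt_le_trans qq.
have [P'0|P'0] := leP p' 0.
  rewrite -E -E'; apply: (@le_lt_trans _ _ (p * q')); last by rewrite ltr_pM2r.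
  by apply: ler_wnM2l => //; rewrite (le_trans (ltW pp)).
apply: (@lt_le_trans _ _ (f' * w)); first by rewrite ltr_pM2r.
by apply: ler_wpM2l => //; exact: F.
Qed.

Section gamma_ratio.
Context {R : realType} (s : R).
Hypothesis s01 : 0 < s < 1.
Let s0 : 0 < s. Proof. by case/andP: s01. Qed.
Let s1 : s < 1. Proof. by case/andP: s01. Qed.
Local Notation ga := (@gamma_integral R).
Implicit Types x a b : R.

Lemma Gamma_gt0E x : 0 < x -> Gamma x = ga x.
Proof. by rewrite /Gamma => ->. Qed.

(** One formula across the pole at 0, where both sides vanish. *)
Lemma Gamma_inv x : -1 < x -> (Gamma x)^-1 = x / ga (x + 1).
Proof.
move=> x1; have [x0|x0] := ltP 0 x.
  rewrite Gamma_gt0E// gamma_integralD1// invfM mulrA mulfV ?mul1r// gt_eqF//.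
rewrite /Gamma ltNge x0 /=.
have -> : Num.truncn (- x) = 0%N.
  by apply: truncn_def; rewrite oppr_ge0 x0 /= ltrNl x1.
by rewrite big_ord1 addr0 invf_div.
Qed.

(* [gamma_quo x] is [Gamma (x + s) / Gamma x] for all [x > - s], with [1 / Gamma = 0] at the poles. *)
Definition gamma_quo1 x := ga (x + s) / ga (x + 1).
Definition gamma_quo x := x * gamma_quo1 x.

Lemma gamma_quo1_gt0 x : - s < x -> 0 < gamma_quo1 x.
Proof.
move=> xs; have h0 := s0; have h1 := s1; rewrite divr_gt0// gamma_integral_gt0//; lra.
Qed.

Lemma gamma_quo1D1 x : - s < x -> gamma_quo1 (x + 1) = gamma_quo1 x * ((x + s) / (x + 1)).
Proof.
move=> xs; have h0 := s0; have h1 := s1.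
have a0 : 0 < x + s by lra.
have b0 : 0 < x + 1 by lra.
rewrite /gamma_quo1 (_ : x + 1 + s = x + s + 1); last by rewrite addrAC.
rewrite (gamma_integralD1 a0) (gamma_integralD1 b0).
have G := gamma_integral_gt0 b0; move: (ga (x + s)) (ga (x + 1)) G => A B B0.
by field; rewrite !gt_eqF.
Qed.

Lemma gamma_quoD1 x : 0 < x -> gamma_quo (x + 1) = gamma_quo x * ((x + s) / x).
Proof.
move=> x0; have h0 := s0; rewrite /gamma_quo gamma_quo1D1; last by lra.
have b0 : 0 < x + 1 by lra.
by field; rewrite !gt_eqF.
Qed.

Lemma gamma_quoE x : 0 < x -> gamma_quo x = ga (x + s) / ga x.
Proof.
move=> x0; rewrite /gamma_quo /gamma_quo1 gamma_integralD1//.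
have G := gamma_integral_gt0 x0; move: (ga (x + s)) (ga x) G => A B B0.
by field; rewrite !gt_eqF.
Qed.

Lemma gamma_quo_gt0 x : 0 < x -> 0 < gamma_quo x.
Proof. by move=> x0; have h0 := s0; rewrite mulr_gt0// gamma_quo1_gt0//; lra. Qed.

Lemma gamma_quo_le x : 0 < x -> gamma_quo x <= x `^ s.
Proof.
by move=> x0; rewrite gamma_quoE// ler_pdivrMr ?gamma_integral_gt0// gamma_integral_shift_le.
Qed.

(** The upper bound at x + s with exponent 1 - s, which bounds Gamma(x + 1) = x Gamma(x) by Gamma(x
    + s). *)
Lemma gamma_quo_ge x : 0 < x -> x / (x + s) * x `^ s <= gamma_quo x.
Proof.
move=> x0; have h0 := s0; have h1 := s1.
have xs0 : 0 < x + s by lra.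
have t01 : 0 < 1 - s < 1 by lra.
have := gamma_integral_shift_le xs0 t01.
rewrite (_ : x + s + (1 - s) = x + 1); last by ring.
rewrite gamma_integralD1// => H.
apply: (@le_trans _ _ (x / (x + s) * (x + s) `^ s)).
  apply: ler_wpM2l; first by rewrite divr_ge0 ?ltW.
  by apply: ge0_ler_powR; rewrite ?nnegrE ?ltW// ltrDl.
rewrite gamma_quoE// ler_pdivlMr ?gamma_integral_gt0//.
have E : (x + s) `^ (1 - s) * (x + s) `^ s = x + s.
  by rewrite -powRDg// subrK powRr1// ltW.
have P0 : 0 < (x + s) `^ s by exact: powR_gt0.
have -> : x / (x + s) * (x + s) `^ s * ga x = (x + s) `^ s / (x + s) * (x * ga x) by ring.
apply: (le_trans (ler_wpM2l _ H)); first by rewrite divr_ge0 ?ltW.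
rewrite le_eqVlt; apply/orP; left; apply/eqP.
transitivity ((x + s) `^ (1 - s) * (x + s) `^ s / (x + s) * ga (x + s)); first by ring.
by rewrite E mulfV ?mul1r// gt_eqF.
Qed.

Lemma gamma_quo_shiftE x : - s < x -> gamma_quo x = x / (x + s) * gamma_quo (x + 1).
Proof.
move=> xs; have h0 := s0; have h1 := s1.
have d1 : x + 1 != 0 by rewrite gt_eqF//; lra.
have d2 : x + s != 0 by rewrite gt_eqF//; lra.
rewrite /gamma_quo gamma_quo1D1//; move: (gamma_quo1 x) => t.
by field; rewrite d1 d2.
Qed.

Lemma shift_ratio_ge (k : nat) x : k%:R < x -> k%:R / k.+1%:R <= x / (x + s).
Proof.
move=> kx; have h0 := s0; have h1 := s1.
have k0 : (0 : R) <= k%:R by [].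
rewrite ler_pdivrMr// mulrAC ler_pdivlMr; last by lra.
rewrite -natr1; nra.
Qed.

Lemma shift_ratio2_ge (k : nat) a b : k%:R < a -> k%:R < b ->
  (k%:R / k.+1%:R) ^+ 2 <= (a / (a + s)) * (b / (b + s)).
Proof.
by move=> ka kb; rewrite expr2; apply: ler_pM; rewrite ?divr_ge0//; exact: shift_ratio_ge.
Qed.

(** With the sum fixed, the ratio is 1 + c/(x y) for a constant c >= 0. It is the factor that
    [gamma_quo x * gamma_quo y] picks up when both arguments grow by 1. *)
Lemma shifted_ratio_le x y x' y' : 0 < x -> 0 < y -> 0 < x' -> 0 < y' ->
  x + y = x' + y' -> x * y <= x' * y' ->
  (x' + s) / x' * ((y' + s) / y') <= (x + s) / x * ((y + s) / y).
Proof.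
move=> x0 y0 x0' y0' S P; have h0 := s0.
have P0 : 0 < x * y by rewrite mulr_gt0.
have P0' : 0 < x' * y' by rewrite mulr_gt0.
rewrite !mulf_div ler_pdivrMr// mulrAC ler_pdivlMr//.
rewrite (_ : (x' + s) * (y' + s) = x' * y' + s * (x' + y') + s ^+ 2); last ring.
rewrite (_ : (x + s) * (y + s) = x * y + s * (x + y) + s ^+ 2); last ring.
rewrite -S.
have c0 : 0 <= s * (x + y) + s ^+ 2 by rewrite addr_ge0 ?sqr_ge0// mulr_ge0 ?ltW// addr_gt0.
rewrite -!addrA; move: P P0 P0' c0; move: (x * y) (x' * y') (s * _ + _ ^+ 2) => p p' c P P0 P0' c0.
nra.
Qed.

(** The counterpart for [gamma_quo1]: with the sum fixed the ratio is 1 - c/((x + 1)(y + 1)) with c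
    >= 0, so the monotonicity is reversed. *)
Lemma shifted_ratio1_le x y x' y' : - s < x -> - s < y -> - s < x' -> - s < y' ->
  x + y = x' + y' -> x * y <= x' * y' ->
  (x + s) / (x + 1) * ((y + s) / (y + 1)) <= (x' + s) / (x' + 1) * ((y' + s) / (y' + 1)).
Proof.
move=> x0 y0 x0' y0' S P; have h0 := s0; have h1 := s1.
have P0 : 0 < (x + 1) * (y + 1) by rewrite mulr_gt0//; lra.
have P0' : 0 < (x' + 1) * (y' + 1) by rewrite mulr_gt0//; lra.
rewrite !mulf_div ler_pdivrMr// mulrAC ler_pdivlMr//.
move: P0 P0'.
rewrite (_ : (x' + 1) * (y' + 1) = x' * y' + (x' + y') + 1); last ring.
rewrite (_ : (x + 1) * (y + 1) = x * y + (x + y) + 1); last ring.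
rewrite (_ : (x' + s) * (y' + s) = x' * y' + (x' + y') + 1 - (1 - s) * (x' + y' + 1 + s)); last ring.
rewrite (_ : (x + s) * (y + s) = x * y + (x + y) + 1 - (1 - s) * (x + y + 1 + s)); last ring.
rewrite -S.
have c0 : 0 <= (1 - s) * (x + y + 1 + s).
  by rewrite mulr_ge0//; lra.
move: c0; move: (_ * (_ + _ + _ + _)) => c c0.
have : 0 <= x' * y' - x * y by rewrite subr_ge0.
move: (x * y) (x' * y') (x + y) => p p' k d P0 P0'.
nra.
Qed.

Section comparison.
Variables a b a' b' : R.
Hypotheses (as_ : - s < a) (bs : - s < b) (as' : - s < a') (bs' : - s < b').
Hypothesis sumE : a + b = a' + b'.
Hypothesis prod_lt : a * b < a' * b'.

Let prodk (x : R) : (a + x) * (b + x) < (a' + x) * (b' + x).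
Proof.
rewrite (_ : (a + x) * (b + x) = a * b + x * (a + b) + x ^+ 2); last ring.
rewrite (_ : (a' + x) * (b' + x) = a' * b' + x * (a' + b') + x ^+ 2); last ring.
by rewrite sumE !ltrD2r.
Qed.

(** Shift both arguments by k. The quotient of the two sides does not decrease in k, by the
    comparison of the step factors, and in the limit it is at most 1, because [gamma_quo x] is
    asymptotic to x^s and the shifted products keep their order. *)
Lemma gamma_quo_shift_le : gamma_quo (a + 1) * gamma_quo (b + 1) <= gamma_quo (a' + 1) * gamma_quo (b' + 1).
Proof.
have h0 := s0; have h1 := s1.
pose u (k : nat) := gamma_quo (a + k.+1%:R) * gamma_quo (b + k.+1%:R).
pose v (k : nat) := gamma_quo (a' + k.+1%:R) * gamma_quo (b' + k.+1%:R).
have pos (x : R) (k : nat) : - s < x -> k%:R < x + k.+1%:R.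
  by rewrite -natr1 => xs; lra.
have pos0 (x : R) (k : nat) : - s < x -> 0 < x + k.+1%:R.
  by move=> xs; apply: le_lt_trans (pos x k xs).
apply: (@ratio_limit_le _ u v) => k.
- by rewrite mulr_gt0 ?gamma_quo_gt0 ?pos0.
- by rewrite mulr_gt0 ?gamma_quo_gt0 ?pos0.
- have S (x : R) : - s < x -> gamma_quo (x + k.+2%:R) = gamma_quo (x + k.+1%:R) * ((x + k.+1%:R + s) / (x + k.+1%:R)).
    by move=> xs; rewrite -natr1 addrA gamma_quoD1 ?pos0.
  rewrite /u /v !S//.
  have E := shifted_ratio_le (pos0 _ k as_) (pos0 _ k bs) (pos0 _ k as') (pos0 _ k bs') _ (ltW (prodk k.+1%:R)).
  have {}E := E ltac:(move: sumE; lra).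
  have G1 := gamma_quo_gt0 (pos0 _ k as_); have G2 := gamma_quo_gt0 (pos0 _ k bs).
  have G3 := gamma_quo_gt0 (pos0 _ k as'); have G4 := gamma_quo_gt0 (pos0 _ k bs').
  move: E G1 G2 G3 G4.
  move: (gamma_quo _) (gamma_quo _) (gamma_quo _) (gamma_quo _) (_ / (a' + _)) (_ / (b' + _)) (_ / (a + _)) (_ / (b + _)).
  move=> g1 g2 g3 g4 r1 r2 r3 r4 E G1 G2 G3 G4.
  rewrite [leLHS](_ : _ = (g1 * g2 * (g3 * g4)) * (r1 * r2)); last ring.
  rewrite [leRHS](_ : _ = (g1 * g2 * (g3 * g4)) * (r3 * r4)); last ring.
  by apply: ler_wpM2l => //; rewrite !mulr_ge0// ltW.
- rewrite /u /v.
  have A0 := pos0 _ k.+1 as_; have B0 := pos0 _ k.+1 bs.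
  have A0' := pos0 _ k.+1 as'; have B0' := pos0 _ k.+1 bs'.
  have kA (x : R) : - s < x -> k%:R < x + k.+2%:R.
    by move=> xs; apply: lt_trans (pos x k.+1 xs); rewrite ltr_nat.
  (* The upper bound x^s is used for (a, b) and the lower bound x/(x + s) x^s for (a', b'); the two
     lost factors x/(x + s) account for (k/(k+1))^2. *)
  apply: (@le_trans _ _ ((k%:R / k.+1%:R) ^+ 2 * ((a + k.+2%:R) * (b + k.+2%:R)) `^ s)).
    apply: ler_wpM2l; first exact: sqr_ge0.
    by rewrite powRM ?(ltW A0) ?(ltW B0)//; apply: ler_pM; rewrite ?(ltW (gamma_quo_gt0 _))// gamma_quo_le.
  apply: (@le_trans _ _ ((k%:R / k.+1%:R) ^+ 2 * ((a' + k.+2%:R) * (b' + k.+2%:R)) `^ s)).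
    apply: ler_wpM2l; first exact: sqr_ge0.
    apply: ge0_ler_powR; rewrite ?nnegrE ?(ltW h0)// ?mulr_ge0 ?(ltW A0) ?(ltW B0) ?(ltW A0') ?(ltW B0')//.
    exact: ltW.
  apply: (le_trans (ler_wpM2r _ (shift_ratio2_ge (kA _ as') (kA _ bs')))); first exact: powR_ge0.
  rewrite powRM ?(ltW A0') ?(ltW B0')// mulrACA; apply: ler_pM; rewrite ?gamma_quo_ge//.
  - by rewrite mulr_ge0 ?powR_ge0// divr_ge0 ?(ltW A0')// addr_ge0 ?(ltW A0') ?(ltW h0).
  - by rewrite mulr_ge0 ?powR_ge0// divr_ge0 ?(ltW B0')// addr_ge0 ?(ltW B0') ?(ltW h0).
Qed.

(** The same argument with the two pairs exchanged, since [gamma_quo1 x] behaves like x^(s-1), a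
    decreasing power. *)
Lemma gamma_quo1_prod_ge : gamma_quo1 a' * gamma_quo1 b' <= gamma_quo1 a * gamma_quo1 b.
Proof.
have h0 := s0; have h1 := s1.
pose u (k : nat) := gamma_quo1 (a' + k%:R) * gamma_quo1 (b' + k%:R).
pose v (k : nat) := gamma_quo1 (a + k%:R) * gamma_quo1 (b + k%:R).
have ps (x : R) (k : nat) : - s < x -> - s < x + k%:R.
  by move=> xs; apply: lt_le_trans xs _; rewrite lerDl.
have pos (x : R) (k : nat) : - s < x -> k%:R < x + k.+1%:R.
  by rewrite -natr1 => xs; lra.
have pos0 (x : R) (k : nat) : - s < x -> 0 < x + k.+1%:R.
  by move=> xs; apply: le_lt_trans (pos x k xs).
suff : u 0%N <= v 0%N by rewrite /u /v !addr0.
apply: (@ratio_limit_le _ u v) => k.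
- by rewrite mulr_gt0 ?gamma_quo1_gt0 ?ps.
- by rewrite mulr_gt0 ?gamma_quo1_gt0 ?ps.
- have S (x : R) : - s < x -> gamma_quo1 (x + k.+1%:R) = gamma_quo1 (x + k%:R) * ((x + k%:R + s) / (x + k%:R + 1)).
    by move=> xs; rewrite -natr1 addrA gamma_quo1D1 ?ps.
  rewrite /u /v !S//.
  have E := shifted_ratio1_le (ps _ k as_) (ps _ k bs) (ps _ k as') (ps _ k bs') _ (ltW (prodk k%:R)).
  have {}E := E ltac:(move: sumE; lra).
  have G1 := gamma_quo1_gt0 (ps _ k as_); have G2 := gamma_quo1_gt0 (ps _ k bs).
  have G3 := gamma_quo1_gt0 (ps _ k as'); have G4 := gamma_quo1_gt0 (ps _ k bs').
  move: E G1 G2 G3 G4.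
  move: (_ / (a' + _ + _)) (_ / (b' + _ + _)) (_ / (a + _ + _)) (_ / (b + _ + _)) (gamma_quo1 _) (gamma_quo1 _) (gamma_quo1 _) (gamma_quo1 _).
  move=> r1 r2 r3 r4 g1 g2 g3 g4 E G1 G2 G3 G4.
  rewrite [leLHS](_ : _ = (g1 * g2 * (g3 * g4)) * (r3 * r4)); last ring.
  rewrite [leRHS](_ : _ = (g1 * g2 * (g3 * g4)) * (r1 * r2)); last ring.
  by apply: ler_wpM2l => //; rewrite !mulr_ge0// ltW.
- rewrite /u /v.
  have A0 := pos0 _ k as_; have B0 := pos0 _ k bs.
  have A0' := pos0 _ k as'; have B0' := pos0 _ k bs'.
  have P0 : 0 < (a + k.+1%:R) * (b + k.+1%:R) by rewrite mulr_gt0.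
  have P0' : 0 < (a' + k.+1%:R) * (b' + k.+1%:R) by rewrite mulr_gt0.
  have hg (x : R) : 0 < x -> gamma_quo1 x = gamma_quo x / x by move=> x0; rewrite /gamma_quo mulrAC mulfV ?mul1r// gt_eqF.
  rewrite !hg// !mulf_div mulrA.
  apply: (@le_trans _ _ ((k%:R / k.+1%:R) ^+ 2 * ((a' + k.+1%:R) * (b' + k.+1%:R)) `^ (s - 1))).
    rewrite -mulrA; apply: ler_wpM2l; first exact: sqr_ge0.
    rewrite powRB1//; apply: ler_wpM2r; first by rewrite invr_ge0 ltW.
    by rewrite powRM ?(ltW A0') ?(ltW B0')//; apply: ler_pM; rewrite ?(ltW (gamma_quo_gt0 _))// gamma_quo_le.
  apply: (@le_trans _ _ ((k%:R / k.+1%:R) ^+ 2 * ((a + k.+1%:R) * (b + k.+1%:R)) `^ (s - 1))).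
    apply: ler_wpM2l; first exact: sqr_ge0.
    rewrite -(opprB 1 s) !powRN lef_pV2 ?posrE ?powR_gt0//.
    apply: ge0_ler_powR; rewrite ?nnegrE ?(ltW P0) ?(ltW P0')//; last exact: ltW.
    by lra.
  rewrite powRB1// mulrA; apply: ler_wpM2r; first by rewrite invr_ge0 ltW.
  apply: (le_trans (ler_wpM2r _ (shift_ratio2_ge (pos _ k as_) (pos _ k bs)))); first exact: powR_ge0.
  rewrite powRM ?(ltW A0) ?(ltW B0)// mulrACA; apply: ler_pM; rewrite ?gamma_quo_ge//.
  - by rewrite mulr_ge0 ?powR_ge0// divr_ge0 ?(ltW A0)// addr_ge0 ?(ltW A0) ?(ltW h0).
  - by rewrite mulr_ge0 ?powR_ge0// divr_ge0 ?(ltW B0)// addr_ge0 ?(ltW B0) ?(ltW h0).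
Qed.

(** [gamma_quo] changes sign at 0, inside the range of arguments. The product is factored once
    through [gamma_quo1] with coefficient a b, and once through the shifted [gamma_quo] with
    coefficient a b / ((a + s)(b + s)); both coefficients increase with a b. *)
Lemma gamma_quo_prod_lt : 0 < a + b -> gamma_quo a * gamma_quo b < gamma_quo a' * gamma_quo b'.
Proof.
move=> K0; have h0 := s0; have h1 := s1.
have xa := as_; have xb := bs; have xa' := as'; have xb' := bs'.
have a1 : 0 < a + 1 by lra.
have b1 : 0 < b + 1 by lra.
have D0 : 0 < (a + s) * (b + s) by rewrite mulr_gt0//; lra.
have D0' : 0 < (a' + s) * (b' + s) by rewrite mulr_gt0//; lra.
have F0 : 0 < a' * b' -> 0 <= a' / (a' + s) * (b' / (b' + s)).
  by move=> P0; rewrite mulf_div divr_ge0 ?ltW.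
have F : a / (a + s) * (b / (b + s)) < a' / (a' + s) * (b' / (b' + s)).
  rewrite !mulf_div ltr_pdivrMr// mulrAC ltr_pdivlMr//.
  rewrite (_ : (a' + s) * (b' + s) = a' * b' + s * (a' + b') + s ^+ 2); last ring.
  rewrite (_ : (a + s) * (b + s) = a * b + s * (a + b) + s ^+ 2); last ring.
  rewrite -sumE.
  have c0 : 0 < s * (a + b) + s ^+ 2 by rewrite addr_gt0 ?exprn_gt0// mulr_gt0.
  move: prod_lt c0; rewrite -!addrA; move: (a * b) (a' * b') (s * _ + _ ^+ 2) => p p' c pp c0.
  nra.
have E (x y : R) : - s < x -> - s < y ->
    x * y * (gamma_quo1 x * gamma_quo1 y) = x / (x + s) * (y / (y + s)) * (gamma_quo (x + 1) * gamma_quo (y + 1)).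
  by move=> xs ys; rewrite mulrACA -/(gamma_quo x) -/(gamma_quo y) (gamma_quo_shiftE xs) (gamma_quo_shiftE ys) mulrACA.
have PQ (x y : R) : gamma_quo x * gamma_quo y = x * y * (gamma_quo1 x * gamma_quo1 y) by rewrite /gamma_quo mulrACA.
have C := @compare_factorizations R _ _ _ _ _ _ _ _ (mulr_gt0 (gamma_quo_gt0 a1) (gamma_quo_gt0 b1)) gamma_quo_shift_le
  (mulr_gt0 (gamma_quo1_gt0 as') (gamma_quo1_gt0 bs')) gamma_quo1_prod_ge prod_lt F F0 (E _ _ as_ bs) (E _ _ as' bs').
by rewrite (PQ a b) (PQ a' b') (E _ _ as_ bs) (E _ _ as' bs').
Qed.

End comparison.
End gamma_ratio.

(** * The exponents *)

Section hardy_exponents.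
Context {R : realType} (N : nat) (s : R).
Hypothesis N2 : (2 <= N)%N.
Hypothesis s01 : 0 < s < 1.
Let s0 : 0 < s. Proof. by case/andP: s01. Qed.
Let s1 : s < 1. Proof. by case/andP: s01. Qed.
Let N2r : 2 <= N%:R :> R. Proof. by rewrite ler_nat. Qed.
Implicit Types t : R.

Definition mid : R := (2 * s - N%:R) / 2.

Lemma c_sE t : - N%:R < t < 2 * s ->
  c_s N s t = 2 `^ (2 * s) * (gamma_quo s ((N%:R - 2 * s + t) / 2) * gamma_quo s (- t / 2)).
Proof.
move=> /andP[t0 t1]; have h0 := s0; have h1 := s1; have n2 := N2r.
rewrite /c_s; congr (_ * _).
rewrite invfM (Gamma_inv (x := - t / 2)); last by lra.
rewrite (Gamma_inv (x := (N%:R - 2 * s + t) / 2)); last by lra.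
rewrite Gamma_gt0E; last by lra.
rewrite Gamma_gt0E; last by lra.
rewrite /gamma_quo /gamma_quo1.
rewrite (_ : (N%:R - 2 * s + t) / 2 + s = (N%:R + t) / 2); last by field.
rewrite (_ : - t / 2 + s = (2 * s - t) / 2); last by field.
move: (gamma_integral _) (gamma_integral _).
move=> A B; move: (gamma_integral _) (gamma_integral _) => D E.
ring.
Qed.

(** The arguments a = (N - 2s + t)/2 and b = -t/2 of [c_sE] have the fixed positive sum (N - 2s)/2
    and difference t - [mid], so that a b decreases with (t - mid)^2. *)
Lemma c_s_lt t t' : - N%:R < t < 2 * s -> - N%:R < t' < 2 * s ->
  (t' - mid) ^+ 2 < (t - mid) ^+ 2 -> c_s N s t < c_s N s t'.
Proof.
move=> t01 t01' H; have h0 := s0; have h1 := s1; have n2 := N2r.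
rewrite !c_sE// ltr_pM2l; last by rewrite powR_gt0.
move: t01 t01' H => /andP[t0 t1] /andP[t0' t1'] H.
apply: (gamma_quo_prod_lt s01); try by lra.
move: H; rewrite /mid; nra.
Qed.

Lemma c_s_mid : c_s N s mid = - mu0 N s.
Proof.
rewrite /c_s /mu0 opprK /mid; congr (_ * _).
rewrite (_ : (N%:R + (2 * s - N%:R) / 2) / 2 = (N%:R + 2 * s) / 4); last by field.
rewrite (_ : (2 * s - (2 * s - N%:R) / 2) / 2 = (N%:R + 2 * s) / 4); last by field.
rewrite (_ : - ((2 * s - N%:R) / 2) / 2 = (N%:R - 2 * s) / 4); last by field.
rewrite (_ : (N%:R - 2 * s + (2 * s - N%:R) / 2) / 2 = (N%:R - 2 * s) / 4); last by field.
by rewrite !expr2.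
Qed.

Let mid01 : - N%:R < mid < 2 * s.
Proof. by have h0 := s0; have n2 := N2r; rewrite /mid; lra. Qed.

Let c_s_inj t t' : - N%:R < t < 2 * s -> - N%:R < t' < 2 * s ->
  c_s N s t = c_s N s t' -> (t' - mid) ^+ 2 = (t - mid) ^+ 2.
Proof.
move=> t01 t01' E; apply/eqP; rewrite eq_le !leNgt; apply/andP; split; apply/negP => /c_s_lt H.
  by have := H t01' t01; rewrite E ltxx.
by have := H t01 t01'; rewrite E ltxx.
Qed.

Variables mu taum taup : R.
Hypothesis hm : is_tau_minus N s mu taum.
Hypothesis hp : is_tau_plus N s mu taup.

Let hm1 : - N%:R < taum < 2 * s.
Proof.
have [/andP[a b] _] := hm; have h0 := s0; have n2 := N2r.
by rewrite a (le_lt_trans b)//; have /andP[] := mid01.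
Qed.

Let hp1 : - N%:R < taup < 2 * s.
Proof.
have [/andP[a b] _] := hp; rewrite b andbT.
by apply: lt_le_trans a; have /andP[] := mid01.
Qed.

(** [c_s] takes equal values only at points equidistant from [mid], and the two exponents lie on
    opposite sides of it. *)
Lemma tau_sum : taum + taup = 2 * s - N%:R.
Proof.
have [/andP[_ a] E] := hm; have [/andP[b _] E'] := hp.
have H := c_s_inj hm1 hp1 (etrans E (esym E')).
have a' : 0 <= mid - taum by rewrite subr_ge0.
have b' : 0 <= taup - mid by rewrite subr_ge0.
have : taup - mid = mid - taum.
  apply/eqP; rewrite -(@eqrXn2 _ 2)//; apply/eqP.
  by rewrite H -[RHS]sqrrN opprB.
rewrite /mid; lra.
Qed.

Lemma tau_minus_mu0 : mu = mu0 N s -> taum = mid.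
Proof.
move=> muE; have [_ E] := hm; rewrite muE -c_s_mid in E.
have := c_s_inj hm1 mid01 E; rewrite subrr expr0n/= => /esym/eqP.
by rewrite sqrf_eq0 subr_eq0 => /eqP.
Qed.

Lemma tau_lt : mu0 N s < mu -> taum < taup.
Proof.
move=> mlt; have [/andP[_ a] E] := hm; have [/andP[b _] _] := hp.
rewrite lt_neqAle (le_trans a b) andbT; apply/eqP => tE.
have tm : taum = mid by apply/eqP; rewrite eq_le a tE b.
by move: mlt; rewrite -[mu0 N s]opprK -c_s_mid -tm E opprK ltxx.
Qed.

Lemma C_Ns_gt0 : 0 < C_Ns N s.
Proof.
have h0 := s0; have h1 := s1; have n2 := N2r.
rewrite /C_Ns !Gamma_gt0E; try lra.
have P1 : 0 < (N%:R + 2 * s) / 2 by lra.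
have P2 : 0 < 1 - s by lra.
apply: mulr_gt0; last by rewrite divr_gt0 ?gamma_integral_gt0.
by apply: mulr_gt0 => //; apply: mulr_gt0; rewrite powR_gt0 ?pi_gt0.
Qed.

End hardy_exponents.

Section hardy_weights.
Context {R : realType} (n : nat) (s al be : R).
Hypothesis n2 : (2 <= n)%N.
Hypothesis s01 : 0 < s < 1.
Hypothesis al0 : - n%:R < al.
Hypothesis albe : al <= be.
Hypothesis sumE : al + be = 2 * s - n%:R.
Let s1 : s < 1. Proof. by case/andP: s01. Qed.
Let n2r : 2 <= n%:R :> R. Proof. by rewrite ler_nat. Qed.

(** The margin [h] of [weights]: a quarter of the distance from al to the integrability threshold
    -n, capped at 1. *)
Definition step : R := Num.min 1 ((n%:R + al) / 4).

Lemma step01 : 0 < step <= 1.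
Proof.
rewrite /step lt_min ltr01 /= ge_min lexx /= andbT.
by rewrite divr_gt0// -ltrBlDl sub0r.
Qed.

Lemma step_le : - n%:R + 4 * step <= al.
Proof.
have : step <= (n%:R + al) / 4 by rewrite /step ge_min lexx orbT.
by move: step => h; lra.
Qed.

Let al_lt0 : al < 0.
Proof. by have := s1; have := n2r; have := sumE; have := albe; lra. Qed.

Lemma powR0_al : 0 `^ al = 0 :> R.
Proof. by rewrite powR0 ?lt_eqF ?al_lt0. Qed.

Lemma powR_symm_sum_ge1 (r k : R) : 0 < r -> 0 <= k -> 1 <= r `^ k + r `^ (- k).
Proof.
move=> r0 k0; have [r1|r1] := leP 1 r.
  by rewrite -[leLHS]addr0; apply: lerD; rewrite ?powR_ge0 ?powR_ge1.
rewrite -[leLHS]add0r; apply: lerD; rewrite ?powR_ge0//.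
by apply: powRN_ge1; rewrite // r0 (ltW r1).
Qed.

Lemma ln_le_powR (r k : R) : 0 < r -> 0 < k -> `|ln r| <= k^-1 * (r `^ k + r `^ (- k)).
Proof.
move=> r0 k0.
have H (t a : R) : 0 < t -> 0 < a -> ln t <= a^-1 * t `^ a.
  move=> t0 a0; rewrite ler_pdivlMl//.
  have := expR_ge1Dx (a * ln t); rewrite -powR_expR// => h; lra.
rewrite ler_norml; apply/andP; split.
  rewrite lerNl -lnV ?posrE//; apply: (le_trans (H _ k _ k0)); first by rewrite invr_gt0.
  apply: ler_wpM2l; first by rewrite invr_ge0 ltW.
  by rewrite -powR_inv1 ?(ltW r0)// -powRrM mulN1r lerDr powR_ge0.
apply: (le_trans (H _ k r0 k0)); apply: ler_wpM2l; first by rewrite invr_ge0 ltW.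
by rewrite lerDl powR_ge0.
Qed.

Definition phi1 (r : R) : R := r `^ al.
(** This is t^al - t^be for t > 0. The factor [t] forces the value 0 at t = 0, where 0^be would be 1
    for be = 0. *)
Definition p1 (t : R) : R := t * (t `^ (al - 1) - t `^ (be - 1)).
Definition phi0 (r : R) : R := - (r `^ al) * ln r.
Definition p0 (t : R) : R := t * t `^ (al - 1) * - ln t.

Lemma p1E t : 0 < t -> p1 t = t `^ al - t `^ be.
Proof. by move=> t0; rewrite /p1 !powRB1// -mulrBl mulrC divfK// gt_eqF. Qed.

Lemma p0E t : 0 < t -> p0 t = t `^ al * - ln t.
Proof. by move=> t0; rewrite /p0 powRB1// [t * _]mulrC divfK// gt_eqF. Qed.

Lemma p1_gt0 t : al < be -> 0 < t < 1 -> 0 < p1 t.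
Proof.
move=> ab /andP[t0 t1]; rewrite p1E// subr_gt0 !powR_expR// ltr_expR.
by rewrite ltr_nM2r// ln_lt0// t0.
Qed.

Lemma p0_gt0 t : 0 < t < 1 -> 0 < p0 t.
Proof.
move=> /andP[t0 t1]; rewrite p0E// mulr_gt0 ?powR_gt0//.
by rewrite oppr_gt0 ln_lt0// t0.
Qed.

Lemma powR_div (r t a : R) : 0 < r -> 0 < t -> (t / r) `^ a = t `^ a * r `^ (- a).
Proof.
by move=> r0 t0; rewrite powRM ?(ltW t0) ?invr_ge0 ?(ltW r0)// -powR_inv1 ?(ltW r0)// -powRrM mulN1r.
Qed.

Lemma weights1 : al < be -> weights n s al be step phi1 p1.
Proof.
move=> ab; split.
- exact: ltnW.
- exact: s01.
- exact: step01.
- exact: sumE.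
- exact: albe.
- exact: step_le.
- exact: measurable_powR.
- apply: measurable_funM => //.
  by apply: measurable_funB; exact: measurable_powR.
- exact: powR0_al.
- by rewrite /p1 mul0r.
- move=> r t r0; rewrite le_eqVlt => /predU1P[<-|t0].
    by rewrite gam0 /phi1 powR0_al mul0r !mulr0 subrr mul0r /p1 mul0r mulr0 oppr0.
  rewrite !gamE// p1E ?divr_gt0// !powR_div// -sumE powRDg// /phi1.
  rewrite !powRN.
  have : r `^ al != 0 by rewrite gt_eqF// powR_gt0.
  have : r `^ be != 0 by rewrite gt_eqF// powR_gt0.
  move: (r `^ al) (r `^ be) (t `^ al) (t `^ be) => A B D E B0 A0.
  by field; rewrite A0 B0.
- exists 1 => // r r0; rewrite mul1r ger0_norm ?powR_ge0//.
  rewrite -[leLHS]mulr1; apply: ler_wpM2l; first exact: powR_ge0.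
  by apply: powR_symm_sum_ge1 => //; rewrite divr_ge0// ltW//; case/andP: step01.
- by move=> t t01; rewrite ltW// p1_gt0.
(* Factor out t^al and use 1 - expR y <= - y at y = (be - al) ln t. *)
- exists (be - al) => [|t /andP[t0 t1]]; first by rewrite subr_ge0.
  rewrite p1E// mulrCA.
  rewrite (_ : t `^ al - t `^ be = t `^ al * (1 - t `^ (be - al))); last first.
    by rewrite mulrBr mulr1 -powRDg// [al + _]addrC subrK.
  apply: ler_wpM2l; first exact: powR_ge0.
  by have := expR_ge1Dx ((be - al) * ln t); rewrite -powR_expR//; lra.
Qed.

Lemma weights0 : al = be -> weights n s al be step phi0 p0.
Proof.
move=> ab; split.
- exact: ltnW.
- exact: s01.
- exact: step01.
- exact: sumE.
- exact: albe.
- exact: step_le.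
- apply: measurable_funM; last exact: measurable_ln.
  by have H := measurableT_comp (@oppr_measurable R setT) (@measurable_powR R al); exact: H.
- apply: measurable_funM.
    by apply: measurable_funM => //; exact: measurable_powR.
  by have H := measurableT_comp (@oppr_measurable R setT) (@measurable_ln R); exact: H.
- by rewrite /phi0 powR0_al oppr0 mul0r.
- by rewrite /p0 !mul0r.
- move=> r t r0; rewrite le_eqVlt => /predU1P[<-|t0].
    by rewrite gam0 /phi0 powR0_al oppr0 !mul0r !mulr0 subrr /p0 !mul0r mulr0 oppr0.
  rewrite -ab !gamE// p0E ?divr_gt0// powR_div// -sumE -ab powRDg// /phi0.
  rewrite lnM ?posrE ?invr_gt0// lnV ?posrE// powRN.
  have : r `^ al != 0 by rewrite gt_eqF// powR_gt0.
  move: (r `^ al) (t `^ al) (ln r) (ln t) => A B D E A0.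
  by field.
(* The powers with exponents h/2 and -h/2 in the bound on [phi] are there to absorb this
   logarithm. *)
- have h20 : 0 < step / 2 by rewrite divr_gt0//; case/andP: step01.
  exists (step / 2)^-1 => [|r r0]; first by rewrite invr_ge0 ltW.
  rewrite /phi0 normrM normrN [`|r `^ al|]ger0_norm; last exact: powR_ge0.
  rewrite [leRHS]mulrCA.
  by apply: ler_wpM2l; [exact: powR_ge0|exact: ln_le_powR].
- by move=> t t01; rewrite ltW// p0_gt0.
- by exists 1 => // t /andP[t0 t1]; rewrite p0E// mul1r.
Qed.

End hardy_weights.

(** * Conclusion *)

Lemma test_funP {R : realType} (n : nat) (xi : 'rV[R]_n -> R) : is_C2c xi ->
  exists C C2 rho, test_fun xi C C2 rho.
Proof.
move=> xiC.
have [C C0 H1] := test_lipschitz xiC.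
have [C2 C20 H2] := test_second_difference xiC.
have [rho r1 H3] := test_support xiC.
by exists C, C2, rho; split.
Qed.

Section pairing.
Context {R : realType} (n : nat) (s al be h : R) (phi p : R -> R).
Hypothesis W : weights n s al be h phi p.
Local Notation lam := (@lam R n).
Local Notation riesz := (riesz s).
Local Notation log_density := (log_density s p).
Let n_gt0 := w_n W.
Let W1 := n%:R * fine (lam (cball 1)).
Let C : R := C_Ns n s.
Let Iml : \bar R := (\int[lam]_z (log_density 1 z)%:E)%E.

Let Iml_fin : Iml \is a fin_num.
Proof. by apply: integrable_fin_num => //; exact: (log_density_integrable W (lexx 1)). Qed.

Lemma measurable_riesz_sub (x : 'rV[R]_n) : measurable_fun setT (fun z : 'rV[R]_n => riesz (x - z)).
Proof. by apply: measurable_riesz; exact: measurable_rV_sub. Qed.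

Lemma riesz_div (a : R) (z : 'rV[R]_n) : a / enorm z `^ (n%:R + 2 * s) = a * riesz z.
Proof. by rewrite /riesz powRN. Qed.

Lemma integral_log_density_gt0 : (forall t, 0 < t < 1 -> 0 < p t) -> (0 < Iml)%E.
Proof.
move=> p_gt0.
pose D : set 'rV[R]_n := cball 2^-1 `\` [set 0].
have m0 := @measurable_origin R n.
have mD : measurable D by apply: measurableD => //; exact: measurable_cball.
have mml := measurable_log_density W 1.
apply: (@lt_le_trans _ _ (\int[lam]_(z in D) (log_density 1 z)%:E)%E); last first.
  apply: ge0_subset_integral => //; first exact/measurable_EFinP.
  by move=> z _; rewrite lee_fin log_density_ge0.
apply: integral_gt0 => //; first exact: measurable_funTS.
- have E : (lam (cball 2^-1) = lam D + lam [set 0%R])%E.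
    rewrite -measureU//; last by rewrite /D setDE -setIA setICl setI0.
    congr (lam _); rewrite /D setUC setDUK// => z /= ->.
    by rewrite /cball/= enorm0 invr_ge0.
  have c0 : (0 < lam (cball (2^-1 : R)))%E
    by rewrite lam_cball// mule_gt0 ?cball_gt0// lte_fin exprn_gt0.
  by move: c0; rewrite E lam_set0// adde0.
- move=> z [zc /eqP z0].
  have z0' : 0 < enorm z by rewrite enorm_gt0.
  have z1 : enorm z < 1 by apply: le_lt_trans zc _; rewrite invf_lt1// ltr1n.
  rewrite /log_density /mass_density z1 mul1r; apply: mulr_gt0; last by rewrite oppr_gt0 ln_lt0// z0'.
  apply: mulr_gt0.
    by rewrite normr_gt0 gt_eqF// p_gt0// z0'.
  rewrite /riesz powR_gt0// enorm_gt0 subr_eq0; apply/eqP => ez.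
  by move: z1; rewrite -ez enorm_e1// ltxx.
Qed.

Lemma normalization_value (f : 'rV[R]_n -> R) : measurable_fun setT f ->
  (forall z, 0 < enorm z < 1 -> f z = `|p (enorm z)| * riesz (e1 n - z)) ->
  (\int[@lebesgue_measure R]_(t in `]0%R, 1%R[) ((t^-1)%:E * \int[lam]_(z in eball 0 t) (f z)%:E) = Iml)%E.
Proof.
move=> mf fE; rewrite /Iml -(layer_cake W); apply: eq_integral => t.
rewrite inE/= in_itv/= => /andP[_ t1].
by rewrite (integral_eball W mf (ltW t1) fE).
Qed.

Lemma normalization_bounds : 0 < C -> (forall t, 0 < t < 1 -> 0 < p t) ->
  (0 < C%:E * omega R n * Iml < +oo)%E.
Proof.
move=> C0 p0; have I0 := integral_log_density_gt0 p0.
have w0 : 0 < W1.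
  by rewrite /W1 mulr_gt0 ?ltr0n// fine_gt0// cball_gt0 ?cball_finite.
rewrite (omegaE n_gt0) -/W1.
move: Iml_fin I0; case: Iml => [r||]// _ r0.
rewrite -!EFinM ltry andbT lte_fin; apply: mulr_gt0; last by [].
exact: mulr_gt0.
Qed.

(** [Gamma_mu] and [gam] may differ at z = 0, which is a null set. *)
Lemma wfl_truncE (xi : 'rV[R]_n -> R) x e : measurable_fun setT xi ->
  wfl_trunc s be xi x e = wfl_cut s be xi e x.
Proof.
move=> mxi.
have meb : measurable (~` eball x e).
  apply: measurableC; rewrite (_ : eball _ _ = [set z | enorm (x - z) < e]).
    apply: measurable_ltr_set => //; apply: measurable_enorm.
    exact: measurable_rV_sub.
  by apply/seteqP; split => z /=; rewrite /eball/= enormB.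
rewrite /wfl_trunc /wfl_cut integral_mkcond.
have E z : (xi x - xi z) / enorm (x - z) `^ (n%:R + 2 * s) * Gamma_mu be z =
    (xi x - xi z) * riesz (x - z) * enorm z `^ be by rewrite riesz_div.
apply: ae_eq_integral => //.
- apply/(measurable_restrictT _ meb)/measurable_EFinP; apply: measurable_funTS.
  under eq_fun do rewrite E.
  apply: measurable_funM; last exact: measurable_enorm_powR.
  by apply: measurable_funM; [exact: measurable_funB|exact: measurable_riesz_sub].
- apply/measurable_EFinP; apply: measurable_funM.
    apply: measurable_nat_ler => //; apply: measurable_enorm.
    exact: measurable_rV_sub.
  apply: measurable_funM.
    by apply: measurable_funM; [exact: measurable_funB|exact: measurable_riesz_sub].
  have H := measurableT_comp (@measurable_gam R be) (@measurable_enorm_id R n); exact: H.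
exists [set 0]; split.
- exact: measurable_origin.
- exact: lam_set0.
move=> z /= /not_implyP[_ zN]; apply/eqP/negP => /negP z0; apply: zN.
have zE : (z \in ~` eball x e) = (e <= enorm (x - z)).
  by apply/idP/idP; rewrite inE /eball/= enormB; [move/negP; rewrite -leNgt|rewrite leNgt => /negP].
rewrite patchE zE /cut /psi; case: ifP => _; last by rewrite mul0r.
by rewrite mul1r E gamE// enorm_gt0.
Qed.

Lemma wfl_trunc_cvg (xi : 'rV[R]_n -> R) C1 C2 rho x : test_fun xi C1 C2 rho -> x != 0 ->
  wfl_trunc s be xi x eps @[eps --> 0^'+] --> wfl_lim s be xi x.
Proof.
move=> T x0; have mxi := lipschitz_measurable (t_C T) (t_lip T).
rewrite (_ : (fun e => _) = (fun e => wfl_cut s be xi e x)); last first.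
  by apply/funext => e; exact: wfl_truncE.
exact: (wfl_cut_cvg_right W T x0).
Qed.

Lemma pairing_value (xi : 'rV[R]_n -> R) C1 C2 rho : test_fun xi C1 C2 rho ->
  lam.-integrable setT (fun x => (phi (enorm x))%:E * wfl s be xi x)%E /\
  (\int[lam]_x ((phi (enorm x))%:E * wfl s be xi x) =
    C%:E * omega R n * Iml * (xi 0)%:E)%E.
Proof.
move=> T; have [I V] := pairing_wfl_lim W T.
have E x : ((phi (enorm x))%:E * wfl s be xi x = C%:E * ((phi (enorm x))%:E * wfl_lim s be xi x))%E.
  have [->|x0] := eqVneq x 0; first by rewrite enorm0 (w_phi0 W) !mul0e mule0.
  by rewrite /wfl (cvg_lim _ (wfl_trunc_cvg T x0))// muleCA.
split.
  by apply: eq_integrable (integrableZl measurableT C I) => // x _; rewrite E.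
under eq_integral do rewrite E.
rewrite (integralZl measurableT I) V (trunc_pairing1 W T) -/W1.
under eq_integral do rewrite EFinM.
rewrite (integralZl measurableT (log_density_integrable W (lexx 1))) -/Iml (omegaE n_gt0) -/W1.
rewrite -!muleA; congr (_ * _)%E.
by rewrite muleC muleA.
Qed.

End pairing.

Theorem theorem1p3 (R : realType) (N : nat) (s mu taum taup : R)
    (hN : (2 <= N)%N) (hs : 0 < s < 1) (hmu : mu0 N s <= mu)
    (htaum : is_tau_minus N s mu taum) (htaup : is_tau_plus N s mu taup) :
  (0 < c_smu N s mu taum taup < +oo)%E /\
  forall xi : 'rV[R]_N -> R, is_C2c xi ->
    [/\ forall x : 'rV[R]_N, x != 0 ->
          exists l : R, wfl_trunc s taup xi x eps @[eps --> 0^'+] --> l%:E,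
        (lebesgue_rV N).-integrable setT
          (fun x => (Phi_mu s mu taum x)%:E * wfl s taup xi x)%E
      & (\int[lebesgue_rV N]_x ((Phi_mu s mu taum x)%:E * wfl s taup xi x)
         = c_smu N s mu taum taup * (xi 0)%:E)%E].
Proof.
have C0 := C_Ns_gt0 hN hs.
have sumE := tau_sum hN hs htaum htaup.
have al0 : - N%:R < taum by case: htaum => /andP[].
have ab : taum <= taup by case: htaum htaup => [/andP[_ a] _] [/andP[b _] _]; exact: le_trans b.
have mf (g : R -> R) : measurable_fun setT g ->
    measurable_fun setT (fun z : 'rV[R]_N => g (enorm z) / enorm (e1 N - z) `^ (N%:R + 2 * s)).
  move=> mg; under eq_fun do rewrite riesz_div.
  apply: measurable_funM; last exact: measurable_riesz_sub.
  by have H := measurableT_comp mg (@measurable_enorm_id R N); exact: H.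
(* The two cases of mu are separated only here: each supplies its profiles and the matching form of
   the constant. *)
have [phi [p [W p_gt0 PhiE cE]]] : exists phi p, [/\ weights N s taum taup (step N taum) phi p,
    forall t, 0 < t < 1 -> 0 < p t,
    forall x : 'rV[R]_N, Phi_mu s mu taum x = phi (enorm x) &
    c_smu N s mu taum taup = ((C_Ns N s)%:E * omega R N * \int[lam (n:=N)]_z (log_density s p 1 z)%:E)%E].
  have [mlt|mle] := ltP (mu0 N s) mu.
    have lt := tau_lt htaum htaup mlt.
    have W := weights1 hN hs al0 ab sumE lt.
    exists (phi1 taum), (p1 taum taup); split => //.
    - by move=> t; exact: p1_gt0.
    - by move=> x; rewrite /Phi_mu mlt.
    - rewrite /c_smu mlt; congr (_ * _)%E; apply: (normalization_value W).
        apply: (mf (fun r => r `^ taum - r `^ taup)).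
        by apply: measurable_funB; exact: measurable_powR.
      move=> z /andP[z0 z1]; rewrite riesz_div -p1E// ger0_norm//.
      by rewrite ltW// p1_gt0// z0.
  have muE : mu = mu0 N s by apply/eqP; rewrite eq_le mle.
  have amid := tau_minus_mu0 hN hs htaum muE.
  (* At mu = mu0 both exponents are [mid], the exponent written out in the second case of the
     constant. *)
  have eq : taum = taup by move: sumE; rewrite amid /mid; lra.
  have W := weights0 hN hs al0 ab sumE eq.
  exists (phi0 taum), (p0 taum); split => //.
  - by move=> t; exact: p0_gt0.
  - by move=> x; rewrite /Phi_mu ltNge mle.
  - rewrite /c_smu ltNge mle; congr (_ * _)%E; apply: (normalization_value W).
      apply: (mf (fun r => r `^ ((2 * s - N%:R) / 2) * - ln r)).
      apply: measurable_funM; first exact: measurable_powR.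
      by have H := measurableT_comp (@oppr_measurable R setT) (@measurable_ln R); exact: H.
    move=> z /andP[z0 z1]; rewrite riesz_div -/(mid N s) -amid -p0E// ger0_norm//.
    by rewrite ltW// p0_gt0// z0.
split; first by rewrite cE; exact: (normalization_bounds W C0 p_gt0).
move=> xi /test_funP[C [C2 [rho T]]].
have [I V] := pairing_value W T.
split.
- move=> x x0; have F : wfl_lim s taup xi x \is a fin_num by exact: (wfl_lim_fin W T).
  by exists (fine (wfl_lim s taup xi x)); rewrite fineK//; exact: (wfl_trunc_cvg W T).
- by under eq_fun do rewrite PhiE.
- by rewrite cE -V; apply: eq_integral => x _; rewrite PhiE.
Qed.
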